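(* Let $r\ge1$, let $a_1,\dots,a_r$ be positive real numbers, let $x$ be a complex number with $\operatorname{Re}(x)>0$, and let $u\in\mathbb{C}$ with $|u|\ge1$ (powers $u^{w}$ taken as $\exp(w\log u)$ for a fixed branch of $\log u$). Let $$l_r(s,x;u\mid a_1,\dots,a_r)=\sum_{n_1,\dots,n_r=0}^{\infty}\frac{u^{-(n_1a_1+\cdots+n_ra_r)}}{(x+n_1a_1+\cdots+n_ra_r)^{s}}\qquad(\operatorname{Re}(s)>r),$$ extended in $s$ by analytic continuation. Then for every integer $n\ge0$, $$\prod_{j=1}^{r}\left(1-u^{-a_j}\right)\, l_r(-n,x;u\mid a_1,\dots,a_r)=H_{r,n}(x,u\mid a_1,\dots,a_r).$$
   Context: The numbers $H_{r,n}(x,u\mid a_1,\dots,a_r)$ are defined by the generating function $\prod_{j=1}^{r}\frac{1-u^{a_j}}{e^{a_jt}-u^{a_j}}\,e^{xt}=\sum_{n\ge0}H_{r,n}(x,u\mid a_1,\dots,a_r)\frac{t^n}{n!}$. *)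

(* Defs.v *)
(* Stdlib real numbers and Coquelicot complex numbers. *)
From Stdlib Require Import Reals List Factorial.
From Coquelicot Require Import Coquelicot.
Import ListNotations.
Open Scope R_scope.

Definition Cexp (z : C) : C := (exp (Re z) * cos (Im z), exp (Re z) * sin (Im z)).

(* Principal argument, with values in (-PI, PI]; meaningless at z = 0. *)
Definition Carg (z : C) : R :=
  if Rle_dec 0 (Im z) then acos (Re z / Cmod z) else - acos (Re z / Cmod z).

Definition Clog (z : C) : C := (ln (Cmod z), Carg z).

(* z ^ s with the principal branch. *)
Definition Cpower (z s : C) : C := Cexp (s * Clog z).

(* u ^ w, where logu is the chosen logarithm of u. *)
Definition upow (logu w : C) : C := Cexp (w * logu).

Definition Csum (l : list C) : C := fold_right Cplus (RtoC 0) l.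
Definition Cprod (l : list C) : C := fold_right Cmult (RtoC 1) l.

(* n_1 a_1 + ... + n_r a_r *)
Fixpoint dot (n : list nat) (a : list R) : R :=
  match n, a with
  | k :: n', b :: a' => INR k * b + dot n' a'
  | _, _ => 0
  end.

(* Multi-indices (n_1, ..., n_r) are lists of length r, finite sets of them are
   duplicate-free lists, and the r-fold series is summed unconditionally (over
   C this is the same as absolute convergence). *)
Definition multi_indices (r : nat) (F : list (list nat)) : Prop :=
  NoDup F /\ forall n, In n F -> length n = r.

Definition is_multi_series (r : nat) (f : list nat -> C) (S : C) : Prop :=
  forall eps : R, 0 < eps ->
  exists F0, multi_indices r F0 /\
    forall F, multi_indices r F -> incl F0 F ->
      Cmod (Csum (map f F) - S) < eps.

Definition l_term (logu s x : C) (a : list R) (n : list nat) : C :=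
  (upow logu (- RtoC (dot n a)) / Cpower (x + RtoC (dot n a)) s)%C.

Definition analytic_on (D : C -> Prop) (f : C -> C) : Prop :=
  forall z, D z -> exists (rho : R) (c : nat -> C), 0 < rho /\
    forall w, Cmod (w - z) < rho ->
      @is_pseries C_AbsRing C_NormedModule c (w - z)%C (f w).

Definition connected (D : C -> Prop) : Prop :=
  forall U V : C -> Prop, open U -> open V ->
    (forall z, D z -> U z \/ V z) ->
    (exists z, D z /\ U z) -> (exists z, D z /\ V z) ->
    exists z, D z /\ U z /\ V z.

(* l is the analytic continuation of s |-> l_r(s, x; u | a_1, ..., a_r) from the
   half-plane Re s > r to the domain D. *)
Definition is_l_continuation (logu x : C) (r : nat) (a : list R)
    (D : C -> Prop) (l : C -> C) : Prop :=
  open D /\ connected D /\ (forall s, INR r < Re s -> D s) /\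
  analytic_on D l /\
  (forall s, INR r < Re s -> is_multi_series r (l_term logu s x a) (l s)).

Definition H_genfun (logu x : C) (a : list R) (t : C) : C :=
  (Cprod (map (fun b : R =>
      (1 - upow logu b) / (Cexp (b * t) - upow logu b)) a) * Cexp (x * t))%C.

(* H n = H_{r,n}(x, u | a_1, ..., a_r).  The neighbourhood of 0 is punctured
   because a factor with u ^ a_j = 1 has the form 0 / 0 at t = 0; such a factor
   is the zero function. *)
Definition is_H (logu x : C) (a : list R) (H : nat -> C) : Prop :=
  exists rho : R, 0 < rho /\
    forall t : C, 0 < Cmod t < rho ->
      @is_series C_AbsRing C_NormedModule
        (fun n => (H n * (t ^ n / INR (fact n)))%C) (H_genfun logu x a t).

(* Main.v *)
(* Write q_j = u^(-a_j), so |q_j| <= 1.  One constructs, by induction on r, the function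
   G_r(s, d) = s (s + 1) ... (s + r - 1) l_r(s + r, x + d), entire in s, starting from
   G_0(s, d) = (x + d)^(-s): the passage from G = G_(r-1) to F = G_r solves
   F(s, d) - q F(s, d + a) = s G(s + 1, d).  Since d/dd acts on these families as the operator
   D : G |-> -s G(s + 1, d), the formal solution is the power series D / (q e^(aD) - 1) applied to G
   (regular at D = 0 even for q = 1).  Truncating it at order K leaves an error of size
   d^(-Re s - K), whose sum along the progression d + n a converges for Re s > 2 - K and corrects
   the truncation; the result does not depend on K.  Taylor remainders in d are carried along
   as the inductive invariant.

   At s = -M the Taylor expansions in d are exact polynomials, so the difference equation becomes
   a recursion between the generating series of the values G_r(-M, 0), the same as the one defining
   e^(xt) / prod_j (1 - q_j e^(a_j t)).  If some q_j = 1, both sides of the theorem vanish.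

   Analyticity of the sums comes from Weierstrass' theorem, with Cauchy's estimates obtained by
   averaging over roots of unity; the identity theorem transfers the result to an arbitrary
   continuation. *)

Require Import Defs.
From Stdlib Require Import Reals List Arith ZArith Lra Lia.
From Stdlib Require Import Classical ClassicalEpsilon FunctionalExtensionality.
From Coquelicot Require Import Coquelicot.
Import ListNotations.
Open Scope R_scope.

(** * Finite sums and series of complex numbers *)

(** The shift of [s] by [r] and the rising factor are what make the induction uniform in [q]. The
    function l_r itself can have poles among s = 1, ..., r when some q_j equals 1, whereas the
    normalised families are always entire. The same factor [s] puts the D into the numerator of D /
    (q e^(aD) - 1), where it cancels the zero of the denominator at q = 1. On the circle |q| = 1 the
    powers of [q] give no decay, so all convergence has to come from the growth in [d]. Hence every
    bound is a power of 1 + d, and translation by [a] must be expanded to arbitrarily high order.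
    The expansion is formal: only the base family is really differentiated in [d]; later families
    carry just the bounds on their formal remainders. The theorem speaks of any continuation on any
    connected open domain. Existence uses one explicit domain; uniqueness is proved for the product
    of l with the rising factor, which is insensitive to the poles. *)

Fixpoint csum (f : nat -> C) (n : nat) : C :=
  match n with O => RtoC 0 | S m => (csum f m + f m)%C end.

Fixpoint rsum (f : nat -> R) (n : nat) : R :=
  match n with O => 0 | S m => rsum f m + f m end.

Lemma csum_S (f : nat -> C) n : csum f (S n) = (csum f n + f n)%C.
Proof. reflexivity. Qed.

Lemma csum_ext (f g : nat -> C) n :
  (forall k, (k < n)%nat -> f k = g k) -> csum f n = csum g n.
Proof.
  induction n as [|n IH]; intros H; simpl; [easy|].
  rewrite IH, (H n); auto with arith.
Qed.

Lemma csum_plus (f g : nat -> C) n :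
  csum (fun k => f k + g k)%C n = (csum f n + csum g n)%C.
Proof. induction n as [|n IH]; simpl; [|rewrite IH]; ring. Qed.

Lemma csum_scal (c : C) (f : nat -> C) n :
  csum (fun k => c * f k)%C n = (c * csum f n)%C.
Proof. induction n as [|n IH]; simpl; [|rewrite IH]; ring. Qed.

Lemma csum_const (c : C) n : csum (fun _ => c) n = (RtoC (INR n) * c)%C.
Proof.
  induction n as [|n IH]; [simpl; ring|].
  rewrite S_INR, RtoC_plus. simpl csum. rewrite IH. ring.
Qed.

Lemma csum_zero (f : nat -> C) n :
  (forall k, (k < n)%nat -> f k = RtoC 0) -> csum f n = RtoC 0.
Proof.
  intros H. rewrite (csum_ext f (fun _ => RtoC 0) n H), csum_const. ring.
Qed.

Lemma csum_add (f : nat -> C) n m :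
  csum f (n + m) = (csum f n + csum (fun k => f (n + k)%nat) m)%C.
Proof.
  induction m as [|m IH]; [rewrite Nat.add_0_r; simpl; ring|].
  rewrite Nat.add_succ_r. simpl. rewrite IH. ring.
Qed.

Lemma csum_S_l (f : nat -> C) n :
  csum f (S n) = (f O + csum (fun k => f (S k)) n)%C.
Proof.
  change (S n) with (1 + n)%nat. rewrite csum_add.
  change (csum f 1) with (RtoC 0 + f O)%C. change (fun k => f (1 + k)%nat) with (fun k => f (S k)). ring.
Qed.

Lemma csum_exchange (f : nat -> nat -> C) n m :
  csum (fun i => csum (f i) m) n = csum (fun j => csum (fun i => f i j) n) m.
Proof.
  induction n as [|n IH]; simpl.
  - symmetry. now apply csum_zero.
  - rewrite IH. now rewrite <- csum_plus.
Qed.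

Lemma csum_single (f : nat -> C) n k : (k < n)%nat ->
  (forall j, (j < n)%nat -> j <> k -> f j = RtoC 0) -> csum f n = f k.
Proof.
  induction n as [|n IH]; intros Hk H; [lia|]. simpl.
  destruct (Nat.eq_dec k n) as [->|Hn].
  - rewrite csum_zero; [ring|]. intros j Hj. apply H; lia.
  - rewrite IH; [|lia|intros; apply H; lia]. rewrite (H n); [ring|lia|lia].
Qed.

Lemma csum_Cmod (f : nat -> C) n : Cmod (csum f n) <= rsum (fun k => Cmod (f k)) n.
Proof.
  induction n as [|n IH]; simpl; [rewrite Cmod_0; lra|].
  eapply Rle_trans; [apply Cmod_triangle|]. lra.
Qed.

Lemma rsum_le (f g : nat -> R) n :
  (forall k, (k < n)%nat -> f k <= g k) -> rsum f n <= rsum g n.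
Proof.
  induction n as [|n IH]; intros H; simpl; [lra|].
  assert (f n <= g n) by (apply H; lia).
  assert (rsum f n <= rsum g n) by (apply IH; intros; apply H; lia). lra.
Qed.

Lemma rsum_scal (c : R) (f : nat -> R) n :
  rsum (fun k => c * f k) n = c * rsum f n.
Proof. induction n as [|n IH]; simpl; [|rewrite IH]; ring. Qed.

Lemma rsum_const (c : R) n : rsum (fun _ => c) n = INR n * c.
Proof. induction n as [|n IH]; [simpl; ring|]. rewrite S_INR; simpl; rewrite IH; ring. Qed.

Lemma rsum_mono (f : nat -> R) n m :
  (forall k, 0 <= f k) -> (n <= m)%nat -> rsum f n <= rsum f m.
Proof. intros H. induction 1 as [|m _ IH]; simpl; [lra|]. specialize (H m). lra. Qed.

Lemma csum_Cmod_le (f : nat -> C) (M : nat -> R) n :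
  (forall k, (k < n)%nat -> Cmod (f k) <= M k) -> Cmod (csum f n) <= rsum M n.
Proof. intros H. eapply Rle_trans; [apply csum_Cmod|]. now apply rsum_le. Qed.

Lemma csum_diff_le (f : nat -> C) (M : nat -> R) n m :
  (forall k, Cmod (f k) <= M k) -> (n <= m)%nat ->
  Cmod (csum f m - csum f n) <= rsum M m - rsum M n.
Proof.
  intros H. induction 1 as [|m _ IH]; simpl.
  - replace (csum f n - csum f n)%C with (RtoC 0) by ring. rewrite Cmod_0. lra.
  - replace (csum f m + f m - csum f n)%C with ((csum f m - csum f n) + f m)%C by ring.
    eapply Rle_trans; [apply Cmod_triangle|]. specialize (H m). lra.
Qed.

(** A summable majorant, given by an explicit bound on its partial sums so that the value of its
    series never has to be named. *)
Definition bounded_by (M : nat -> R) (B : R) : Prop :=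
  (forall k, 0 <= M k) /\ forall n, rsum M n <= B.

Lemma bounded_by_tail (M : nat -> R) B : bounded_by M B ->
  forall eps, 0 < eps -> exists N, forall n, (N <= n)%nat -> rsum M n - rsum M N < eps.
Proof.
  intros [H0 HB] eps He.
  destruct (growing_cv (rsum M)) as [l Hl].
  - intros n. simpl. specialize (H0 n). lra.
  - exists B. intros x [n ->]. apply HB.
  - assert (Hle : forall n, rsum M n <= l)
      by (apply growing_ineq; [intros n; simpl; specialize (H0 n); lra|exact Hl]).
    destruct (Hl eps He) as [N HN]. exists N. intros n Hn.
    specialize (HN N (le_n _)). unfold R_dist in HN.
    apply Rabs_def2 in HN. specialize (Hle n). lra.
Qed.

(** The partial sum [csum f n] stops before index [n], while Coquelicot's [sum_n] includes it; this
    accounts for the [S n] in [cser_is_series]. *)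
Definition cser (f : nat -> C) (l : C) : Prop :=
  forall eps, 0 < eps -> exists N, forall n, (N <= n)%nat -> Cmod (csum f n - l) < eps.

Lemma cser_is_series (f : nat -> C) (l : C) :
  cser f l <-> @is_series C_AbsRing C_NormedModule f l.
Proof.
  assert (Hs : forall n, @sum_n C_AbelianMonoid f n = csum f (S n)).
  { induction n as [|n IH].
    - rewrite sum_O. simpl. ring.
    - rewrite sum_Sn, IH. reflexivity. }
  unfold is_series. split; intros H.
  - apply (proj2 (filterlim_locally_ball_norm (F := eventually) _ l)).
    intros eps. destruct (H eps (cond_pos eps)) as [N HN]. exists N. intros n Hn.
    change (Cmod (minus (@sum_n C_AbelianMonoid f n) l) < eps). rewrite Hs. apply HN. lia.
  - intros eps He.
    destruct (proj1 (filterlim_locally_ball_norm (F := eventually) _ l) H (mkposreal eps He))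
      as [N HN].
    exists (S N). intros [|n] Hn; [lia|]. rewrite <- Hs. apply (HN n). lia.
Qed.

Lemma Cmod_le_eq (z : C) : (forall eps, 0 < eps -> Cmod z < eps) -> z = RtoC 0.
Proof.
  intros H. apply Cmod_eq_0. apply Rle_antisym; [|apply Cmod_ge_0].
  apply Rnot_lt_le. intros Hz. exact (Rlt_irrefl _ (H _ Hz)).
Qed.

Lemma Cmod_sub_sym (a b : C) : Cmod (a - b) = Cmod (b - a).
Proof. rewrite <- Cmod_opp. f_equal. ring. Qed.

Lemma Cmod_sub_triangle (a b c : C) : Cmod (a - c) <= Cmod (a - b) + Cmod (b - c).
Proof. replace (a - c)%C with ((a - b) + (b - c))%C by ring. apply Cmod_triangle. Qed.

Lemma cser_unique f l1 l2 : cser f l1 -> cser f l2 -> l1 = l2.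
Proof.
  intros H1 H2. apply Ceq_minus, Cmod_le_eq. intros eps He.
  destruct (H1 (eps / 2)) as [N1 HN1]; [lra|]. destruct (H2 (eps / 2)) as [N2 HN2]; [lra|].
  specialize (HN1 (N1 + N2)%nat ltac:(lia)). specialize (HN2 (N1 + N2)%nat ltac:(lia)).
  pose proof (Cmod_sub_triangle l1 (csum f (N1 + N2)) l2) as Ht.
  rewrite (Cmod_sub_sym l1 (csum f _)) in Ht. lra.
Qed.

Lemma cser_ext f g l : (forall n, f n = g n) -> cser f l -> cser g l.
Proof.
  intros H Hf eps He. destruct (Hf eps He) as [N HN]. exists N. intros n Hn.
  rewrite <- (csum_ext f g); auto.
Qed.

Lemma cser_plus f g l m :
  cser f l -> cser g m -> cser (fun n => f n + g n)%C (l + m)%C.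
Proof.
  intros H1 H2 eps He.
  destruct (H1 (eps / 2)) as [N1 HN1]; [lra|]. destruct (H2 (eps / 2)) as [N2 HN2]; [lra|].
  exists (N1 + N2)%nat. intros n Hn.
  specialize (HN1 n ltac:(lia)). specialize (HN2 n ltac:(lia)).
  rewrite csum_plus.
  replace (csum f n + csum g n - (l + m))%C with ((csum f n - l) + (csum g n - m))%C by ring.
  eapply Rle_lt_trans; [apply Cmod_triangle|]. lra.
Qed.

Lemma cser_scal c f l : cser f l -> cser (fun n => c * f n)%C (c * l)%C.
Proof.
  intros H eps He.
  assert (Hc : 0 < Cmod c + 1) by (pose proof (Cmod_ge_0 c); lra).
  destruct (H (eps / (Cmod c + 1))) as [N HN]; [now apply Rdiv_lt_0_compat|].
  exists N. intros n Hn. specialize (HN n Hn). rewrite csum_scal.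
  replace (c * csum f n - c * l)%C with (c * (csum f n - l))%C by ring.
  rewrite Cmod_mult. apply Rle_lt_trans with ((Cmod c) * (eps / (Cmod c + 1))).
  - apply Rmult_le_compat_l; [apply Cmod_ge_0|lra].
  - replace (Cmod c * (eps / (Cmod c + 1))) with (eps - eps / (Cmod c + 1)) by (field; lra).
    assert (0 < eps / (Cmod c + 1)) by now apply Rdiv_lt_0_compat. lra.
Qed.

Lemma cser_minus f g l m :
  cser f l -> cser g m -> cser (fun n => f n - g n)%C (l - m)%C.
Proof.
  intros H1 H2. replace (l - m)%C with (l + (-(1)) * m)%C by ring.
  eapply cser_ext; [|apply cser_plus; [exact H1|apply cser_scal, H2]].
  intros n. simpl. ring.
Qed.

Lemma cser_shift f l : cser f l <-> cser (fun n => f (S n)) (l - f O)%C.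
Proof.
  split; intros H eps He; destruct (H eps He) as [N HN].
  - exists N. intros n Hn. specialize (HN (S n) ltac:(lia)). rewrite csum_S_l in HN.
    replace (csum (fun k => f (S k)) n - (l - f O))%C
      with (f O + csum (fun k => f (S k)) n - l)%C by ring. exact HN.
  - exists (S N). intros [|n] Hn; [lia|]. specialize (HN n ltac:(lia)). rewrite csum_S_l.
    replace (f O + csum (fun k => f (S k)) n - l)%C
      with (csum (fun k => f (S k)) n - (l - f O))%C by ring. exact HN.
Qed.

Lemma cser_zero : cser (fun _ => RtoC 0) (RtoC 0).
Proof.
  intros eps He. exists O. intros n _. rewrite csum_zero; [|easy].
  replace (0 - 0)%C with (RtoC 0) by ring. now rewrite Cmod_0.
Qed.

Lemma cser_csum (f : nat -> nat -> C) (l : nat -> C) K :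
  (forall k, (k < K)%nat -> cser (f k) (l k)) ->
  cser (fun n => csum (fun k => f k n) K) (csum l K).
Proof.
  induction K as [|K IH]; intros H; simpl; [apply cser_zero|].
  apply cser_plus; [apply IH; intros; apply H; lia|apply H; lia].
Qed.

Lemma cser_le f l M B : cser f l -> (forall n, Cmod (f n) <= M n) ->
  (forall n, rsum M n <= B) -> Cmod l <= B.
Proof.
  intros Hf HM HB. apply Rnot_lt_le. intros Hl.
  destruct (Hf (Cmod l - B)) as [N HN]; [lra|]. specialize (HN N (le_n _)).
  assert (Cmod (csum f N) <= B).
  { eapply Rle_trans; [apply csum_Cmod_le; intros; apply HM|apply HB]. }
  rewrite Cmod_sub_sym in HN.
  assert (Cmod l <= Cmod (l - csum f N) + Cmod (csum f N)).
  { replace l with ((l - csum f N) + csum f N)%C at 1 by ring. apply Cmod_triangle. }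
  lra.
Qed.

(** Completeness of C is taken from R through the two coordinate projections, which are additive and
    do not increase the modulus. *)
Lemma cser_cauchy f :
  (forall eps, 0 < eps -> exists N, forall n, (N <= n)%nat -> Cmod (csum f n - csum f N) < eps) ->
  exists l, cser f l.
Proof.
  intros H.
  assert (Hc : forall p : C -> R, (forall a b, p (a - b)%C = p a - p b) ->
     (forall z, Rabs (p z) <= Cmod z) -> exists x, Un_cv (fun n => p (csum f n)) x).
  { intros p Hp Hle. destruct (Rcomplete.R_complete (fun n => p (csum f n))) as [x Hx]; [|now exists x].
    intros eps He. destruct (H (eps / 2)) as [N HN]; [lra|]. exists N.
    intros n m Hn Hm. unfold R_dist. rewrite <- Hp.
    eapply Rle_lt_trans; [apply Hle|].
    pose proof (Cmod_sub_triangle (csum f n) (csum f N) (csum f m)) as Ht.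
    rewrite (Cmod_sub_sym (csum f N) (csum f m)) in Ht.
    pose proof (HN n Hn). pose proof (HN m Hm). lra. }
  destruct (Hc Re) as [x Hx]; [reflexivity|intros z; apply re_le_Cmod|].
  destruct (Hc Im) as [y Hy]; [reflexivity|intros z; eapply Rle_trans; [apply Rmax_r|apply Rmax_Cmod]|].
  exists (x, y). intros eps He.
  destruct (Hx (eps / 2)) as [N1 H1]; [lra|]. destruct (Hy (eps / 2)) as [N2 H2]; [lra|].
  exists (N1 + N2)%nat. intros n Hn.
  specialize (H1 n ltac:(lia)). specialize (H2 n ltac:(lia)). unfold R_dist in *.
  eapply Rle_lt_trans; [apply Cmod_2Rmax|].
  set (z := (csum f n - (x, y))%C).
  change (Re (csum f n) - x) with (fst z) in H1. change (Im (csum f n) - y) with (snd z) in H2.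
  assert (Hm : Rmax (Rabs (fst z)) (Rabs (snd z)) < eps / 2) by (apply Rmax_lub_lt; assumption).
  assert (sqrt 2 <= 2).
  { replace 2 with (sqrt (2 * 2)) at 2 by (apply sqrt_square; lra). apply sqrt_le_1_alt. lra. }
  assert (0 <= sqrt 2) by apply sqrt_pos.
  assert (0 <= Rmax (Rabs (fst z)) (Rabs (snd z)))
    by (eapply Rle_trans; [apply Rabs_pos|apply Rmax_l]).
  nra.
Qed.

Lemma cser_dominated f M B : (forall n, Cmod (f n) <= M n) -> bounded_by M B ->
  exists l, cser f l.
Proof.
  intros Hf HM. apply cser_cauchy. intros eps He.
  destruct (bounded_by_tail M B HM eps He) as [N HN]. exists N. intros n Hn.
  eapply Rle_lt_trans; [apply csum_diff_le; [exact Hf|exact Hn]|]. now apply HN.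
Qed.

Lemma cser_tail_le f l M B : cser f l -> (forall n, Cmod (f n) <= M n) ->
  forall N, (forall n, (N <= n)%nat -> rsum M n - rsum M N <= B) -> Cmod (l - csum f N) <= B.
Proof.
  intros Hf HM N HB. apply Rnot_lt_le. intros Hl.
  destruct (Hf (Cmod (l - csum f N) - B)) as [n0 Hn0]; [lra|].
  specialize (Hn0 (N + n0)%nat ltac:(lia)). specialize (HB (N + n0)%nat ltac:(lia)).
  pose proof (csum_diff_le f M N (N + n0) HM ltac:(lia)) as Hd.
  pose proof (Cmod_sub_triangle l (csum f (N + n0)) (csum f N)) as Ht.
  rewrite (Cmod_sub_sym l (csum f (N + n0))) in Ht. lra.
Qed.

(** Choice makes the sum a total function; its value is meaningful only once convergence is
    known. *)
Definition CSum (f : nat -> C) : C := epsilon (inhabits (RtoC 0)) (cser f).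

Lemma CSum_correct f l : cser f l -> cser f (CSum f).
Proof. intros H. unfold CSum. apply epsilon_spec. now exists l. Qed.

Lemma CSum_eq f l : cser f l -> CSum f = l.
Proof. intros H. eapply cser_unique; [eapply CSum_correct|]; exact H. Qed.

Lemma rsum_geom (t : R) n : 0 <= t < 1 -> rsum (fun k => t ^ k) n <= / (1 - t).
Proof.
  intros Ht. assert (Hs : rsum (fun k => t ^ k) n * (1 - t) = 1 - t ^ n)
    by (induction n as [|n IH]; simpl; [ring|rewrite Rmult_plus_distr_r, IH; ring]).
  assert (0 <= t ^ n) by (apply pow_le; lra).
  apply Rmult_le_reg_r with (1 - t); [lra|]. rewrite Hs, Rinv_l; lra.
Qed.

Lemma bounded_geom (A t : R) : 0 <= A -> 0 <= t < 1 ->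
  bounded_by (fun k => A * t ^ k) (A * / (1 - t)).
Proof.
  intros HA Ht. split.
  - intros k. apply Rmult_le_pos; [lra|apply pow_le; lra].
  - intros n. rewrite rsum_scal. apply Rmult_le_compat_l; [lra|]. now apply rsum_geom.
Qed.

Lemma geom_small (A t : R) : 0 <= t < 1 -> forall eps, 0 < eps ->
  exists N, forall n, (N <= n)%nat -> A * t ^ n < eps.
Proof.
  intros Ht eps He.
  destruct (pow_lt_1_zero t) with (y := eps / (Rabs A + 1)) as [N HN].
  - rewrite Rabs_pos_eq; lra.
  - apply Rdiv_lt_0_compat; [lra|]. pose proof (Rabs_pos A). lra.
  - exists N. intros n Hn. specialize (HN n Hn).
    assert (Hp : 0 <= t ^ n) by (apply pow_le; lra). rewrite Rabs_pos_eq in HN by exact Hp.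
    pose proof (Rabs_pos A). pose proof (Rle_abs A).
    apply Rle_lt_trans with ((Rabs A + 1) * t ^ n); [nra|].
    apply Rmult_lt_compat_l with (r := Rabs A + 1) in HN; [|lra].
    replace ((Rabs A + 1) * (eps / (Rabs A + 1))) with eps in HN by (field; lra). exact HN.
Qed.

(** * The complex exponential *)

Lemma Cexp_plus (z w : C) : Cexp (z + w) = (Cexp z * Cexp w)%C.
Proof.
  destruct z as [a b], w as [c d]. unfold Cexp, Cplus, Cmult; simpl.
  rewrite exp_plus, cos_plus, sin_plus. f_equal; ring.
Qed.

Lemma Cexp_0 : Cexp 0 = RtoC 1.
Proof. unfold Cexp; simpl. rewrite exp_0, cos_0, sin_0. unfold RtoC. f_equal; ring. Qed.

Lemma Cmod_Cexp (z : C) : Cmod (Cexp z) = exp (Re z).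
Proof.
  unfold Cmod, Cexp; simpl.
  replace (_ + _) with (exp (Re z) * exp (Re z) * (Rsqr (sin (Im z)) + Rsqr (cos (Im z))))
    by (unfold Rsqr; ring).
  rewrite sin2_cos2, Rmult_1_r. apply sqrt_square. left; apply exp_pos.
Qed.

Lemma Cexp_neq_0 (z : C) : Cexp z <> RtoC 0.
Proof. apply Cmod_gt_0. rewrite Cmod_Cexp. apply exp_pos. Qed.

Lemma Cexp_opp (z : C) : Cexp (- z) = (/ Cexp z)%C.
Proof.
  assert (H : (Cexp (- z) * Cexp z)%C = RtoC 1).
  { rewrite <- Cexp_plus. replace (- z + z)%C with (RtoC 0) by ring. apply Cexp_0. }
  rewrite <- (Cmult_1_r (Cexp (- z))), <- (Cinv_r (Cexp z)) by apply Cexp_neq_0.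
  rewrite Cmult_assoc, H. ring.
Qed.

Lemma Cexp_INR (n : nat) (z : C) : Cexp (INR n * z) = (Cexp z ^ n)%C.
Proof.
  induction n as [|n IH].
  - simpl INR. rewrite Cmult_0_l. apply Cexp_0.
  - rewrite S_INR, RtoC_plus, Cpow_S, <- IH, <- Cexp_plus. f_equal. ring.
Qed.

(** * Power series and Cauchy's estimates *)

Definition has_ps (c : nat -> C) (rho : R) (f : C -> C) : Prop :=
  forall w, Cmod w < rho -> cser (fun k => c k * w ^ k)%C (f w).

(** The coefficients may depend on the radius. This lets [step_entire] use a different truncation
    order on each disc without comparing the resulting series. *)
Definition entire (f : C -> C) : Prop :=
  forall z R, exists c, has_ps c R (fun w => f (z + w)%C).

Lemma cser_bounded f l : cser f l -> exists M, 0 <= M /\ forall k, Cmod (f k) <= M.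
Proof.
  intros H. destruct (H 1 ltac:(lra)) as [N HN].
  exists (2 + rsum (fun k => Cmod (f k)) N).
  assert (H0 : forall k, 0 <= Cmod (f k)) by (intros; apply Cmod_ge_0).
  assert (Hp : 0 <= rsum (fun k => Cmod (f k)) N).
  { apply (rsum_mono _ 0 N); [exact H0|lia]. }
  split; [lra|]. intros k. destruct (le_lt_dec N k) as [Hk|Hk].
  - replace (f k) with ((csum f (S k) - l) - (csum f k - l))%C by (simpl; ring).
    pose proof (HN k Hk). pose proof (HN (S k) ltac:(lia)).
    eapply Rle_trans; [apply Cmod_triangle|]. rewrite Cmod_opp. lra.
  - pose proof (rsum_mono _ (S k) N H0 Hk) as Hm. simpl in Hm.
    assert (0 <= rsum (fun k => Cmod (f k)) k) by (apply (rsum_mono _ 0 k); [exact H0|lia]).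
    lra.
Qed.

Lemma Cmod_pos_real (t : R) : 0 <= t -> Cmod (RtoC t) = t.
Proof. intros H. rewrite Cmod_R. now apply Rabs_pos_eq. Qed.

Lemma has_ps_coef_bounded c R f t : has_ps c R f -> 0 <= t < R ->
  exists A, 0 <= A /\ forall k, Cmod (c k) * t ^ k <= A.
Proof.
  intros H Ht. assert (Hw : Cmod (RtoC t) < R) by (rewrite Cmod_pos_real; lra).
  destruct (cser_bounded _ _ (H _ Hw)) as [A [HA HM]]. exists A. split; [exact HA|].
  intros k. specialize (HM k).
  rewrite Cmod_mult, Cmod_pow, Cmod_pos_real in HM by lra. exact HM.
Qed.

Lemma rsum_geom_tail (A t : R) N n : 0 <= A -> 0 <= t < 1 -> (N <= n)%nat ->
  rsum (fun k => A * t ^ k) n - rsum (fun k => A * t ^ k) N <= A * / (1 - t) * t ^ N.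
Proof.
  intros HA Ht Hn. rewrite !rsum_scal.
  assert (Hs : forall m, rsum (fun k => t ^ k) m = (1 - t ^ m) * / (1 - t)).
  { intros m. induction m as [|m IH]; simpl; [ring|]. rewrite IH. field. lra. }
  rewrite !Hs.
  assert (0 <= t ^ n) by (apply pow_le; lra).
  assert (0 < / (1 - t)) by (apply Rinv_0_lt_compat; lra).
  assert (0 <= A * / (1 - t) * t ^ n) by (apply Rmult_le_pos; [apply Rmult_le_pos|]; lra).
  lra.
Qed.

Lemma term_geom_le (a w : C) (A t rho : R) k :
  0 < t -> Cmod a * t ^ k <= A -> Cmod w <= rho -> Cmod (a * w ^ k)%C <= A * (rho / t) ^ k.
Proof.
  intros Ht HA Hw. rewrite Cmod_mult, Cmod_pow.
  assert (Hk : 0 < t ^ k) by now apply pow_lt.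
  assert (Cmod w ^ k <= rho ^ k) by (apply pow_incr; split; [apply Cmod_ge_0|exact Hw]).
  unfold Rdiv. rewrite Rpow_mult_distr, pow_inv.
  assert (0 <= rho ^ k).
  { eapply Rle_trans; [apply pow_le, (Cmod_ge_0 w)|eassumption]. }
  apply Rle_trans with (Cmod a * rho ^ k).
  { apply Rmult_le_compat_l; [apply Cmod_ge_0|assumption]. }
  replace (Cmod a * rho ^ k) with ((Cmod a * t ^ k) * (rho ^ k * / t ^ k)) by (field; lra).
  apply Rmult_le_compat_r; [|exact HA].
  apply Rmult_le_pos; [assumption|]. left. now apply Rinv_0_lt_compat.
Qed.

Lemma ratio_bounds rho t : 0 <= rho < t -> 0 <= rho / t < 1.
Proof.
  intros H. split.
  - apply Rmult_le_pos; [lra|]. left; apply Rinv_0_lt_compat; lra.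
  - apply Rmult_lt_reg_r with t; [lra|]. unfold Rdiv. rewrite Rmult_assoc, Rinv_l; lra.
Qed.

Lemma ps_tail_le c A t rho w l N :
  0 <= rho < t -> (forall k, Cmod (c k) * t ^ k <= A) -> Cmod w <= rho ->
  cser (fun k => c k * w ^ k)%C l ->
  Cmod (l - csum (fun k => c k * w ^ k)%C N) <= A * / (1 - rho / t) * (rho / t) ^ N.
Proof.
  intros Hr HA Hw Hl.
  assert (HA0 : 0 <= A).
  { eapply Rle_trans; [|apply (HA O)]. simpl. rewrite Rmult_1_r. apply Cmod_ge_0. }
  apply cser_tail_le with (M := fun k => A * (rho / t) ^ k); [exact Hl| |].
  - intros k. apply term_geom_le; auto; lra.
  - intros n Hn. apply rsum_geom_tail; auto. now apply ratio_bounds.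
Qed.

Lemma cos_lt_1 (x : R) : 0 < x < 2 * PI -> cos x <> 1.
Proof.
  intros Hx H. replace x with (2 * (x / 2)) in H by field. rewrite cos_2a_sin in H.
  assert (0 < sin (x / 2)) by (apply sin_gt_0; lra). nra.
Qed.

Definition unity_root (N : nat) : C := Cexp (0, 2 * PI / INR N).

Lemma unity_root_pow_N N : (0 < N)%nat -> (unity_root N ^ N)%C = RtoC 1.
Proof.
  intros HN. unfold unity_root. rewrite <- Cexp_INR.
  apply lt_0_INR in HN.
  replace (Cmult (RtoC (INR N)) (0, 2 * PI / INR N)) with ((0, 2 * PI) : C).
  - unfold Cexp; simpl. rewrite exp_0, cos_2PI, sin_2PI. unfold RtoC. f_equal; ring.
  - unfold Cmult, RtoC; simpl. f_equal; [ring|field; lra].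
Qed.

Lemma unity_root_pow_neq_1 N i : (0 < i < N)%nat -> (unity_root N ^ i)%C <> RtoC 1.
Proof.
  intros [Hi HN] H. unfold unity_root in H. rewrite <- Cexp_INR in H.
  apply (f_equal Re) in H.
  unfold Cexp, Cmult, RtoC in H; simpl in H.
  replace (INR i * 0 - 0 * (2 * PI / INR N)) with 0 in H by ring.
  rewrite exp_0, Rmult_1_l in H. revert H. apply cos_lt_1.
  apply lt_INR in HN. apply lt_0_INR in Hi. pose proof PI_RGT_0.
  replace (INR i * (2 * PI / INR N) + 0 * 0) with (2 * PI * (INR i / INR N)) by (field; lra).
  destruct (ratio_bounds (INR i) (INR N)) as [_ H1]; [lra|].
  assert (0 < INR i / INR N) by (apply Rdiv_lt_0_compat; lra). nra.
Qed.

Lemma Cmod_unity_root N : Cmod (unity_root N) = 1.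
Proof. unfold unity_root. rewrite Cmod_Cexp. apply exp_0. Qed.

Lemma csum_roots (z : C) N : (z ^ N)%C = RtoC 1 -> z <> RtoC 1 -> csum (fun j => z ^ j)%C N = RtoC 0.
Proof.
  intros HN H1.
  assert (H : ((z - 1) * csum (fun j => z ^ j) N)%C = (z ^ N - 1)%C).
  { clear. induction N as [|N IH].
    - simpl. ring.
    - simpl csum. rewrite Cmult_plus_distr_l, IH, Cpow_S. ring. }
  rewrite HN in H.
  assert (Hz : (z - 1)%C <> RtoC 0) by now apply Cminus_eq_contra.
  replace (csum (fun j => z ^ j)%C N) with (/ (z - 1) * ((z - 1) * csum (fun j => z ^ j) N))%C
    by (field; exact Hz).
  rewrite H. ring.
Qed.

(* Averaging the partial sum of order [N] over the [N]-th roots of unity isolates a coefficient. *)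
Lemma coef_average (c : nat -> C) (rho : R) N k : (k < N)%nat ->
  (INR N * (c k * RtoC rho ^ k))%C =
  csum (fun j => (unity_root N ^ (N - k)) ^ j *
     csum (fun m => c m * (RtoC rho * unity_root N ^ j) ^ m) N)%C N.
Proof.
  intros Hk. set (om := unity_root N).
  (* The weight shifts the exponent [m] to m + (N - k), which lies strictly between 0 and 2 N and is
     a multiple of [N] only for m = k. All other sums over the roots vanish. *)
  rewrite (csum_ext _ (fun j => csum (fun m => (c m * RtoC rho ^ m) * (om ^ (m + (N - k))) ^ j)%C N)).
  2:{ intros j _. rewrite <- csum_scal. apply csum_ext. intros m _.
      rewrite Cpow_mult_l, Cpow_add_r, (Cpow_mult_l (om ^ m)).
      rewrite <- !Cpow_mult_r, (Nat.mul_comm j m). ring. }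
  rewrite csum_exchange.
  rewrite (csum_ext _ (fun m => (c m * RtoC rho ^ m) * csum (fun j => (om ^ (m + (N - k))) ^ j) N)%C)
    by (intros m _; apply csum_scal).
  rewrite (csum_single _ N k Hk).
  - replace (k + (N - k))%nat with N by lia.
    unfold om at 1. rewrite unity_root_pow_N by lia.
    rewrite (csum_ext _ (fun _ => RtoC 1)) by (intros; apply Cpow_1_l).
    rewrite csum_const. ring.
  - intros m Hm Hne. rewrite csum_roots; [ring| |].
    + rewrite <- Cpow_mult_r, Nat.mul_comm, Cpow_mult_r. unfold om.
      rewrite unity_root_pow_N by lia. apply Cpow_1_l.
    + destruct (le_lt_dec N (m + (N - k))) as [Hle|Hlt].
      * replace (m + (N - k))%nat with (N + (m - k))%nat by lia.
        rewrite Cpow_add_r. unfold om at 1. rewrite unity_root_pow_N, Cmult_1_l by lia.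
        apply unity_root_pow_neq_1. lia.
      * apply unity_root_pow_neq_1. lia.
Qed.

Lemma le_of_lt_eps (a b : R) : (forall eps, 0 < eps -> a <= b + eps) -> a <= b.
Proof. intros H. apply Rnot_lt_le. intros Hl. specialize (H ((a - b) / 2)). lra. Qed.

(** The average over the [N]-th roots of unity returns c_k rho^k exactly from partial sums of order
    [N]. On the circle these differ from [f] by a geometric tail, which is below [eps] for large
    [N], so no contour integral is involved. *)
Lemma cauchy_estimate c R f rho M :
  has_ps c R f -> 0 < rho < R -> (forall w, Cmod w <= rho -> Cmod (f w) <= M) ->
  forall k, Cmod (c k) * rho ^ k <= M.
Proof.
  intros Hf Hr HM k. set (t := (rho + R) / 2).
  destruct (has_ps_coef_bounded c R f t Hf) as [A [HA0 HA]]; [unfold t; lra|].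
  assert (Hrt : 0 <= rho < t) by (unfold t; lra).
  pose proof (ratio_bounds rho t Hrt) as Hth.
  apply le_of_lt_eps. intros eps He.
  destruct (geom_small (A * / (1 - rho / t)) (rho / t) Hth eps He) as [N0 HN0].
  set (N := (N0 + k + 1)%nat). specialize (HN0 N ltac:(unfold N; lia)).
  assert (HNp : 0 < INR N) by (apply lt_0_INR; unfold N; lia).
  assert (Hmain : Cmod (INR N * (c k * RtoC rho ^ k))%C <= INR N * (M + eps)).
  { rewrite (coef_average c rho N k) by (unfold N; lia).
    rewrite <- rsum_const. apply csum_Cmod_le. intros j _.
    set (w := (RtoC rho * unity_root N ^ j)%C).
    assert (Hw : Cmod w <= rho).
    { unfold w. rewrite Cmod_mult, Cmod_pow, Cmod_unity_root, pow1, Cmod_pos_real; lra. }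
    rewrite Cmod_mult, !Cmod_pow, Cmod_unity_root, !pow1, Rmult_1_l.
    assert (Hwf : cser (fun k => c k * w ^ k)%C (f w)) by (apply Hf; lra).
    pose proof (ps_tail_le c A t rho w (f w) N Hrt HA Hw Hwf) as Ht.
    specialize (HM w Hw). set (s := csum _ N) in *.
    replace s with (f w - (f w - s))%C by ring.
    eapply Rle_trans; [apply Cmod_triangle|]. rewrite Cmod_opp. lra. }
  rewrite Cmod_mult, Cmod_mult, Cmod_pow, !Cmod_pos_real in Hmain by lra.
  apply Rmult_le_reg_l with (INR N); assumption.
Qed.

(** Cauchy's estimates transfer the majorant [M] from the functions to their coefficients. The
    coefficient series then converge, and the [K]-th remainders, each at most a geometric factor
    times M_n, can be summed over [n]. *)
Lemma weierstrass (c : nat -> nat -> C) (g : nat -> C -> C) (F : C -> C) R :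
  (forall n, has_ps (c n) R (g n)) ->
  (forall rho, 0 < rho < R -> exists M B, bounded_by M B /\
     forall n w, Cmod w <= rho -> Cmod (g n w) <= M n) ->
  (forall w, Cmod w < R -> cser (fun n => g n w) (F w)) ->
  has_ps (fun k => CSum (fun n => c n k)) R F.
Proof.
  intros Hg HM HF w Hw.
  pose proof (Cmod_ge_0 w) as Hw0. set (rho := (Cmod w + R) / 2).
  assert (Hr : 0 < rho < R) by (unfold rho; lra).
  destruct (HM rho Hr) as [M [B [HMB HMg]]].
  assert (Hc : forall n k, Cmod (c n k) * rho ^ k <= M n).
  { intros n k. apply cauchy_estimate with (R := R) (f := g n); auto. }
  assert (HC : forall k, cser (fun n => c n k) (CSum (fun n => c n k))).
  { intros k. assert (Hk : 0 < / rho ^ k) by (apply Rinv_0_lt_compat, pow_lt; lra).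
    destruct (cser_dominated (fun n => c n k) (fun n => / rho ^ k * M n) (/ rho ^ k * B))
      as [l Hl].
    - intros n. specialize (Hc n k). assert (0 < rho ^ k) by (apply pow_lt; lra).
      apply Rmult_le_reg_r with (rho ^ k); [assumption|].
      replace (/ rho ^ k * M n * rho ^ k) with (M n) by (field; lra). exact Hc.
    - destruct HMB as [HM0 HMB]. split.
      + intros n. apply Rmult_le_pos; [lra|apply HM0].
      + intros n. rewrite rsum_scal. apply Rmult_le_compat_l; [lra|apply HMB].
    - eapply CSum_correct, Hl. }
  assert (Hth : 0 <= Cmod w / rho < 1) by (apply ratio_bounds; unfold rho; lra).
  set (th := Cmod w / rho) in *.
  intros eps He.
  destruct (geom_small (/ (1 - th) * B) th Hth eps He) as [N HN].
  exists N. intros K HK. specialize (HN K HK).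
  eapply Rle_lt_trans; [|exact HN]. rewrite Cmod_sub_sym.
  apply cser_le with (f := fun n => (g n w - csum (fun k => c n k * w ^ k) K)%C)
    (M := fun n => (/ (1 - th) * th ^ K) * M n).
  - apply cser_minus; [now apply HF|]. apply (cser_csum (fun k n => (c n k * w ^ k)%C)).
    intros k _. rewrite (Cmult_comm (CSum _)).
    eapply cser_ext; [|apply cser_scal, HC]. intros n. simpl. ring.
  - intros n.
    replace (/ (1 - th) * th ^ K * M n) with (M n * / (1 - th) * th ^ K) by ring.
    apply ps_tail_le; [unfold rho; lra|apply Hc|lra|now apply Hg].
  - intros n. rewrite rsum_scal. destruct HMB as [_ HMB].
    replace (/ (1 - th) * B * th ^ K) with (/ (1 - th) * th ^ K * B) by ring.
    apply Rmult_le_compat_l; [|apply HMB].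
    apply Rmult_le_pos; [left; apply Rinv_0_lt_compat; lra|apply pow_le; lra].
Qed.

Lemma has_ps_ext c R f g : (forall w, Cmod w < R -> f w = g w) -> has_ps c R f -> has_ps c R g.
Proof. intros H Hf w Hw. rewrite <- H by exact Hw. now apply Hf. Qed.

Lemma has_ps_mono c R R' f : R' <= R -> has_ps c R f -> has_ps c R' f.
Proof. intros H Hf w Hw. apply Hf. lra. Qed.

Lemma has_ps_plus c d R f g : has_ps c R f -> has_ps d R g ->
  has_ps (fun k => c k + d k)%C R (fun w => f w + g w)%C.
Proof.
  intros Hf Hg w Hw. eapply cser_ext; [|apply cser_plus; [apply Hf|apply Hg]; exact Hw].
  intros k. simpl. ring.
Qed.

Lemma has_ps_scal a c R f : has_ps c R f ->
  has_ps (fun k => a * c k)%C R (fun w => a * f w)%C.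
Proof.
  intros Hf w Hw. eapply cser_ext; [|apply cser_scal, Hf, Hw]. intros k. simpl. ring.
Qed.

Lemma has_ps_const a R : has_ps (fun k => match k with O => a | _ => RtoC 0 end) R (fun _ => a).
Proof.
  intros w Hw. apply cser_shift.
  replace (a - a * w ^ 0)%C with (RtoC 0) by (simpl; ring).
  eapply cser_ext; [|apply cser_zero]. intros k. simpl. ring.
Qed.

Lemma has_ps_mult_X c R f : has_ps c R f ->
  has_ps (fun k => match k with O => RtoC 0 | S k => c k end) R (fun w => w * f w)%C.
Proof.
  intros Hf w Hw. apply cser_shift.
  replace (w * f w - 0 * w ^ 0)%C with (w * f w)%C by (simpl; ring).
  eapply cser_ext; [|apply cser_scal, Hf, Hw]. intros k. rewrite Cpow_S. ring.
Qed.

Lemma has_ps_mult_lin a c R f : has_ps c R f ->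
  exists d, has_ps d R (fun w => (a + w) * f w)%C.
Proof.
  intros Hf. eexists.
  eapply has_ps_ext; [|exact (has_ps_plus _ _ _ _ _ (has_ps_scal a _ _ _ Hf) (has_ps_mult_X _ _ _ Hf))].
  intros w _. simpl. ring.
Qed.

(** Near 0 the first nonzero term c_m w^m dominates the tail of the series. *)
Lemma has_ps_zero_or_isolated c R f : 0 < R -> has_ps c R f ->
  (forall k, c k = RtoC 0) \/
  exists eps, 0 < eps /\ forall w, 0 < Cmod w < eps -> f w <> RtoC 0.
Proof.
  intros HR Hf. destruct (classic (forall k, c k = RtoC 0)) as [H|H]; [now left|right].
  assert (Hm : exists m, c m <> RtoC 0 /\ forall k, (k < m)%nat -> c k = RtoC 0).
  { apply Classical_Pred_Type.not_all_ex_not in H. destruct H as [n Hn].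
    revert Hn. induction n as [n IH] using lt_wf_ind. intros Hn.
    destruct (classic (forall k, (k < n)%nat -> c k = RtoC 0)) as [Hk|Hk]; [now exists n|].
    apply Classical_Pred_Type.not_all_ex_not in Hk. destruct Hk as [k Hk].
    apply Classical_Prop.imply_to_and in Hk. now apply (IH k). }
  destruct Hm as [m [Hm Hlt]].
  destruct (has_ps_coef_bounded c R f (R / 2) Hf) as [A [HA0 HA]]; [lra|].
  set (t := R / 2) in *. assert (Ht : 0 < t) by (unfold t; lra).
  assert (Hcm : 0 < Cmod (c m)) by now apply Cmod_gt_0.
  (* A zero [w] forces |c_m| t^(m+1) <= 2 A |w| by the tail bound, which |w| < e contradicts. The
     added 1 keeps the denominator positive when [A] is 0. *)
  set (e := Cmod (c m) * t ^ S m / (2 * A + 1)).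
  assert (Htm : 0 < t ^ S m) by now apply pow_lt.
  assert (He : 0 < e) by (apply Rdiv_lt_0_compat; [now apply Rmult_lt_0_compat|lra]).
  exists (Rmin (t / 2) e). split; [apply Rmin_pos; lra|].
  intros w [Hw0 Hw] Hfw.
  assert (Hw1 : Cmod w < t / 2) by (eapply Rlt_le_trans; [exact Hw|apply Rmin_l]).
  assert (Hw2 : Cmod w < e) by (eapply Rlt_le_trans; [exact Hw|apply Rmin_r]).
  assert (Hps : cser (fun k => c k * w ^ k)%C (f w)) by (apply Hf; unfold t in *; lra).
  pose proof (ps_tail_le c A t (Cmod w) w (f w) (S m) ltac:(lra) HA (Rle_refl _) Hps) as Htl.
  simpl csum in Htl. rewrite csum_zero in Htl by (intros k Hk; rewrite (Hlt k Hk); ring).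
  rewrite Hfw in Htl.
  replace (0 - (0 + c m * w ^ m))%C with (- (c m * w ^ m))%C in Htl by ring.
  rewrite Cmod_opp, Cmod_mult, Cmod_pow in Htl.
  set (x := Cmod w) in *.
  assert (Hx : x / t <= / 2).
  { apply Rmult_le_reg_r with t; [exact Ht|]. unfold Rdiv. rewrite Rmult_assoc, Rinv_l; lra. }
  assert (Hinv : / (1 - x / t) <= 2).
  { replace 2 with (/ / 2) by field. apply Rinv_le_contravar; lra. }
  assert (Hxm : 0 < x ^ m) by now apply pow_lt.
  assert (Hb : Cmod (c m) * x ^ m <= A * 2 * (x / t) ^ S m).
  { eapply Rle_trans; [exact Htl|]. apply Rmult_le_compat_r.
    - apply pow_le. apply ratio_bounds; lra.
    - apply Rmult_le_compat_l; lra. }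
  unfold Rdiv in Hb. rewrite Rpow_mult_distr, pow_inv in Hb.
  assert (Hc : Cmod (c m) * t ^ S m <= 2 * A * x).
  { apply Rmult_le_reg_r with (x ^ m * / t ^ S m).
    - apply Rmult_lt_0_compat; [exact Hxm|now apply Rinv_0_lt_compat].
    - replace (Cmod (c m) * t ^ S m * (x ^ m * / t ^ S m)) with (Cmod (c m) * x ^ m) by (field; lra).
      replace (2 * A * x * (x ^ m * / t ^ S m)) with (A * 2 * (x ^ S m * / t ^ S m))
        by (simpl; field; split; [apply Rgt_not_eq, pow_lt|]; lra).
      exact Hb. }
  assert (Hx2 : (2 * A + 1) * x < (2 * A + 1) * e) by (apply Rmult_lt_compat_l; lra).
  unfold e in Hx2. replace ((2 * A + 1) * (Cmod (c m) * t ^ S m / (2 * A + 1)))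
    with (Cmod (c m) * t ^ S m) in Hx2 by (field; lra).
  nra.
Qed.

(** The centre is left out because [is_H] says nothing at t = 0. *)
Lemma has_ps_coef_unique c d R f : 0 < R ->
  (forall w, 0 < Cmod w < R -> cser (fun k => c k * w ^ k)%C (f w)) ->
  (forall w, 0 < Cmod w < R -> cser (fun k => d k * w ^ k)%C (f w)) ->
  forall k, c k = d k.
Proof.
  intros HR Hc Hd.
  (* The difference series is 0 away from the centre; giving it its constant term as value at 0
     makes it a power series on the whole disc, with zeros accumulating at 0. *)
  assert (H : has_ps (fun k => c k - d k)%C R (fun w => if excluded_middle_informative (w = RtoC 0)
      then (c O - d O)%C else RtoC 0)).
  { intros w Hw. destruct excluded_middle_informative as [->|Hn].
    - apply cser_shift. replace (c O - d O - (c O - d O) * 0 ^ 0)%C with (RtoC 0) by (simpl; ring).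
      eapply cser_ext; [|apply cser_zero]. intros n. simpl. ring.
    - apply Cmod_gt_0 in Hn. replace (RtoC 0) with (f w - f w)%C by ring.
      eapply cser_ext; [|apply cser_minus; [apply Hc|apply Hd]; lra]. intros n. simpl. ring. }
  destruct (has_ps_zero_or_isolated _ _ _ HR H) as [Hz|[eps [He Hz]]].
  - intros k. apply Ceq_minus, Hz.
  - exfalso. set (x := Rmin eps R / 2).
    assert (Hx : 0 < x) by (unfold x; pose proof (Rmin_pos eps R He HR); lra).
    assert (Hxe : x < eps) by (unfold x in *; pose proof (Rmin_l eps R); lra).
    apply (Hz (RtoC x)); [rewrite Cmod_pos_real; lra|].
    destruct excluded_middle_informative as [Hn|Hn]; [|reflexivity].
    apply RtoC_inj in Hn. lra.
Qed.

(** * Products and quotients of power series *)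

Definition conv (c d : nat -> C) (k : nat) : C :=
  csum (fun i => c i * d (k - i)%nat)%C (S k).

Lemma has_ps_shift c R f i : has_ps c R f ->
  has_ps (fun k => if (i <=? k)%nat then c (k - i)%nat else RtoC 0) R (fun w => w ^ i * f w)%C.
Proof.
  intros Hf. induction i as [|i IH].
  - intros w Hw. rewrite Cmult_1_l. eapply cser_ext; [|now apply Hf].
    intros k. simpl. now rewrite Nat.sub_0_r.
  - apply has_ps_mult_X in IH. intros w Hw. specialize (IH w Hw). cbv beta in IH.
    rewrite Cpow_S, <- Cmult_assoc. eapply cser_ext; [|exact IH].
    intros [|k]; reflexivity.
Qed.

Lemma has_ps_bounded c R f rho : has_ps c R f -> 0 < rho < R ->
  exists B, 0 <= B /\ forall w, Cmod w <= rho -> Cmod (f w) <= B.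
Proof.
  intros Hf Hr. set (t := (rho + R) / 2).
  destruct (has_ps_coef_bounded c R f t Hf) as [A [HA0 HA]]; [unfold t; lra|].
  assert (Hrt : 0 <= rho < t) by (unfold t; lra).
  pose proof (ratio_bounds rho t Hrt) as Hth.
  exists (A * / (1 - rho / t)). split.
  - apply Rmult_le_pos; [lra|]. left; apply Rinv_0_lt_compat; lra.
  - intros w Hw. assert (Hwf : cser (fun k => c k * w ^ k)%C (f w)) by (apply Hf; lra).
    pose proof (ps_tail_le c A t rho w (f w) 0 Hrt HA Hw Hwf) as Ht.
    simpl in Ht. rewrite Rmult_1_r in Ht.
    replace (f w - 0)%C with (f w) in Ht by ring. exact Ht.
Qed.

Lemma cser_finite f K : (forall k, (K <= k)%nat -> f k = RtoC 0) -> cser f (csum f K).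
Proof.
  intros H eps He. exists K. intros n Hn. replace n with (K + (n - K))%nat by lia.
  rewrite csum_add, (csum_zero (fun k => f (K + k)%nat)) by (intros; apply H; lia).
  replace (csum f K + 0 - csum f K)%C with (RtoC 0) by ring. now rewrite Cmod_0.
Qed.

(* [f * g] is the sum over [i] of the power series of [c_i w^i g(w)]. *)
Lemma has_ps_mult c d R f g : has_ps c R f -> has_ps d R g ->
  has_ps (conv c d) R (fun w => f w * g w)%C.
Proof.
  intros Hf Hg.
  set (e := fun i k => if (i <=? k)%nat then (c i * d (k - i)%nat)%C else RtoC 0).
  assert (He : forall i, has_ps (e i) R (fun w => (c i * w ^ i) * g w)%C).
  { intros i w Hw. rewrite <- Cmult_assoc.
    eapply cser_ext; [|exact (has_ps_scal (c i) _ _ _ (has_ps_shift _ _ _ i Hg) w Hw)].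
    intros k. unfold e. cbv beta. destruct (i <=? k)%nat; [reflexivity|ring]. }
  assert (HW : has_ps (fun k => CSum (fun i => e i k)) R (fun w => f w * g w)%C).
  { apply weierstrass with (g := fun i w => ((c i * w ^ i) * g w)%C).
    - exact He.
    - intros rho Hr. destruct (has_ps_bounded d R g rho Hg Hr) as [B [HB0 HB]].
      set (t := (rho + R) / 2).
      destruct (has_ps_coef_bounded c R f t Hf) as [A [HA0 HA]]; [unfold t; lra|].
      assert (Hrt : 0 <= rho < t) by (unfold t; lra).
      pose proof (ratio_bounds rho t Hrt) as Hth.
      exists (fun i => (B * A) * (rho / t) ^ i), (B * A * / (1 - rho / t)). split.
      + apply bounded_geom; [now apply Rmult_le_pos|exact Hth].
      + intros n w Hw. rewrite Cmod_mult, Rmult_comm, Rmult_assoc.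
        apply Rmult_le_compat; [apply Cmod_ge_0|apply Cmod_ge_0|now apply HB|].
        apply term_geom_le; auto; lra.
    - intros w Hw. rewrite Cmult_comm. eapply cser_ext; [|apply cser_scal, Hf, Hw].
      intros k. simpl. ring. }
  intros w Hw. eapply cser_ext; [|exact (HW w Hw)]. intros k. cbv beta. f_equal.
  rewrite (CSum_eq _ (csum (fun i => e i k) (S k))).
  - unfold conv. apply csum_ext. intros i Hi. unfold e.
    destruct (Nat.leb_spec i k); [reflexivity|lia].
  - apply cser_finite. intros i Hi. unfold e. destruct (Nat.leb_spec i k); [lia|reflexivity].
Qed.

(** Course-of-values recursion made structural: stage [n] is a table that is correct below [n],
    since each new coefficient needs all the previous ones. *)
Fixpoint conv_solve_upto (c e : nat -> C) (n : nat) : nat -> C :=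
  match n with
  | O => fun _ => RtoC 0
  | S n => let b := conv_solve_upto c e n in
      fun k => if (k =? n)%nat
        then (/ c O * (e n - csum (fun i => c (S i) * b (n - S i)%nat) n))%C else b k
  end.

Definition conv_solve (c e : nat -> C) (k : nat) : C := conv_solve_upto c e (S k) k.

Lemma conv_solve_upto_eq c e n k : (k < n)%nat -> conv_solve_upto c e n k = conv_solve c e k.
Proof.
  induction 1 as [|n Hn IH]; [reflexivity|]. simpl.
  destruct (Nat.eqb_spec k n) as [->|_]; [lia|exact IH].
Qed.

Lemma conv_solve_correct c e : c O <> RtoC 0 -> forall n, conv c (conv_solve c e) n = e n.
Proof.
  intros Hc n. unfold conv. rewrite csum_S_l, Nat.sub_0_r.
  unfold conv_solve at 1. simpl conv_solve_upto. rewrite Nat.eqb_refl.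
  rewrite (csum_ext (fun i => c (S i) * conv_solve_upto c e n (n - S i)%nat)%C
                    (fun i => c (S i) * conv_solve c e (n - S i)%nat)%C).
  - field. exact Hc.
  - intros i Hi. rewrite conv_solve_upto_eq by lia. reflexivity.
Qed.

Lemma conv_cancel c b b' : c O <> RtoC 0 ->
  (forall n, conv c b n = conv c b' n) -> forall n, b n = b' n.
Proof.
  intros Hc H n. induction n as [n IH] using lt_wf_ind. specialize (H n).
  unfold conv in H. rewrite !csum_S_l, !Nat.sub_0_r in H.
  rewrite (csum_ext _ (fun k => c (S k) * b' (n - S k)%nat)%C) in H
    by (intros k Hk; rewrite IH by lia; reflexivity).
  set (s := csum _ n) in H.
  replace (b n) with (/ c O * ((c O * b n + s) - s))%C by (field; exact Hc).
  rewrite H. field. exact Hc.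
Qed.

(** This gives the quotient series a positive radius. With [tau] so small that the numbers |c_i|
    tau^i for i >= 1 add up to at most |c_0| / 2, the bound 2 A0 / |c_0| reproduces itself in the
    recursion for [h]. *)
Lemma conv_solve_geometric c e R f A0 t0 h : has_ps c R f -> 0 < R -> c O <> RtoC 0 ->
  0 < t0 -> 0 <= A0 -> (forall k, Cmod (e k) * t0 ^ k <= A0) ->
  (forall n, conv c h n = e n) ->
  exists B tau, 0 < tau /\ forall k, Cmod (h k) * tau ^ k <= B.
Proof.
  intros Hf HR Hc Ht0 HA0 He Hh.
  destruct (has_ps_coef_bounded c R f (R / 2) Hf) as [A [HA HcA]]; [lra|].
  set (t := R / 2) in *. assert (Ht : 0 < t) by (unfold t; lra).
  set (x := Cmod (c O)). assert (Hx : 0 < x) by now apply Cmod_gt_0.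
  set (tau := Rmin t0 (Rmin (t / 2) (x * t / (4 * A + 1)))).
  assert (Hxt : 0 < x * t / (4 * A + 1)) by (apply Rdiv_lt_0_compat; [now apply Rmult_lt_0_compat|lra]).
  assert (Htau : 0 < tau) by (unfold tau; repeat apply Rmin_pos; lra).
  assert (Htau0 : tau <= t0) by apply Rmin_l.
  assert (Htau1 : tau <= t / 2) by (eapply Rle_trans; [apply Rmin_r|apply Rmin_l]).
  assert (Htau2 : tau <= x * t / (4 * A + 1)) by (eapply Rle_trans; [apply Rmin_r|apply Rmin_r]).
  assert (Hth : 0 <= tau / t < 1) by (apply ratio_bounds; lra).
  set (th := tau / t) in *.
  assert (Hth2 : th <= / 2).
  { unfold th. apply Rmult_le_reg_r with t; [exact Ht|]. unfold Rdiv.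
    rewrite Rmult_assoc, Rinv_l; lra. }
  assert (Hsmall : 4 * A * th <= x).
  { unfold th. apply Rmult_le_reg_r with t; [exact Ht|].
    replace (4 * A * (tau / t) * t) with (4 * A * tau) by (field; lra).
    apply Rmult_le_compat_l with (r := 4 * A + 1) in Htau2; [|lra].
    replace ((4 * A + 1) * (x * t / (4 * A + 1))) with (x * t) in Htau2 by (field; lra). nra. }
  assert (Hctau : forall i, Cmod (c i) * tau ^ i <= A * th ^ i).
  { intros i. pose proof (term_geom_le (c i) (RtoC tau) A t tau i Ht (HcA i)) as Hi.
    rewrite Cmod_mult, Cmod_pow, Cmod_pos_real in Hi by lra. apply Hi. lra. }
  exists (2 * A0 / x), tau. split; [exact Htau|].
  intros n. induction n as [n IH] using lt_wf_ind.
  set (B := 2 * A0 / x) in *.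
  assert (HB : 0 <= B).
  { unfold B. apply Rmult_le_pos; [lra|]. left. now apply Rinv_0_lt_compat. }
  specialize (Hh n). unfold conv in Hh. rewrite csum_S_l, Nat.sub_0_r in Hh.
  set (s := csum _ n) in Hh.
  assert (Hs : Cmod s * tau ^ n <= x / 2 * B).
  { assert (Htn : 0 <= tau ^ n) by (apply pow_le; lra).
    apply Rle_trans with (rsum (fun i => (A * th * B) * th ^ i) n).
    - rewrite <- (Cmod_pos_real (tau ^ n)) by exact Htn. rewrite <- Cmod_mult, Cmult_comm.
      unfold s. rewrite <- csum_scal. apply csum_Cmod_le. intros i Hi.
      rewrite !Cmod_mult, Cmod_pos_real by exact Htn.
      replace (tau ^ n) with (tau ^ S i * tau ^ (n - S i)).
      2:{ rewrite <- pow_add. f_equal. lia. }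
      replace (tau ^ S i * tau ^ (n - S i) * (Cmod (c (S i)) * Cmod (h (n - S i)%nat)))
        with ((Cmod (c (S i)) * tau ^ S i) * (Cmod (h (n - S i)%nat) * tau ^ (n - S i))) by ring.
      replace (A * th * B * th ^ i) with ((A * th ^ S i) * B) by (simpl; ring).
      apply Rmult_le_compat; [| |apply Hctau|apply IH; lia];
        (apply Rmult_le_pos; [apply Cmod_ge_0|apply pow_le; lra]).
    - rewrite rsum_scal.
      assert (H2 : rsum (fun i => th ^ i) n <= 2).
      { eapply Rle_trans; [now apply rsum_geom|]. replace 2 with (/ / 2) by field.
        apply Rinv_le_contravar; lra. }
      assert (0 <= A * th * B) by (apply Rmult_le_pos; [apply Rmult_le_pos|]; lra).
      apply Rle_trans with (A * th * B * 2); [apply Rmult_le_compat_l; [lra|exact H2]|].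
      apply Rmult_le_compat_r with (r := B) in Hsmall; [lra|exact HB]. }
  assert (Hen : Cmod (e n) * tau ^ n <= A0).
  { eapply Rle_trans; [|apply (He n)]. apply Rmult_le_compat_l; [apply Cmod_ge_0|].
    apply pow_incr. lra. }
  assert (Hxh : x * Cmod (h n) <= Cmod (e n) + Cmod s).
  { unfold x. rewrite <- Cmod_mult. replace (c O * h n)%C with (e n - s)%C by (rewrite <- Hh; ring).
    eapply Rle_trans; [apply Cmod_triangle|]. rewrite Cmod_opp. lra. }
  assert (0 <= tau ^ n) by (apply pow_le; lra).
  apply Rmult_le_reg_l with x; [exact Hx|].
  assert (HxB : x * B = 2 * A0) by (unfold B; field; lra).
  apply Rmult_le_compat_r with (r := tau ^ n) in Hxh; [|assumption]. nra.
Qed.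

Lemma has_ps_at_0 c R f : 0 < R -> has_ps c R f -> f (RtoC 0) = c O.
Proof.
  intros HR Hf.
  assert (Hl : cser (fun k => c k * 0 ^ k)%C (f (RtoC 0))) by (apply Hf; rewrite Cmod_0; lra).
  eapply cser_unique; [exact Hl|]. apply cser_shift.
  replace (c O - c O * 0 ^ 0)%C with (RtoC 0) by (simpl; ring).
  eapply cser_ext; [|apply cser_zero]. intros n. simpl. ring.
Qed.

Lemma has_ps_div c e R f g h : 0 < R -> has_ps c R f -> has_ps e R g -> c O <> RtoC 0 ->
  (forall n, conv c h n = e n) ->
  exists r, 0 < r <= R /\ has_ps h r (fun w => g w / f w)%C /\
    forall w, Cmod w < r -> f w <> RtoC 0.
Proof.
  intros HR Hf Hg Hc Hh.
  destruct (has_ps_coef_bounded e R g (R / 2) Hg) as [A0 [HA0 He]]; [lra|].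
  assert (HR2 : 0 < R / 2) by lra.
  destruct (conv_solve_geometric c e R f A0 (R / 2) h Hf HR Hc HR2 HA0 He Hh)
    as [B [tau [Htau HB]]].
  destruct (has_ps_zero_or_isolated c R f HR Hf) as [Hz|[eps [Heps Hne]]].
  { exfalso. apply Hc, Hz. }
  set (r := Rmin eps (Rmin tau R)).
  assert (Hr : 0 < r) by (unfold r; repeat apply Rmin_pos; lra).
  assert (Hre : r <= eps) by apply Rmin_l.
  assert (Hrt : r <= tau) by (eapply Rle_trans; [apply Rmin_r|apply Rmin_l]).
  assert (HrR : r <= R) by (eapply Rle_trans; [apply Rmin_r|apply Rmin_r]).
  exists r. split; [lra|].
  assert (Hnz : forall w, Cmod w < r -> f w <> RtoC 0).
  { intros w Hw. destruct (classic (w = RtoC 0)) as [->|Hw0].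
    - now rewrite (has_ps_at_0 c R f HR Hf).
    - apply Hne. apply Cmod_gt_0 in Hw0. lra. }
  split; [|exact Hnz].
  assert (Hh' : has_ps h r (fun w => CSum (fun k => h k * w ^ k)%C)).
  { intros w Hw. destruct (cser_dominated (fun k => h k * w ^ k)%C
      (fun k => B * (Cmod w / tau) ^ k) (B * / (1 - Cmod w / tau))) as [l Hl].
    - intros k. apply term_geom_le; auto; lra.
    - apply bounded_geom.
      + eapply Rle_trans; [|apply (HB O)]. simpl. rewrite Rmult_1_r. apply Cmod_ge_0.
      + apply ratio_bounds. split; [apply Cmod_ge_0|lra].
    - eapply CSum_correct, Hl. }
  apply has_ps_ext with (2 := Hh'). intros w Hw.
  pose proof (has_ps_mult _ _ _ _ _ (has_ps_mono _ _ _ _ HrR Hf) Hh' w Hw) as Hp. cbv beta in Hp.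
  assert (Heq : (f w * CSum (fun k => h k * w ^ k)%C)%C = g w).
  { eapply cser_unique; [exact Hp|]. eapply cser_ext; [|apply Hg; lra].
    intros k. cbv beta. now rewrite Hh. }
  rewrite <- Heq. field. now apply Hnz.
Qed.

(** * Analytic functions on connected sets *)

Definition analytic_at (f : C -> C) (z : C) : Prop :=
  exists c R, 0 < R /\ has_ps c R (fun w => f (z + w)%C).

Lemma analytic_on_iff D f : analytic_on D f <-> forall z, D z -> analytic_at f z.
Proof.
  assert (Hp : forall (w : C) k, @pow_n C_Ring w k = (w ^ k)%C).
  { intros w k. induction k as [|k IH]; [reflexivity|]. simpl. now rewrite IH. }
  assert (Hs : forall (c : nat -> C) (w : C) l, @is_pseries C_AbsRing C_NormedModule c w l <->
    cser (fun k => c k * w ^ k)%C l).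
  { intros c w l. unfold is_pseries. rewrite <- cser_is_series.
    split; apply cser_ext; intros k; change (@scal _ C_NormedModule) with Cmult;
      change (@pow_n (AbsRing.Ring C_AbsRing)) with (@pow_n C_Ring);
      rewrite (Hp w k); apply Cmult_comm. }
  split; intros H z Hz.
  - destruct (H z Hz) as [R [c [HR Hc]]]. exists c, R. split; [exact HR|].
    intros w Hw. specialize (Hc (z + w)%C). replace (z + w - z)%C with w in Hc by ring.
    apply Hs. now apply Hc.
  - destruct (H z Hz) as [c [R [HR Hc]]]. exists R, c. split; [exact HR|].
    intros w Hw. apply Hs. specialize (Hc (w - z)%C Hw). cbv beta in Hc.
    replace (z + (w - z))%C with w in Hc by ring. exact Hc.
Qed.

Lemma entire_analytic f z : entire f -> analytic_at f z.
Proof. intros H. destruct (H z 1) as [c Hc]. exists c, 1. split; [lra|exact Hc]. Qed.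

Lemma open_C (U : C -> Prop) :
  open U <-> forall z, U z -> exists eps, 0 < eps /\ forall w, Cmod (w - z) < eps -> U w.
Proof.
  split; intros H z Hz.
  - destruct (H z Hz) as [eps He]. exists eps. split; [apply cond_pos|].
    intros w Hw. apply He. now apply C_NormedModule_mixin_compat1.
  - destruct (H z Hz) as [eps [He Hw]].
    (* Coquelicot's balls in C are products of intervals; halving [eps] absorbs the factor sqrt 2
       between them and the discs of [Cmod]. *)
    assert (He2 : 0 < eps / 2) by lra. exists (mkposreal _ He2).
    intros w Hb. apply Hw. apply C_NormedModule_mixin_compat2 in Hb. simpl in Hb.
    assert (sqrt 2 < 2).
    { replace 2 with (sqrt (2 * 2)) at 2 by (apply sqrt_square; lra). apply sqrt_lt_1_alt. lra. }
    change (Cmod (w - z) < sqrt 2 * (eps / 2)) in Hb. nra.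
Qed.

(** [U] holds where [f] vanishes nearby, [V] where [f] is nonzero on a punctured disc. Both are open
    and together cover [D] by [has_ps_zero_or_isolated]. No point can lie in both, so connectedness
    leaves no room for a point of [D] in [V]. *)
Lemma identity_theorem (D : C -> Prop) f z0 e0 :
  connected D -> (forall z, D z -> analytic_at f z) ->
  D z0 -> 0 < e0 -> (forall w, Cmod (w - z0) < e0 -> f w = RtoC 0) ->
  forall z, D z -> f z = RtoC 0.
Proof.
  intros HD Hf Hz0 He0 H0 z Hz.
  set (U := fun z => exists eps, 0 < eps /\ forall w, Cmod (w - z) < eps -> f w = RtoC 0).
  set (V := fun z => exists eps, 0 < eps /\ forall w, 0 < Cmod (w - z) < eps -> f w <> RtoC 0).
  assert (HU : open U).
  { apply open_C. intros y [eps [He Hy]]. exists (eps / 2). split; [lra|].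
    intros w Hw. exists (eps / 2). split; [lra|]. intros v Hv. apply Hy.
    pose proof (Cmod_sub_triangle v w y). lra. }
  assert (HV : open V).
  { apply open_C. intros y [eps [He Hy]]. exists eps. split; [lra|].
    intros w Hw. destruct (classic (w = y)) as [->|Hn]; [now exists eps|].
    assert (Hwy : 0 < Cmod (w - y)) by now apply Cmod_gt_0, Cminus_eq_contra.
    exists (Rmin (Cmod (w - y)) (eps - Cmod (w - y))). split; [apply Rmin_pos; lra|].
    intros v [_ Hv]. apply Hy.
    pose proof (Rmin_l (Cmod (w - y)) (eps - Cmod (w - y))).
    pose proof (Rmin_r (Cmod (w - y)) (eps - Cmod (w - y))).
    pose proof (Cmod_sub_triangle v w y). pose proof (Cmod_sub_triangle w v y).
    rewrite (Cmod_sub_sym w v) in *. lra. }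
  assert (HUV : forall y, D y -> U y \/ V y).
  { intros y Hy. destruct (Hf y Hy) as [c [R [HR Hc]]].
    destruct (has_ps_zero_or_isolated _ _ _ HR Hc) as [Hz'|[eps [He Hn]]].
    - left. exists R. split; [exact HR|]. intros w Hw. specialize (Hc _ Hw). cbv beta in Hc.
      replace (y + (w - y))%C with w in Hc by ring.
      eapply cser_unique; [exact Hc|]. eapply cser_ext; [|apply cser_zero].
      intros k. simpl. rewrite Hz'. ring.
    - right. exists eps. split; [exact He|]. intros w Hw. specialize (Hn _ Hw).
      replace (y + (w - y))%C with w in Hn by ring. exact Hn. }
  assert (Hself : forall y, Cmod (y - y) = 0).
  { intros y. replace (y - y)%C with (RtoC 0) by ring. apply Cmod_0. }
  destruct (HUV z Hz) as [[eps [He HzU]]|HzV].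
  { apply HzU. rewrite Hself. exact He. }
  exfalso.
  destruct (HD U V HU HV HUV) as [y [_ [[e1 [He1 H1]] [e2 [He2 H2]]]]].
  - exists z0. split; [exact Hz0|]. now exists e0.
  - exists z. split; assumption.
  - set (x := Rmin e1 e2 / 2).
    assert (Hx : 0 < x) by (unfold x; pose proof (Rmin_pos e1 e2 He1 He2); lra).
    assert (x < e1) by (unfold x in *; pose proof (Rmin_l e1 e2); lra).
    assert (x < e2) by (unfold x in *; pose proof (Rmin_r e1 e2); lra).
    assert (Hm : Cmod (y + RtoC x - y) = x).
    { replace (y + RtoC x - y)%C with (RtoC x) by ring. apply Cmod_pos_real. lra. }
    apply (H2 (y + RtoC x)%C); [rewrite Hm; lra|]. apply H1. rewrite Hm. lra.
Qed.

(** * Complex-valued functions of a real variable *)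

(** Componentwise, so that [auto_derive] and the real mean value theorem apply directly. *)
Definition Cderiv (phi : R -> C) (t : R) (v : C) : Prop :=
  is_derive (fun t => Re (phi t)) t (Re v) /\ is_derive (fun t => Im (phi t)) t (Im v).

Ltac rewrite_Derive :=
  repeat match goal with
  | H : is_derive _ ?x _ |- context [Derive ?g ?x] =>
      rewrite (is_derive_unique g x _ H)
  end.

Lemma Cderiv_const c t : Cderiv (fun _ => c) t (RtoC 0).
Proof. split; apply (is_derive_const (K := R_AbsRing) (V := R_NormedModule)). Qed.

Lemma Cderiv_minus f g t u v :
  Cderiv f t u -> Cderiv g t v -> Cderiv (fun t => f t - g t)%C t (u - v)%C.
Proof.
  intros [H1 H2] [H3 H4].
  split; [exact (is_derive_minus _ _ _ _ _ H1 H3)|exact (is_derive_minus _ _ _ _ _ H2 H4)].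
Qed.

Lemma Cderiv_real_scal (f : R -> R) (df : R) c t :
  is_derive f t df -> Cderiv (fun t => RtoC (f t) * c)%C t (RtoC df * c)%C.
Proof.
  intros H. split; simpl.
  - eapply is_derive_ext with (f := fun t => f t * Re c); [intros; simpl; unfold Re; ring|].
    replace (df * fst c - 0 * snd c) with (df * Re c) by (unfold Re; ring).
    auto_derive; [now exists df|]. rewrite_Derive. ring.
  - eapply is_derive_ext with (f := fun t => f t * Im c); [intros; simpl; unfold Im; ring|].
    replace (df * snd c + 0 * fst c) with (df * Im c) by (unfold Im; ring).
    auto_derive; [now exists df|]. rewrite_Derive. ring.
Qed.

Lemma is_derive_lin_comb (a b : R) (p q : R -> R) t dp dq : is_derive p t dp -> is_derive q t dq ->
  is_derive (fun t => a * p t + b * q t) t (a * dp + b * dq).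
Proof.
  intros Hp Hq. auto_derive; [split; [now exists dp|split; [now exists dq|easy]]|].
  rewrite_Derive. ring.
Qed.

Lemma Cderiv_cst_mult f c t v : Cderiv f t v -> Cderiv (fun t => c * f t)%C t (c * v)%C.
Proof.
  intros [H1 H2]. split.
  - apply is_derive_ext with (f := fun t => Re c * Re (f t) + (- Im c) * Im (f t)).
    + intros s. unfold Re, Im. simpl. ring.
    + replace (Re (c * v)) with (Re c * Re v + (- Im c) * Im v)
        by (unfold Re, Im; simpl; ring).
      now apply is_derive_lin_comb.
  - apply is_derive_ext with (f := fun t => Re c * Im (f t) + Im c * Re (f t)).
    + intros s. unfold Re, Im. simpl. ring.
    + replace (Im (c * v)) with (Re c * Im v + Im c * Re v)
        by (unfold Re, Im; simpl; ring).
      now apply is_derive_lin_comb.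
Qed.

Lemma is_derive_exp_cos_sin (p q : R -> R) t dp dq : is_derive p t dp -> is_derive q t dq ->
  is_derive (fun t => exp (p t) * cos (q t)) t
    (dp * (exp (p t) * cos (q t)) - dq * (exp (p t) * sin (q t))) /\
  is_derive (fun t => exp (p t) * sin (q t)) t
    (dp * (exp (p t) * sin (q t)) + dq * (exp (p t) * cos (q t))).
Proof.
  intros Hp Hq. split; (auto_derive; [split; [now exists dp|split; [now exists dq|easy]]|]);
    rewrite_Derive; ring.
Qed.

Lemma Cderiv_Cexp f t v : Cderiv f t v -> Cderiv (fun t => Cexp (f t)) t (v * Cexp (f t))%C.
Proof. intros [H1 H2]. exact (is_derive_exp_cos_sin _ _ _ _ _ H1 H2). Qed.

Lemma Cderiv_ext f g t v : (forall t, f t = g t) -> Cderiv f t v -> Cderiv g t v.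
Proof.
  intros H [H1 H2]. split; (eapply is_derive_ext; [|eassumption]);
    intros s; simpl; now rewrite H.
Qed.

Lemma le_of_derivative_le (f g f' g' : R -> R) (Y : R) :
  (forall t, 0 <= t <= Y -> is_derive f t (f' t)) ->
  (forall t, 0 <= t <= Y -> is_derive g t (g' t)) ->
  (forall t, 0 <= t <= Y -> f' t <= g' t) ->
  forall t, 0 <= t <= Y -> f t - f 0 <= g t - g 0.
Proof.
  intros Hf Hg Hle t Ht.
  assert (Hd : forall x, 0 <= x <= t -> is_derive (fun x => g x - f x) x (g' x - f' x)).
  { intros x Hx. apply (is_derive_minus g f x); [apply Hg|apply Hf]; lra. }
  destruct (MVT_gen (fun x => g x - f x) 0 t (fun x => g' x - f' x)) as [c [Hc Heq]].
  - intros x Hx. apply Hd. rewrite Rmin_left, Rmax_right in Hx; lra.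
  - intros x Hx. apply continuity_pt_filterlim.
    apply (ex_derive_continuous (fun x => g x - f x)). eexists. apply Hd.
    rewrite Rmin_left, Rmax_right in Hx; lra.
  - rewrite Rmin_left, Rmax_right in Hc by lra.
    assert (f' c <= g' c) by (apply Hle; lra).
    assert (0 <= (g' c - f' c) * (t - 0)) by (apply Rmult_le_pos; lra). lra.
Qed.

Lemma is_derive_pow_fact J t :
  is_derive (fun t => t ^ S J / INR (fact (S J))) t (t ^ J / INR (fact J)).
Proof.
  assert (H : is_derive (fun t => t ^ S J) t (INR (S J) * t ^ J)).
  { replace (INR (S J) * t ^ J) with (INR (S J) * 1 * t ^ J) by ring.
    apply (is_derive_pow (fun t => t) (S J)), (is_derive_id (K := R_AbsRing)). }
  apply is_derive_ext with (f := fun t => / INR (fact (S J)) * t ^ S J);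
    [intros s; unfold Rdiv; apply Rmult_comm|].
  replace (t ^ J / INR (fact J)) with (/ INR (fact (S J)) * (INR (S J) * t ^ J)).
  - now apply (is_derive_scal (fun t => t ^ S J)).
  - rewrite fact_simpl, mult_INR.
    pose proof (INR_fact_neq_0 J). assert (INR (S J) <> 0) by now apply not_0_INR.
    field. now split.
Qed.

(** Integration of a bound without integrals: each component is compared with a primitive of the
    bound by the mean value theorem. The factor 2 absorbs the sqrt 2 lost in recombining the
    components. *)
Lemma Cderiv_bound (phi psi : R -> C) (Y M : R) J :
  (forall t, 0 <= t <= Y -> Cderiv phi t (psi t)) ->
  (forall t, 0 <= t <= Y -> Cmod (psi t) <= M * (t ^ J / INR (fact J))) ->
  forall t, 0 <= t <= Y -> Cmod (phi t - phi 0) <= 2 * M * (t ^ S J / INR (fact (S J))).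
Proof.
  intros Hd HM t Ht.
  set (m := fun t => M * (t ^ S J / INR (fact (S J)))).
  set (m' := fun t => M * (t ^ J / INR (fact J))).
  assert (Hm : forall t, is_derive m t (m' t)).
  { intros u. apply (is_derive_scal (fun t => t ^ S J / INR (fact (S J)))), is_derive_pow_fact. }
  assert (Hm0 : m 0 = 0) by (unfold m; simpl; unfold Rdiv; ring).
  assert (Hc : forall p : C -> R, (forall z, Rabs (p z) <= Cmod z) ->
    (forall t, 0 <= t <= Y -> is_derive (fun t => p (phi t)) t (p (psi t))) ->
    Rabs (p (phi t) - p (phi 0)) <= m t).
  { intros p Hp Hpd.
    assert (Hpb : forall u, 0 <= u <= Y -> Rabs (p (psi u)) <= m' u).
    { intros u Hu. eapply Rle_trans; [apply Hp|now apply HM]. }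
    apply Rabs_le. split.
    - assert (H1 : forall u, 0 <= u <= Y -> - m' u <= p (psi u)).
      { intros u Hu. pose proof (Hpb u Hu) as Hb. apply Rabs_le_between in Hb. lra. }
      assert (Hn : forall u, 0 <= u <= Y -> is_derive (fun t => - m t) u (- m' u)).
      { intros u _. apply (is_derive_opp m), Hm. }
      pose proof (le_of_derivative_le _ _ _ _ Y Hn Hpd H1 t Ht). cbv beta in *. lra.
    - assert (H1 : forall u, 0 <= u <= Y -> p (psi u) <= m' u).
      { intros u Hu. pose proof (Hpb u Hu) as Hb. apply Rabs_le_between in Hb. lra. }
      pose proof (le_of_derivative_le _ _ _ _ Y Hpd (fun u _ => Hm u) H1 t Ht).
      cbv beta in *. lra. }
  assert (HR : Rabs (Re (phi t) - Re (phi 0)) <= m t).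
  { apply Hc; [intros; apply re_le_Cmod|]. intros u Hu. apply Hd, Hu. }
  assert (HI : Rabs (Im (phi t) - Im (phi 0)) <= m t).
  { apply Hc; [intros z; eapply Rle_trans; [apply Rmax_r|apply Rmax_Cmod]|].
    intros u Hu. apply Hd, Hu. }
  replace (2 * M * (t ^ S J / INR (fact (S J)))) with (2 * m t) by (unfold m; ring).
  eapply Rle_trans; [apply Cmod_2Rmax|].
  assert (Hmax : Rmax (Rabs (fst (phi t - phi 0)%C)) (Rabs (snd (phi t - phi 0)%C)) <= m t)
    by (apply Rmax_lub; assumption).
  assert (0 <= m t) by (eapply Rle_trans; [apply Rabs_pos|exact HR]).
  assert (sqrt 2 <= 2).
  { replace 2 with (sqrt (2 * 2)) at 2 by (apply sqrt_square; lra). apply sqrt_le_1_alt. lra. }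
  apply Rmult_le_compat; [apply sqrt_pos| |assumption|assumption].
  eapply Rle_trans; [apply Rabs_pos|apply Rmax_l].
Qed.

(** The remainder of order J + 1 has derivative [w] times the remainder of order [J]. Every use of
    [Cderiv_bound] costs a factor 2, hence the power of 2 |w|. *)
Lemma Cexp_taylor_bound (w : C) J t : 0 <= t <= 1 ->
  Cmod (Cexp (t * w) - csum (fun j => RtoC (t ^ j / INR (fact j)) * w ^ j)%C J)
  <= exp (Cmod w) * (2 * Cmod w) ^ J * (t ^ J / INR (fact J)).
Proof.
  revert t. induction J as [|J IH]; intros t Ht.
  - simpl. replace (Cexp (t * w) - 0)%C with (Cexp (t * w)) by ring.
    rewrite Cmod_Cexp. replace (1 / 1) with 1 by field. rewrite !Rmult_1_r.
    assert (Hre : Re (t * w) <= Cmod w).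
    { replace (Re (t * w)) with (t * Re w) by (unfold Re, Cmult, RtoC; simpl; ring).
      pose proof (re_le_Cmod w) as H. apply Rabs_le_between in H. pose proof (Cmod_ge_0 w). nra. }
    destruct Hre as [Hre|Hre]; [left; now apply exp_increasing|rewrite Hre; lra].
  - set (phi := fun t : R => (Cexp (t * w) - csum (fun j => RtoC (t ^ j / INR (fact j)) * w ^ j) (S J))%C).
    assert (Hphi0 : phi 0 = RtoC 0).
    { unfold phi. rewrite Cmult_0_l, Cexp_0, csum_S_l.
      rewrite csum_zero.
      - simpl. replace (1 / 1) with 1 by field. ring.
      - intros k _. simpl. unfold Rdiv. rewrite !Rmult_0_l. ring. }
    assert (Hd : forall t, Cderiv phi t
       (w * (Cexp (t * w) - csum (fun j => RtoC (t ^ j / INR (fact j)) * w ^ j) J))%C).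
    { intros u. unfold phi. 
      replace (w * (Cexp (u * w) - csum (fun j => RtoC (u ^ j / INR (fact j)) * w ^ j) J))%C
        with (w * Cexp (u * w) - w * csum (fun j => RtoC (u ^ j / INR (fact j)) * w ^ j) J)%C
        by ring.
      apply Cderiv_minus.
      - apply (Cderiv_Cexp (fun t : R => (t * w)%C)).
        pose proof (Cderiv_real_scal (fun t => t) 1 w u (is_derive_id (K := R_AbsRing) u)) as H.
        rewrite Cmult_1_l in H. exact H.
      - clear. induction J as [|J IH].
        + simpl. apply Cderiv_ext with (f := fun _ => RtoC 1).
          * intros. replace (1 / 1) with 1 by field. ring.
          * replace (w * 0)%C with (RtoC 0) by ring. apply Cderiv_const.
        + apply Cderiv_ext with (f := fun t : R =>
            (csum (fun j => RtoC (t ^ j / INR (fact j)) * w ^ j) (S J)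
             - RtoC (t ^ S J / INR (fact (S J))) * ((-(1)) * w ^ S J))%C).
          * intros s. rewrite (csum_S _ (S J)). ring.
          * replace (w * csum (fun j => RtoC (u ^ j / INR (fact j)) * w ^ j) (S J))%C with
             (w * csum (fun j => RtoC (u ^ j / INR (fact j)) * w ^ j) J
              - RtoC (u ^ J / INR (fact J)) * ((-(1)) * w ^ S J))%C
              by (rewrite Cpow_S, csum_S; ring).
            apply Cderiv_minus; [exact IH|]. apply Cderiv_real_scal, is_derive_pow_fact. }
    pose proof (Cderiv_bound phi _ 1 (Cmod w * (exp (Cmod w) * (2 * Cmod w) ^ J)) J
      (fun t _ => Hd t)) as Hb.
    cbv beta in Hb. specialize (Hb ltac:(intros u Hu; rewrite Cmod_mult, Rmult_assoc;
      apply Rmult_le_compat_l; [apply Cmod_ge_0|now apply IH]) t Ht).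
    rewrite Hphi0 in Hb. replace (phi t - 0)%C with (phi t) in Hb by ring.
    unfold phi in Hb. eapply Rle_trans; [exact Hb|]. right.
    rewrite <- (tech_pow_Rmult (2 * Cmod w)). ring.
Qed.

Lemma has_ps_Cexp (a : C) R : has_ps (fun k => a ^ k / INR (fact k))%C R (fun w => Cexp (a * w)).
Proof.
  intros w _ eps He. set (z := (a * w)%C).
  destruct (cv_speed_pow_fact (2 * Cmod z) (eps / exp (Cmod z))) as [N HN].
  { apply Rdiv_lt_0_compat; [exact He|apply exp_pos]. }
  exists N. intros n Hn. specialize (HN n Hn). unfold R_dist in HN. rewrite Rminus_0_r in HN.
  pose proof (Cexp_taylor_bound z n 1 ltac:(lra)) as Hb. rewrite Cmult_1_l in Hb.
  rewrite Cmod_sub_sym.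
  rewrite (csum_ext _ (fun j => RtoC (1 ^ j / INR (fact j)) * z ^ j)%C).
  - eapply Rle_lt_trans; [exact Hb|]. rewrite pow1.
    apply Rabs_def2 in HN. destruct HN as [HN _].
    apply Rmult_lt_compat_l with (r := exp (Cmod z)) in HN; [|apply exp_pos].
    replace (exp (Cmod z) * (eps / exp (Cmod z))) with eps in HN
      by (field; apply Rgt_not_eq, exp_pos).
    unfold Rdiv in *. lra.
  - intros k _. unfold z. rewrite pow1, Cpow_mult_l, RtoC_div by apply INR_fact_neq_0.
    field. intros Hf. apply RtoC_inj in Hf. revert Hf. apply INR_fact_neq_0.
Qed.

Lemma entire_Cexp (a : C) : entire (fun s => Cexp (a * s)).
Proof.
  intros z R. eexists.
  eapply has_ps_ext; [|exact (has_ps_scal (Cexp (a * z)) _ _ _ (has_ps_Cexp a R))].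
  intros w _. cbv beta. rewrite <- Cexp_plus. f_equal. ring.
Qed.

(** * The logarithm on the right half-plane *)

Lemma Cmod_sqr (z : C) : Cmod z * Cmod z = Re z * Re z + Im z * Im z.
Proof. pose proof (Cmod2_alt z) as H. simpl in H. rewrite !Rmult_1_r in H. exact H. Qed.

Lemma sqrt_ratio (z : C) : 0 < Re z -> sqrt (1 + (Im z / Re z)²) = Cmod z / Re z.
Proof.
  intros H. apply Rsqr_inj.
  - apply sqrt_pos.
  - apply Rmult_le_pos; [apply Cmod_ge_0|left; now apply Rinv_0_lt_compat].
  - rewrite Rsqr_sqrt by (pose proof (Rle_0_sqr (Im z / Re z)); lra).
    unfold Rsqr. replace (Cmod z / Re z * (Cmod z / Re z)) with (Cmod z * Cmod z / (Re z * Re z))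
      by (field; lra).
    rewrite Cmod_sqr. field. lra.
Qed.

Lemma Cmod_pos_of_Re (z : C) : 0 < Re z -> 0 < Cmod z.
Proof. intros H. pose proof (re_le_Cmod z) as Hz. apply Rabs_le_between in Hz. lra. Qed.

Lemma cos_atan_ratio (z : C) : 0 < Re z -> cos (atan (Im z / Re z)) = Re z / Cmod z.
Proof.
  intros H. pose proof (Cmod_pos_of_Re z H). rewrite cos_atan, sqrt_ratio by exact H.
  field. lra.
Qed.

Lemma sin_atan_ratio (z : C) : 0 < Re z -> sin (atan (Im z / Re z)) = Im z / Cmod z.
Proof.
  intros H. pose proof (Cmod_pos_of_Re z H). rewrite sin_atan, sqrt_ratio by exact H.
  field. lra.
Qed.

(** On the right half-plane this replaces the case distinction on the sign of the imaginary part by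
    a single smooth formula, which can be differentiated. *)
Lemma Clog_atan (z : C) : 0 < Re z -> Clog z = (ln (Cmod z), atan (Im z / Re z)).
Proof.
  intros H. unfold Clog. f_equal. unfold Carg. rewrite <- cos_atan_ratio by exact H.
  pose proof (atan_bound (Im z / Re z)) as Hb. pose proof PI_RGT_0.
  assert (Hi : 0 < / Re z) by now apply Rinv_0_lt_compat.
  destruct (Rle_dec 0 (Im z)) as [Hz|Hz].
  - apply acos_cos. split; [|lra]. rewrite <- atan_0.
    assert (Hq : 0 <= Im z / Re z) by (apply Rmult_le_pos; lra).
    destruct Hq as [Hq|Hq]; [left; now apply atan_increasing|rewrite <- Hq; lra].
  - rewrite <- cos_neg, acos_cos; [ring|]. split; [|lra].
    assert (Hq : Im z / Re z < 0) by (apply Rnot_le_lt in Hz; unfold Rdiv; nra).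
    apply atan_increasing in Hq. rewrite atan_0 in Hq. lra.
Qed.

Lemma Cexp_Clog (z : C) : 0 < Re z -> Cexp (Clog z) = z.
Proof.
  intros H. pose proof (Cmod_pos_of_Re z H). rewrite Clog_atan by exact H.
  unfold Cexp. simpl. rewrite cos_atan_ratio, sin_atan_ratio, exp_ln by assumption.
  destruct z as [a b]. simpl. f_equal; field; apply Rgt_not_eq; assumption.
Qed.

Lemma Cderiv_Clog (z : C) (y : R) : 0 < Re z + y ->
  Cderiv (fun y => Clog (z + RtoC y)) y (/ (z + RtoC y))%C.
Proof.
  intros Hy. destruct z as [a b]. simpl in Hy.
  assert (Hs : 0 < (a + y) * (a + y) + b * b) by nra.
  assert (Hloc : locally y (fun t => 0 < a + t)).
  { apply (open_gt 0 (a + y)) in Hy. destruct Hy as [e He]. exists e. intros t Ht.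
    apply He. change (Rabs (t - y) < e) in Ht. change (Rabs (a + t - (a + y)) < e).
    replace (a + t - (a + y)) with (t - y) by ring. exact Ht. }
  split.
  (* Half the logarithm of the squared modulus avoids differentiating a square root. *)
  - apply is_derive_ext_loc with (f := fun t => / 2 * ln ((a + t) * (a + t) + b * b)).
    + apply filter_imp with (2 := Hloc). intros t Ht. simpl.
      set (q := (a + t) * (a + t) + b * b).
      assert (Hq : 0 < q) by (unfold q; nra).
      replace (Cmod ((a, b) + RtoC t)) with (sqrt q) by (unfold Cmod, q; simpl; f_equal; ring).
      rewrite <- (sqrt_sqrt q) at 1 by lra. rewrite ln_mult by now apply sqrt_lt_R0. field.
    + auto_derive; [exact Hs|]. simpl. field. lra.
  - apply is_derive_ext_loc with (f := fun t => atan (b / (a + t))).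
    + apply filter_imp with (2 := Hloc). intros t Ht. rewrite Clog_atan by (simpl; lra).
      simpl. f_equal. unfold Rdiv. f_equal. ring.
    + auto_derive; [lra|]. simpl. field. lra.
Qed.

(** * Families [G(s, d)] behaving like [(x + d)^(-s)] *)

(* [d/dd] acts on [(x + d)^(-s)] as [Dop]. *)
Definition Dop (G : C -> R -> C) : C -> R -> C := fun s d => (- s * G (s + 1) d)%C.

Fixpoint Dpow (k : nat) (G : C -> R -> C) : C -> R -> C :=
  match k with O => G | S k => Dpow k (Dop G) end.

(* Remainder of order [J] in the formal Taylor expansion of [G s (d + y)]. *)
Fixpoint Tay (J : nat) (y : R) (G : C -> R -> C) : C -> R -> C :=
  match J with
  | O => fun s d => G s (d + y)
  | S J => fun s d => (Tay J y G s d - RtoC (y ^ J / INR (fact J)) * Dpow J G s d)%C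
  end.

Definition lincomb (a : C) (G : C -> R -> C) (b : C) (H : C -> R -> C) : C -> R -> C :=
  fun s d => (a * G s d + b * H s d)%C.

(** [p] counts the decay gained over (x + d)^(-s), locally uniformly in [s]. Using 1 + d rather than
    [d] keeps the bound finite at d = 0. *)
Definition order_at_least (p : R) (G : C -> R -> C) : Prop :=
  forall R, exists A, 0 <= A /\ forall s d, Cmod s <= R -> 0 <= d ->
    Cmod (G s d) <= A * Rpower (1 + d) (- Re s - p).

(** Applied to [Tay J y G], this says that the expansion of order [J] is exact at s = -N for N < J,
    as it is for the polynomial (x + d)^N. *)
Definition vanishing (J : nat) (G : C -> R -> C) : Prop :=
  forall N d, (N < J)%nat -> 0 <= d -> G (- RtoC (INR N))%C d = RtoC 0.

Definition entire_family (G : C -> R -> C) : Prop :=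
  forall d, 0 <= d -> entire (fun s => G s d).

(** The invariant of the induction on [r]. The order clause makes the correcting sums converge at
    the next step; the vanishing clause is what evaluates the families at the nonpositive
    integers. *)
Definition tame (G : C -> R -> C) : Prop :=
  entire_family G /\
  forall J y, 0 <= y -> order_at_least (INR J) (Tay J y G) /\ vanishing J (Tay J y G).

Lemma Dpow_Dop k G : Dpow k (Dop G) = Dop (Dpow k G).
Proof. revert G. induction k as [|k IH]; intros G; [reflexivity|]. apply (IH (Dop G)). Qed.

Lemma Dpow_S k G : Dpow (S k) G = Dop (Dpow k G).
Proof. apply Dpow_Dop. Qed.

Lemma Dpow_add k j G : Dpow k (Dpow j G) = Dpow (k + j) G.
Proof.
  induction k as [|k IH]; [reflexivity|]. change (S k + j)%nat with (S (k + j)).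
  now rewrite !Dpow_S, IH.
Qed.

Lemma Dop_lincomb a G b H : Dop (lincomb a G b H) = lincomb a (Dop G) b (Dop H).
Proof.
  apply functional_extensionality; intros s. apply functional_extensionality; intros d.
  unfold Dop, lincomb. ring.
Qed.

Lemma Dpow_lincomb k a G b H : Dpow k (lincomb a G b H) = lincomb a (Dpow k G) b (Dpow k H).
Proof. induction k as [|k IH]; [reflexivity|]. now rewrite !Dpow_S, IH, Dop_lincomb. Qed.

Lemma Tay_lincomb J y a G b H :
  Tay J y (lincomb a G b H) = lincomb a (Tay J y G) b (Tay J y H).
Proof.
  apply functional_extensionality; intros s. apply functional_extensionality; intros d.
  induction J as [|J IH]; [reflexivity|]. simpl. rewrite IH, Dpow_lincomb.
  unfold lincomb. ring.
Qed.

Lemma Tay_Dop J y G : Tay J y (Dop G) = Dop (Tay J y G).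
Proof.
  apply functional_extensionality; intros s. apply functional_extensionality; intros d.
  induction J as [|J IH]; [reflexivity|]. simpl. rewrite IH, Dpow_Dop. unfold Dop. ring.
Qed.

Lemma Dpow_shift k G y s d : Dpow k (fun s d => G s (d + y)) s d = Dpow k G s (d + y).
Proof.
  revert G. induction k as [|k IH]; intros G; [reflexivity|]. apply (IH (Dop G)).
Qed.

Lemma Tay_shift J y G b s d :
  Tay J y (fun s d => G s (d + b)) s d = Tay J y G s (d + b).
Proof.
  induction J as [|J IH]; simpl; [f_equal; ring|]. now rewrite IH, Dpow_shift.
Qed.

Lemma Tay_expand J (y : R) (G : C -> R -> C) s (d : R) :
  (G s (d + y)%R = csum (fun j => RtoC (y ^ j / INR (fact j)) * Dpow j G s d) J + Tay J y G s d)%C.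
Proof. induction J as [|J IH]; simpl; [ring|]. rewrite IH at 1. ring. Qed.

Lemma Rpower_le a b c : 1 <= a -> b <= c -> Rpower a b <= Rpower a c.
Proof.
  intros Ha Hb. destruct (Rle_lt_or_eq_dec 1 a Ha) as [H|<-]; [now apply Rle_Rpower|].
  unfold Rpower. rewrite ln_1, !Rmult_0_r. lra.
Qed.

Lemma order_weaken p q G : q <= p -> order_at_least p G -> order_at_least q G.
Proof.
  intros Hpq H R. destruct (H R) as [A [HA HG]]. exists A. split; [exact HA|].
  intros s d Hs Hd. eapply Rle_trans; [now apply HG|].
  apply Rmult_le_compat_l; [exact HA|]. apply Rpower_le; lra.
Qed.

Lemma order_lincomb p a G b H :
  order_at_least p G -> order_at_least p H -> order_at_least p (lincomb a G b H).
Proof.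
  intros HG HH R. destruct (HG R) as [A [HA HGA]]. destruct (HH R) as [B [HB HHB]].
  pose proof (Cmod_ge_0 a). pose proof (Cmod_ge_0 b).
  exists (Cmod a * A + Cmod b * B). split.
  - apply Rplus_le_le_0_compat; now apply Rmult_le_pos.
  - intros s d Hs Hd. unfold lincomb. eapply Rle_trans; [apply Cmod_triangle|].
    rewrite !Cmod_mult, Rmult_plus_distr_r, !Rmult_assoc.
    apply Rplus_le_compat; (apply Rmult_le_compat_l; [assumption|]); auto.
Qed.

(** The argument s + 1 gains one power of 1 + d, and the factor [s] is bounded on a disc. The
    hypothesis is used on a disc whose radius is larger by 1, to contain s + 1. *)
Lemma order_Dop p G : order_at_least p G -> order_at_least (p + 1) (Dop G).
Proof.
  intros HG R. destruct (HG (Rabs R + 1)) as [A [HA HGA]].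
  exists (Rabs R * A). split; [apply Rmult_le_pos; [apply Rabs_pos|exact HA]|].
  intros s d Hs Hd. unfold Dop. rewrite Cmod_mult, Cmod_opp, Rmult_assoc.
  assert (HsR : Cmod s <= Rabs R) by (eapply Rle_trans; [exact Hs|apply Rle_abs]).
  apply Rmult_le_compat; [apply Cmod_ge_0|apply Cmod_ge_0|exact HsR|].
  replace (- Re s - (p + 1)) with (- Re (s + 1)%C - p) by (unfold Re; simpl; ring).
  apply HGA; [|exact Hd]. eapply Rle_trans; [apply Cmod_triangle|]. rewrite Cmod_1. lra.
Qed.

Lemma order_Dpow p k G : order_at_least p G -> order_at_least (p + INR k) (Dpow k G).
Proof.
  intros HG. induction k as [|k IH]; [simpl; now rewrite Rplus_0_r|].
  rewrite Dpow_S, S_INR, <- Rplus_assoc. now apply order_Dop.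
Qed.

Lemma vanishing_lincomb J a G b H :
  vanishing J G -> vanishing J H -> vanishing J (lincomb a G b H).
Proof. intros HG HH N d HN Hd. unfold lincomb. rewrite HG, HH by assumption. ring. Qed.

(** At s = 0 the factor [s] vanishes; at any other -N the value of [G] at -(N - 1) does. *)
Lemma vanishing_Dop J G : vanishing J G -> vanishing J (Dop G).
Proof.
  intros HG [|N] d HN Hd; unfold Dop.
  - simpl. ring.
  - replace (- INR (S N) + 1)%C with (- INR N)%C by (rewrite S_INR, RtoC_plus; ring).
    rewrite HG by (lia || lra). ring.
Qed.

Lemma entire_family_lincomb a G b H :
  entire_family G -> entire_family H -> entire_family (lincomb a G b H).
Proof.
  intros HG HH d Hd z R. destruct (HG d Hd z R) as [c Hc]. destruct (HH d Hd z R) as [e He].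
  eexists. exact (has_ps_plus _ _ _ _ _ (has_ps_scal a _ _ _ Hc) (has_ps_scal b _ _ _ He)).
Qed.

Lemma entire_shift f a : entire f -> entire (fun s => f (s + a)%C).
Proof.
  intros Hf z R. destruct (Hf (z + a)%C R) as [c Hc]. exists c.
  eapply has_ps_ext; [|exact Hc]. intros w _. cbv beta. f_equal. ring.
Qed.

Lemma entire_mult_id f : entire f -> entire (fun s => s * f s)%C.
Proof. intros Hf z R. destruct (Hf z R) as [c Hc]. exact (has_ps_mult_lin z _ _ _ Hc). Qed.

Lemma entire_family_Dop G : entire_family G -> entire_family (Dop G).
Proof.
  intros HG d Hd z R.
  pose proof (entire_mult_id _ (entire_shift _ (RtoC 1) (HG d Hd))) as H.
  assert (HE : exists c, has_ps c R (fun w => (z + w - 1 + 1) * G ((z + w)  + 1) d)%C).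
  { destruct (H z R) as [c Hc]. exists c.
    eapply has_ps_ext; [|exact Hc]. intros w _. cbv beta. ring. }
  destruct HE as [c Hc]. eexists. eapply has_ps_ext; [|exact (has_ps_scal (-(1)) _ _ _ Hc)].
  intros w _. unfold Dop. ring.
Qed.

Lemma entire_family_translate G y : 0 <= y -> entire_family G -> entire_family (fun s d => G s (d + y)).
Proof. intros Hy HG d Hd. apply HG. lra. Qed.

(** The exponent may have either sign: if nonnegative, 1 + d + y <= (1 + y) (1 + d) is used,
    otherwise monotonicity. The constant [B] covers both cases. *)
Lemma order_translate p G y : 0 <= y -> order_at_least p G -> order_at_least p (fun s d => G s (d + y)).
Proof.
  intros Hy HG R. destruct (HG R) as [A [HA HGA]].
  set (B := exp ((Rabs R + Rabs p) * ln (1 + y))).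
  exists (A * B). split; [apply Rmult_le_pos; [exact HA|left; apply exp_pos]|].
  intros s d Hs Hd. eapply Rle_trans; [apply HGA; lra|]. rewrite Rmult_assoc.
  apply Rmult_le_compat_l; [exact HA|]. unfold B, Rpower. rewrite <- exp_plus.
  set (e := - Re s - p).
  assert (He : e <= Rabs R + Rabs p).
  { unfold e. pose proof (re_le_Cmod s) as Hr. apply Rabs_le_between in Hr.
    pose proof (Rle_abs R). pose proof (Rabs_le_between p (Rabs p)) as [Hp _].
    specialize (Hp (Rle_refl _)). lra. }
  assert (Hl1 : ln (1 + d) <= ln (1 + (d + y))) by (apply ln_le; lra).
  assert (Hl0 : 0 <= ln (1 + y)) by (rewrite <- ln_1; apply ln_le; lra).
  assert (Hl2 : ln (1 + (d + y)) <= ln (1 + y) + ln (1 + d)).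
  { rewrite <- ln_mult by lra. apply ln_le; [lra|]. nra. }
  assert (He2 : 0 <= Rabs R + Rabs p) by (pose proof (Rabs_pos R); pose proof (Rabs_pos p); lra).
  assert (Hmain : e * ln (1 + (d + y)) <= (Rabs R + Rabs p) * ln (1 + y) + e * ln (1 + d)).
  { destruct (Rle_dec 0 e) as [H0|H0]; nra. }
  destruct Hmain as [Hm|Hm]; [left; now apply exp_increasing|rewrite Hm; lra].
Qed.

(** * The family [(x + d)^(-s)] *)

Definition base_family (x : C) : C -> R -> C := fun s d => Cexp (- s * Clog (x + RtoC d))%C.

Lemma base_family_Cderiv x s d : 0 < Re x -> 0 <= d ->
  Cderiv (fun d => base_family x s d) d (Dop (base_family x) s d).
Proof.
  intros Hx Hd.
  assert (Hre : 0 < Re (x + RtoC d)) by (unfold Re in *; simpl; lra).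
  pose proof (Cderiv_Cexp _ _ _ (Cderiv_cst_mult _ (- s)%C _ _ (Cderiv_Clog x d ltac:(lra)))) as H.
  cbv beta in H. unfold base_family at 1.
  replace (Dop (base_family x) s d) with
    (- s * / (x + RtoC d) * Cexp (- s * Clog (x + RtoC d)))%C; [exact H|].
  unfold Dop, base_family.
  replace (- (s + 1) * Clog (x + RtoC d))%C
    with (- s * Clog (x + RtoC d) + - Clog (x + RtoC d))%C by ring.
  rewrite Cexp_plus, Cexp_opp, Cexp_Clog by exact Hre. ring.
Qed.

Lemma Cderiv_translate f d y v : Cderiv f (d + y) v -> Cderiv (fun y => f (d + y)) y v.
Proof.
  intros [H1 H2]. split.
  - replace (Re v) with (1 * Re v) by ring.
    apply (is_derive_comp (fun t => Re (f t)) (fun y => d + y)); [exact H1|].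
    auto_derive; [easy|ring].
  - replace (Im v) with (1 * Im v) by ring.
    apply (is_derive_comp (fun t => Im (f t)) (fun y => d + y)); [exact H2|].
    auto_derive; [easy|ring].
Qed.

(** Differentiating a remainder in [y] lowers its order by one and applies [Dop]. Both inductions on
    [J] for the base family, for the bound and for the vanishing, integrate this relation from y =
    0. *)
Lemma base_Tay_Cderiv x J s d y : 0 < Re x -> 0 <= d -> 0 <= y ->
  Cderiv (fun y => Tay (S J) y (base_family x) s d) y (Dop (Tay J y (base_family x)) s d).
Proof.
  intros Hx Hd Hy. set (G := base_family x). induction J as [|J IH].
  - replace (Dop (Tay 0 y G) s d) with (Dop G s (d + y) - RtoC 0)%C by (unfold Dop; simpl; ring).
    apply (Cderiv_minus (fun y => G s (d + y)) (fun y => (RtoC (y ^ 0 / INR (fact 0)) * Dpow 0 G s d)%C)).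
    + apply (Cderiv_translate (fun d => G s d)). apply base_family_Cderiv; [exact Hx|lra].
    + apply Cderiv_ext with (f := fun _ => G s d); [|apply Cderiv_const].
      intros t. simpl. replace (1 / 1) with 1 by field. ring.
  - replace (Dop (Tay (S J) y G) s d) with
      (Dop (Tay J y G) s d - RtoC (y ^ J / INR (fact J)) * Dpow (S J) G s d)%C
      by (rewrite Dpow_S; unfold Dop; simpl Tay; ring).
    apply (Cderiv_minus (fun y => Tay (S J) y G s d)
      (fun y => (RtoC (y ^ S J / INR (fact (S J))) * Dpow (S J) G s d)%C)); [exact IH|].
    apply (Cderiv_real_scal (fun y => y ^ S J / INR (fact (S J)))), is_derive_pow_fact.
Qed.

Lemma Tay_0 J G s d : Tay (S J) 0 G s d = RtoC 0.
Proof.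
  induction J as [|J IH].
  - simpl. rewrite Rplus_0_r. replace (1 / 1) with 1 by field. ring.
  - change (Tay (S (S J)) 0 G s d) with
      (Tay (S J) 0 G s d - RtoC (0 ^ S J / INR (fact (S J))) * Dpow (S J) G s d)%C.
    rewrite IH, pow_i by lia. unfold Rdiv. rewrite Rmult_0_l. ring.
Qed.

Lemma Cmod_ge_Re (z : C) : Re z <= Cmod z.
Proof. pose proof (re_le_Cmod z) as H. apply Rabs_le_between in H. lra. Qed.

(** The modulus of x + d + y lies between fixed multiples of 1 + d, and its argument is bounded, so
    passing to a power of 1 + d costs only a constant for |s| <= R. *)
Lemma base_family_bound x Y R : 0 < Re x -> 0 <= Y -> exists A, 0 <= A /\
  forall s d y, Cmod s <= R -> 0 <= d -> 0 <= y <= Y ->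
    Cmod (base_family x s (d + y)) <= A * Rpower (1 + d) (- Re s).
Proof.
  intros Hx HY.
  set (m := Rmin (Re x) 1). set (M := Cmod x + Y + 1).
  assert (Hm : 0 < m) by (unfold m; apply Rmin_pos; lra).
  assert (Hm1 : m <= 1) by apply Rmin_r. assert (Hmx : m <= Re x) by apply Rmin_l.
  pose proof (Cmod_ge_0 x) as Hx0. assert (HM : 1 <= M) by (unfold M; lra).
  set (L := ln M - ln m).
  exists (exp (Rabs R * L + Rabs R * PI)). split; [left; apply exp_pos|].
  intros s d y Hs Hd Hy. unfold base_family. rewrite Cmod_Cexp. unfold Rpower.
  rewrite <- exp_plus. set (z := (x + RtoC (d + y))%C).
  assert (Hz : Re z = Re x + (d + y)) by reflexivity.
  assert (Hzp : 0 < Re z) by lra.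
  assert (Hz1 : m * (1 + d) <= Cmod z) by (pose proof (Cmod_ge_Re z); nra).
  assert (Hz2 : Cmod z <= M * (1 + d)).
  { unfold z. eapply Rle_trans; [apply Cmod_triangle|]. rewrite Cmod_pos_real by lra.
    unfold M. nra. }
  assert (Hzm : 0 < Cmod z) by now apply Cmod_pos_of_Re.
  assert (Hl1 : ln m + ln (1 + d) <= ln (Cmod z)).
  { rewrite <- ln_mult by lra. apply ln_le; [apply Rmult_lt_0_compat|]; lra. }
  assert (Hl2 : ln (Cmod z) <= ln M + ln (1 + d)).
  { rewrite <- ln_mult by lra. now apply ln_le. }
  assert (Hlm : ln m <= 0) by (rewrite <- ln_1; apply ln_le; lra).
  assert (HlM : 0 <= ln M) by (rewrite <- ln_1; apply ln_le; lra).
  rewrite Clog_atan by exact Hzp. set (th := atan (Im z / Re z)).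
  replace (Re (- s * (ln (Cmod z), th))) with (- Re s * ln (Cmod z) + Im s * th)
    by (unfold Re, Im; simpl; ring).
  assert (Hth : Rabs th <= PI).
  { pose proof (atan_bound (Im z / Re z)). pose proof PI_RGT_0. apply Rabs_le. unfold th. lra. }
  assert (HsR : Cmod s <= Rabs R) by (eapply Rle_trans; [exact Hs|apply Rle_abs]).
  assert (Hre : Rabs (Re s) <= Rabs R) by (eapply Rle_trans; [apply re_le_Cmod|exact HsR]).
  assert (Him : Rabs (Im s) <= Rabs R).
  { eapply Rle_trans; [|exact HsR]. eapply Rle_trans; [apply Rmax_r|apply (Rmax_Cmod s)]. }
  assert (H1 : Im s * th <= Rabs R * PI).
  { eapply Rle_trans; [apply Rle_abs|]. rewrite Rabs_mult.
    apply Rmult_le_compat; try apply Rabs_pos; assumption. }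
  assert (H2 : - Re s * (ln (Cmod z) - ln (1 + d)) <= Rabs R * L).
  { eapply Rle_trans; [apply Rle_abs|]. rewrite Rabs_mult, Rabs_Ropp.
    apply Rmult_le_compat; try apply Rabs_pos; [assumption|]. apply Rabs_le. unfold L. lra. }
  assert (Hmain : - Re s * ln (Cmod z) + Im s * th <=
     Rabs R * L + Rabs R * PI + - Re s * ln (1 + d)) by lra.
  destruct Hmain as [H|H]; [left; now apply exp_increasing|rewrite H; lra].
Qed.

(** Uniformity in [y] on [0, Y] is required by the induction, which integrates the previous bound
    over [y]. That bound is taken on a disc larger by 1, since [Dop] moves [s] to s + 1. *)
Lemma base_Tay_bound x Y J R : 0 < Re x -> 0 <= Y -> exists A, 0 <= A /\
  forall s d y, Cmod s <= R -> 0 <= d -> 0 <= y <= Y ->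
    Cmod (Tay J y (base_family x) s d) <= A * Rpower (1 + d) (- Re s - INR J).
Proof.
  intros Hx HY. revert R. induction J as [|J IH]; intros R.
  - destruct (base_family_bound x Y R Hx HY) as [A [HA H]]. exists A. split; [exact HA|].
    intros s d y Hs Hd Hy. simpl INR. rewrite Rminus_0_r. now apply H.
  - destruct (IH (Rabs R + 1)) as [A [HA H]].
    pose proof (Rabs_pos R). exists (2 * (Rabs R * A) * Y). split.
    { repeat apply Rmult_le_pos; lra. }
    intros s d y Hs Hd Hy.
    assert (HsR : Cmod s <= Rabs R) by (eapply Rle_trans; [exact Hs|apply Rle_abs]).
    set (P := Rpower (1 + d) (- Re s - INR (S J))).
    assert (HP : 0 <= P) by (left; apply exp_pos).
    pose proof (Cderiv_bound (fun y => Tay (S J) y (base_family x) s d)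
      (fun y => Dop (Tay J y (base_family x)) s d) Y (Rabs R * A * P) 0) as Hb.
    cbv beta in Hb. rewrite Tay_0 in Hb.
    replace (Tay (S J) y (base_family x) s d) with (Tay (S J) y (base_family x) s d - RtoC 0)%C by ring.
    eapply Rle_trans; [apply Hb; [| |exact Hy]|].
    + intros t Ht. apply base_Tay_Cderiv; [exact Hx|exact Hd|lra].
    + intros t Ht. simpl (_ ^ _). simpl fact. replace (1 / INR 1) with 1 by (simpl; field).
      rewrite Rmult_1_r. unfold Dop. rewrite Cmod_mult, Cmod_opp, Rmult_assoc.
      apply Rmult_le_compat; [apply Cmod_ge_0|apply Cmod_ge_0|exact HsR|].
      unfold P. rewrite S_INR.
      replace (- Re s - (INR J + 1)) with (- Re (s + 1)%C - INR J) by (unfold Re; simpl; ring).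
      apply H; [|exact Hd|exact Ht]. eapply Rle_trans; [apply Cmod_triangle|]. rewrite Cmod_1. lra.
    + simpl (_ ^ _). simpl fact. replace (y * 1 / INR 1) with y by (simpl; field).
      replace (2 * (Rabs R * A) * Y * P) with (2 * (Rabs R * A * P) * Y) by ring.
      apply Rmult_le_compat_l; [|lra]. repeat apply Rmult_le_pos; lra.
Qed.

(** The remainder is 0 at y = 0, and its derivative in [y] vanishes: at s = 0 through the factor
    [s], at other -N by induction. *)
Lemma base_vanishing x J y : 0 < Re x -> 0 <= y -> vanishing J (Tay J y (base_family x)).
Proof.
  intros Hx Hy. revert y Hy. induction J as [|J IH]; intros y Hy N d HN Hd; [lia|].
  pose proof (Cderiv_bound (fun y => Tay (S J) y (base_family x) (- INR N)%C d)
    (fun y => Dop (Tay J y (base_family x)) (- INR N)%C d) y 0 0) as Hb.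
  cbv beta in Hb. rewrite Tay_0 in Hb.
  apply Cmod_eq_0. apply Rle_antisym; [|apply Cmod_ge_0].
  replace (Tay (S J) y (base_family x) (- INR N)%C d)
    with (Tay (S J) y (base_family x) (- INR N)%C d - RtoC 0)%C by ring.
  eapply Rle_trans; [apply Hb; [| |lra]|].
  - intros t Ht. apply base_Tay_Cderiv; [exact Hx|exact Hd|lra].
  - intros t Ht. rewrite Rmult_0_l. right. rewrite <- Cmod_0. f_equal.
    destruct N as [|N]; unfold Dop; [simpl; ring|].
    replace (- INR (S N) + 1)%C with (- INR N)%C by (rewrite S_INR, RtoC_plus; ring).
    rewrite IH by (lia || lra). ring.
  - lra.
Qed.

Lemma tame_base x : 0 < Re x -> tame (base_family x).
Proof.
  intros Hx. split.
  - intros d Hd z R. destruct (entire_Cexp (- Clog (x + RtoC d))%C z R) as [c Hc]. exists c.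
    eapply has_ps_ext; [|exact Hc]. intros w _. unfold base_family. cbv beta. f_equal. ring.
  - intros J y Hy. split; [|now apply base_vanishing].
    intros R. destruct (base_Tay_bound x y J R Hx Hy) as [A [HA H]].
    exists A. split; [exact HA|]. intros s d Hs Hd. apply H; lra.
Qed.

Lemma csum_rev (f : nat -> C) n : csum f n = csum (fun i => f (n - S i)%nat) n.
Proof.
  revert f. induction n as [|n IH]; intros f; [reflexivity|].
  rewrite csum_S_l, (csum_S (fun i => f (S n - S i)%nat)), Nat.sub_diag.
  rewrite (IH (fun k => f (S k))), Cplus_comm. f_equal.
  apply csum_ext. intros i Hi. f_equal. lia.
Qed.

Lemma conv_comm c d n : conv c d n = conv d c n.
Proof.
  unfold conv. rewrite csum_rev. apply csum_ext. intros i Hi.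
  replace (n - (S n - S i))%nat with i by lia. replace (S n - S i)%nat with (n - i)%nat by lia.
  ring.
Qed.

(** * Closure properties of tame families *)

Definition translate (b : R) (G : C -> R -> C) : C -> R -> C := fun s d => G s (d + b).

Lemma tame_lincomb a G b H : tame G -> tame H -> tame (lincomb a G b H).
Proof.
  intros [HG1 HG2] [HH1 HH2]. split; [now apply entire_family_lincomb|].
  intros J y Hy. destruct (HG2 J y Hy), (HH2 J y Hy). rewrite Tay_lincomb.
  split; [now apply order_lincomb|now apply vanishing_lincomb].
Qed.

Lemma tame_Dop G : tame G -> tame (Dop G).
Proof.
  intros [HG1 HG2]. split; [now apply entire_family_Dop|].
  intros J y Hy. destruct (HG2 J y Hy). rewrite Tay_Dop. split; [|now apply vanishing_Dop].
  apply order_weaken with (INR J + 1); [lra|]. now apply order_Dop.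
Qed.

Lemma tame_Dpow k G : tame G -> tame (Dpow k G).
Proof. intros HG. induction k as [|k IH]; [exact HG|]. rewrite Dpow_S. now apply tame_Dop. Qed.

Lemma tame_translate b G : 0 <= b -> tame G -> tame (translate b G).
Proof.
  intros Hb [HG1 HG2]. split; [now apply entire_family_translate|].
  intros J y Hy. destruct (HG2 J y Hy) as [H1 H2].
  replace (Tay J y (translate b G)) with (translate b (Tay J y G)).
  - split; [now apply order_translate|]. intros N d HN Hd. apply H2; [exact HN|lra].
  - apply functional_extensionality; intros s. apply functional_extensionality; intros d.
    symmetry. apply Tay_shift.
Qed.

Lemma tame_order G : tame G -> order_at_least 0 G.
Proof.
  intros [_ HG]. destruct (HG O 0 (Rle_refl _)) as [H _]. intros R.
  destruct (H R) as [A [HA HAG]]. exists A. split; [exact HA|].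
  intros s d Hs Hd. specialize (HAG s d Hs Hd). simpl in HAG. now rewrite Rplus_0_r in HAG.
Qed.

(** The remainder of order [J] is the one of order J + i plus [i] Taylor terms, and these inherit
    the order [p] of [rho]. Thus the remainders of a fast decaying defect decay fast as well, and
    can be summed along a progression. *)
Lemma order_Tay p rho : order_at_least p rho -> tame rho ->
  forall i J y, 0 <= y -> INR i <= p -> order_at_least (INR J + INR i) (Tay J y rho).
Proof.
  intros Hp Ht i. induction i as [|i IH]; intros J y Hy Hi.
  - simpl. rewrite Rplus_0_r. now apply Ht.
  - rewrite S_INR in Hi.
    replace (Tay J y rho) with
      (lincomb 1 (Tay (S J) y rho) (RtoC (y ^ J / INR (fact J))) (Dpow J rho)).
    + apply order_lincomb.
      * replace (INR J + INR (S i)) with (INR (S J) + INR i) by (rewrite !S_INR; ring).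
        apply IH; [exact Hy|lra].
      * apply order_weaken with (p + INR J); [rewrite S_INR; lra|]. now apply order_Dpow.
    + apply functional_extensionality; intros s. apply functional_extensionality; intros d.
      unfold lincomb. simpl. ring.
Qed.

Fixpoint famsum (c : nat -> C) (F : nat -> C -> R -> C) (K : nat) : C -> R -> C :=
  match K with
  | O => fun _ _ => RtoC 0
  | S K => lincomb 1 (famsum c F K) (c K) (F K)
  end.

Lemma famsum_csum c F K s d : famsum c F K s d = csum (fun k => c k * F k s d)%C K.
Proof. induction K as [|K IH]; [reflexivity|]. simpl. unfold lincomb. rewrite IH. ring. Qed.

Lemma order_famsum p c F K : (forall k, (k < K)%nat -> order_at_least p (F k)) ->
  order_at_least p (famsum c F K).
Proof.
  induction K as [|K IH]; intros H.
  - intros R. exists 0. split; [lra|]. intros s d _ _. simpl. rewrite Cmod_0. lra.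
  - simpl. apply order_lincomb; [apply IH; intros; apply H; lia|apply H; lia].
Qed.

Lemma tame_zero : tame (fun _ _ => RtoC 0).
Proof.
  assert (H0 : forall J y s d, Tay J y (fun _ _ => RtoC 0) s d = RtoC 0).
  { intros J y s d.
    assert (Hk : forall k, Dpow k (fun (_ : C) (_ : R) => RtoC 0) s d = RtoC 0).
    { intros k. revert s. induction k as [|k IH]; intros s; [reflexivity|].
      rewrite Dpow_S. unfold Dop. rewrite IH. ring. }
    induction J as [|J IH]; [reflexivity|]. simpl. rewrite IH, Hk. ring. }
  split.
  - intros d Hd z R. eexists. apply has_ps_const.
  - intros J y Hy. split.
    + intros R. exists 0. split; [lra|]. intros s d _ _. rewrite H0, Cmod_0. lra.
    + intros N d _ _. apply H0.
Qed.

Lemma tame_famsum c F K : (forall k, (k < K)%nat -> tame (F k)) -> tame (famsum c F K).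
Proof.
  induction K as [|K IH]; intros H; [apply tame_zero|].
  simpl. apply tame_lincomb; [apply IH; intros; apply H; lia|apply H; lia].
Qed.

(** * Sums along arithmetic progressions *)

(** The integral test in telescoping form: the mean value theorem for t^(1 - alpha) on [u, u + a],
    with the derivative estimated at the right end. *)
Lemma Rpower_decrease_step (alpha a u : R) : 1 < alpha -> 0 < a -> 1 <= u ->
  (alpha - 1) * a * Rpower (u + a) (- alpha) <= Rpower u (1 - alpha) - Rpower (u + a) (1 - alpha).
Proof.
  intros Hal Ha Hu.
  assert (Hd : forall t, 0 < t -> is_derive (fun t => Rpower t (1 - alpha)) t
     ((1 - alpha) * Rpower t (- alpha))).
  { intros t Ht. apply is_derive_Reals.
    replace (- alpha) with (1 - alpha - 1) by ring. now apply derivable_pt_lim_power. }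
  destruct (MVT_gen (fun t => Rpower t (1 - alpha)) u (u + a)
     (fun t => (1 - alpha) * Rpower t (- alpha))) as [c [Hc Heq]].
  - intros x Hx. apply Hd. rewrite Rmin_left in Hx; lra.
  - intros x Hx. apply continuity_pt_filterlim.
    apply (ex_derive_continuous (fun t => Rpower t (1 - alpha))). eexists. apply Hd.
    rewrite Rmin_left in Hx; lra.
  - rewrite Rmin_left, Rmax_right in Hc by lra.
    assert (Hle : Rpower (u + a) (- alpha) <= Rpower c (- alpha)).
    { unfold Rpower. assert (Hln : ln c <= ln (u + a)) by (apply ln_le; lra).
      assert (H : - alpha * ln (u + a) <= - alpha * ln c) by nra.
      destruct H as [H|H]; [left; now apply exp_increasing|rewrite H; lra]. }
    replace (Rpower u (1 - alpha) - Rpower (u + a) (1 - alpha))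
      with ((alpha - 1) * a * Rpower c (- alpha)) by lra.
    apply Rmult_le_compat_l; [|exact Hle]. apply Rmult_le_pos; lra.
Qed.

Lemma bounded_progression (alpha a : R) : 1 < alpha -> 0 < a ->
  exists B, bounded_by (fun n => Rpower (1 + INR n * a) (- alpha)) B.
Proof.
  intros Hal Ha. exists (1 + / ((alpha - 1) * a)). split; [intros; left; apply exp_pos|].
  assert (Hp : 0 < (alpha - 1) * a) by (apply Rmult_lt_0_compat; lra).
  assert (Hi : 0 < / ((alpha - 1) * a)) by now apply Rinv_0_lt_compat.
  assert (H : forall n, rsum (fun n => Rpower (1 + INR n * a) (- alpha)) (S n)
    <= 1 + / ((alpha - 1) * a) * (1 - Rpower (1 + INR n * a) (1 - alpha))).
  { induction n as [|n IH].
    - simpl. rewrite Rmult_0_l, Rplus_0_r. unfold Rpower. rewrite ln_1, !Rmult_0_r, exp_0. lra.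
    - change (rsum (fun n => Rpower (1 + INR n * a) (- alpha)) (S (S n))) with
        (rsum (fun n => Rpower (1 + INR n * a) (- alpha)) (S n) + Rpower (1 + INR (S n) * a) (- alpha)).
      pose proof (pos_INR n) as Hn0.
      assert (Hu : 1 <= 1 + INR n * a) by nra.
      pose proof (Rpower_decrease_step alpha a _ Hal Ha Hu) as Hst.
      replace (1 + INR n * a + a) with (1 + INR (S n) * a) in Hst by (rewrite S_INR; ring).
      apply Rmult_le_compat_l with (r := / ((alpha - 1) * a)) in Hst; [|lra].
      rewrite <- Rmult_assoc, Rinv_l, Rmult_1_l in Hst by lra. lra. }
  intros [|n]; [simpl; lra|]. eapply Rle_trans; [apply H|].
  assert (0 < Rpower (1 + INR n * a) (1 - alpha)) by apply exp_pos. nra.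
Qed.

Lemma Rpower_anti a b e : 0 < a <= b -> e <= 0 -> Rpower b e <= Rpower a e.
Proof.
  intros Hab He. unfold Rpower. assert (ln a <= ln b) by (apply ln_le; lra).
  assert (He' : e * ln b <= e * ln a) by nra.
  destruct He' as [He'|He']; [left; now apply exp_increasing|rewrite He'; lra].
Qed.

Lemma Rpower_vanish (a e : R) : 0 < a -> 0 < e -> forall eps, 0 < eps ->
  exists N, forall n, (N <= n)%nat -> Rpower (1 + INR n * a) (- e) < eps.
Proof.
  intros Ha He eps Heps.
  set (X := Rpower eps (- / e)). assert (HX : 0 < X) by apply exp_pos.
  destruct (INR_archimed a X Ha) as [N HN]. exists N. intros n Hn.
  assert (Hn' : X < 1 + INR n * a).
  { apply le_INR in Hn. assert (INR N * a <= INR n * a) by (apply Rmult_le_compat_r; lra). lra. }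
  assert (Heq : Rpower X (- e) = eps).
  { unfold X. rewrite Rpower_mult. replace (- / e * - e) with 1 by (field; lra).
    now apply Rpower_1. }
  rewrite <- Heq. unfold Rpower. apply exp_increasing.
  assert (ln X < ln (1 + INR n * a)) by (apply ln_increasing; assumption). nra.
Qed.

(** The geometric series for the inverse of 1 - q e^(aD), acting by translations: where it
    converges, it solves S(d) - q S(d + a) = G(d). *)
Definition progression_sum (q : C) (a : R) (G : C -> R -> C) : C -> R -> C :=
  fun s d => CSum (fun n => q ^ n * G s (d + INR n * a)%R)%C.

Lemma Cmod_pow_le_1 (q : C) n : Cmod q <= 1 -> Cmod (q ^ n) <= 1.
Proof.
  intros Hq. rewrite Cmod_pow. rewrite <- (pow1 n). apply pow_incr.
  split; [apply Cmod_ge_0|exact Hq].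
Qed.

(** The exponent is split: -2 is spent on summing over [n], the rest is kept as decay in [d]. The
    condition R + 2 <= p makes both parts nonpositive, so the base 1 + d + n a may be lowered to 1 +
    n a in one and to 1 + d in the other. *)
Lemma progression_bound p G a R : 0 < a -> order_at_least p G -> R + 2 <= p ->
  exists A, 0 <= A /\ forall q s d n, Cmod q <= 1 -> Cmod s <= R -> 0 <= d ->
    Cmod (q ^ n * G s (d + INR n * a)%R)%C <=
      A * Rpower (1 + d) (- Re s - (p - 2)) * Rpower (1 + INR n * a) (- (2)).
Proof.
  intros Ha HG HR. destruct (HG R) as [A [HA HAG]]. exists A. split; [exact HA|].
  intros q s d n Hq Hs Hd. pose proof (pos_INR n) as Hn.
  assert (Hna : 0 <= INR n * a) by (apply Rmult_le_pos; lra).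
  rewrite Cmod_mult. pose proof (Cmod_pow_le_1 q n Hq).
  specialize (HAG s (d + INR n * a) Hs ltac:(lra)).
  apply Rle_trans with (1 * (A * Rpower (1 + (d + INR n * a)) (- Re s - p))).
  - apply Rmult_le_compat; try apply Cmod_ge_0; assumption.
  - rewrite Rmult_1_l, Rmult_assoc. apply Rmult_le_compat_l; [exact HA|].
    replace (- Re s - p) with ((- Re s - (p - 2)) + - (2)) by ring.
    rewrite Rpower_plus.
    pose proof (re_le_Cmod s) as Hre. apply Rabs_le_between in Hre.
    apply Rmult_le_compat; try (left; apply exp_pos); apply Rpower_anti; lra.
Qed.

Lemma progression_sum_cser p G a q s d : 0 < a -> order_at_least p G -> Cmod s + 2 <= p ->
  Cmod q <= 1 -> 0 <= d ->
  cser (fun n => q ^ n * G s (d + INR n * a)%R)%C (progression_sum q a G s d).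
Proof.
  intros Ha HG Hp Hq Hd.
  destruct (progression_bound p G a (Cmod s) Ha HG Hp) as [A [HA H]].
  destruct (bounded_progression 2 a ltac:(lra) Ha) as [B [HB1 HB2]].
  set (M := A * Rpower (1 + d) (- Re s - (p - 2))).
  assert (HM : 0 <= M) by (apply Rmult_le_pos; [exact HA|left; apply exp_pos]).
  destruct (cser_dominated (fun n => q ^ n * G s (d + INR n * a)%R)%C
     (fun n => M * Rpower (1 + INR n * a) (- (2))) (M * B)) as [l Hl].
  - intros n. apply H; [exact Hq|lra|exact Hd].
  - split.
    + intros n. now apply Rmult_le_pos.
    + intros n. rewrite rsum_scal. now apply Rmult_le_compat_l.
  - eapply CSum_correct, Hl.
Qed.

(** The boundary term q^N G(s, d + N a) tends to 0 through the decay of [G] alone, so |q| = 1 is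
    allowed. *)
Lemma telescoping p G a q s d : 0 < a -> order_at_least p G -> 0 < Re s + p -> Cmod q <= 1 ->
  0 <= d ->
  cser (fun n => q ^ n * (G s (d + INR n * a)%R - q * G s (d + INR n * a + a)%R))%C (G s d).
Proof.
  intros Ha HG Hp Hq Hd.
  assert (Hs : forall N, csum (fun n => q ^ n * (G s (d + INR n * a)%R - q * G s (d + INR n * a + a)%R))%C N
     = (G s d - q ^ N * G s (d + INR N * a)%R)%C).
  { induction N as [|N IH].
    - simpl. rewrite Rmult_0_l, Rplus_0_r. ring.
    - simpl csum. rewrite IH, Cpow_S.
      replace (d + INR (S N) * a) with (d + INR N * a + a) by (rewrite S_INR; ring). ring. }
  destruct (HG (Cmod s)) as [A [HA HAG]].
  intros eps He.
  destruct (Rpower_vanish a (Re s + p) Ha Hp (eps / (A + 1))) as [N HN].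
  { apply Rdiv_lt_0_compat; lra. }
  exists N. intros n Hn. specialize (HN n Hn). rewrite Hs.
  replace (G s d - q ^ n * G s (d + INR n * a)%R - G s d)%C
    with (- (q ^ n * G s (d + INR n * a)%R))%C by ring.
  rewrite Cmod_opp, Cmod_mult. pose proof (Cmod_pow_le_1 q n Hq).
  assert (Hna : 0 <= INR n * a) by (apply Rmult_le_pos; [apply pos_INR|lra]).
  specialize (HAG s (d + INR n * a) (Rle_refl _) ltac:(lra)).
  set (X := Rpower (1 + INR n * a) (- (Re s + p))) in *.
  assert (HX : 0 < X) by apply exp_pos.
  assert (Hle : Rpower (1 + (d + INR n * a)) (- Re s - p) <= X).
  { unfold X. replace (- Re s - p) with (- (Re s + p)) by ring. apply Rpower_anti; lra. }
  apply Rle_lt_trans with (1 * (A * X)).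
  - apply Rmult_le_compat; try apply Cmod_ge_0; [assumption|].
    eapply Rle_trans; [exact HAG|]. now apply Rmult_le_compat_l.
  - apply Rmult_lt_compat_l with (r := A + 1) in HN; [|lra].
    replace ((A + 1) * (eps / (A + 1))) with eps in HN by (field; lra). nra.
Qed.

(** * Solving [F(s, d) - q F(s, d + a) = s G(s + 1, d)] within tame families *)

Fixpoint Dcoef (k : nat) (s : C) : C :=
  match k with O => RtoC 1 | S k => (- s * Dcoef k (s + 1))%C end.

Lemma Dpow_Dcoef k G s d : Dpow k G s d = (Dcoef k s * G (s + INR k) d)%C.
Proof.
  revert s. induction k as [|k IH]; intros s.
  - simpl. replace (s + 0)%C with s by ring. ring.
  - rewrite Dpow_S. unfold Dop. rewrite IH, S_INR, RtoC_plus. simpl Dcoef.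
    replace (s + 1 + INR k)%C with (s + (INR k + 1))%C by ring. ring.
Qed.

(** A remainder at [s] involves the family only at translates s + j of [s]. This is used for the
    solution [F], which agrees with a fixed truncation only on a bounded set of [s]. *)
Lemma Tay_ext J y G H s d :
  (forall j d', (j <= J)%nat -> 0 <= d' -> G (s + INR j)%C d' = H (s + INR j)%C d') ->
  0 <= d -> 0 <= y -> Tay J y G s d = Tay J y H s d.
Proof.
  intros HGH Hd Hy. induction J as [|J IH].
  - simpl. specialize (HGH O (d + y) (le_n _) ltac:(lra)). simpl in HGH.
    replace (s + 0)%C with s in HGH by ring. exact HGH.
  - simpl. rewrite IH by (intros; apply HGH; lia || lra).
    rewrite !Dpow_Dcoef, HGH by (lia || lra). reflexivity.
Qed.

Section Step.

Variables (G : C -> R -> C) (q : C) (a : R).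
Hypotheses (HG : tame G) (Hq : Cmod q <= 1) (Ha : 0 < a).

(** The coefficients of 1 - q e^(aX) as a power series in X. *)
Let kappa (j : nat) : C :=
  ((if (j =? 0)%nat then 1 else 0) - q * RtoC (a ^ j / INR (fact j)))%C.

(* The coefficients of [D / (q e^(aD) - 1)], a power series even when [q = 1]. *)
Lemma step_coefs : exists beta : nat -> C, forall m,
  conv kappa beta m = (if (m =? 1)%nat then - (1) else 0)%C.
Proof.
  destruct (classic (q = RtoC 1)) as [H1|H1].
  (* For q = 1 the series 1 - q e^(aX) has no constant term, so X is cancelled from both sides
     first; the new constant term is -a. *)
  - exists (conv_solve (fun j => kappa (S j)) (fun m => (if (m =? 0)%nat then - (1) else 0)%C)).
    assert (Hk1 : kappa 1 <> RtoC 0).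
    { unfold kappa. rewrite H1. simpl. replace (a * 1 / 1) with a by field.
      replace (0 - 1 * a)%C with (RtoC (- a)) by (rewrite RtoC_opp; ring).
      intros Hz. apply RtoC_inj in Hz. lra. }
    assert (Hk0 : kappa 0 = RtoC 0).
    { unfold kappa. rewrite H1. simpl. replace (1 / 1) with 1 by field. ring. }
    intros [|m].
    + unfold conv. simpl. rewrite Hk0. ring.
    + pose proof (conv_solve_correct (fun j => kappa (S j))
        (fun m => (if (m =? 0)%nat then - (1) else 0)%C) Hk1 m) as Hm.
      unfold conv in *. rewrite csum_S_l, Hk0, Cmult_0_l, Cplus_0_l. exact Hm.
  - exists (conv_solve kappa (fun m => (if (m =? 1)%nat then - (1) else 0)%C)).
    apply conv_solve_correct. unfold kappa. simpl. replace (1 / 1) with 1 by field.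
    rewrite Cmult_1_r. apply Cminus_eq_contra. now apply not_eq_sym.
Qed.

Variable beta : nat -> C.
Hypothesis Hbeta : forall m, conv kappa beta m = (if (m =? 1)%nat then - (1) else 0)%C.

Let P (K : nat) : C -> R -> C := famsum beta (fun k => Dpow k G) K.
(** The defect of [P K] in the difference equation: [Dop G] is minus the right-hand side s G(s + 1,
    d). *)
Let rho (K : nat) : C -> R -> C :=
  lincomb 1 (lincomb 1 (P K) (- q) (translate a (P K))) 1 (Dop G).
(** What remains when each term of P(d + a) is expanded around [d] up to total order [K] in D. *)
Let E (K : nat) : C -> R -> C := famsum beta (fun k => Dpow k (Tay (K - k) a G)) K.

Lemma step_expand K s d :
  (P K s d - q * P K s (d + a)%R + q * E K s d)%C
  = csum (fun m => conv kappa beta m * Dpow m G s d)%C K.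
Proof.
  unfold P, E. rewrite !famsum_csum. induction K as [|K IH]; [simpl; ring|].
  rewrite !csum_S, <- IH, conv_comm. unfold conv. rewrite csum_S, Nat.sub_diag, Nat.sub_succ_l, Nat.sub_diag by lia.
  rewrite (csum_ext (fun k => beta k * Dpow k (Tay (S K - k) a G) s d)%C
    (fun k => beta k * Dpow k (Tay (K - k) a G) s d
              + Dpow K G s d * (beta k * (- RtoC (a ^ (K - k) / INR (fact (K - k))))))%C).
  (* Raising [K] by one takes one more Taylor term out of every remainder. All these terms are
     multiples of [Dpow K G] and form the next convolution coefficient. *)
  2:{ intros k Hk. rewrite Nat.sub_succ_l by lia.
      replace (Tay (S (K - k)) a G) with (lincomb 1 (Tay (K - k) a G)
         (- RtoC (a ^ (K - k) / INR (fact (K - k)))) (Dpow (K - k) G)).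
      - rewrite Dpow_lincomb, Dpow_add. unfold lincomb.
        replace (k + (K - k))%nat with K by lia. ring.
      - apply functional_extensionality; intros s'. apply functional_extensionality; intros d'.
        unfold lincomb. simpl. ring. }
  rewrite csum_plus, csum_scal.
  rewrite (csum_ext (fun i => beta i * kappa (K - i)%nat)%C
    (fun i => q * (beta i * (- RtoC (a ^ (K - i) / INR (fact (K - i))))))%C).
  2:{ intros i Hi. unfold kappa. destruct (Nat.eqb_spec (K - i) 0); [lia|]. ring. }
  rewrite csum_scal.
  replace (Dpow K (Tay 1 a G) s d) with (Dpow K G s (d + a)%R - Dpow K G s d)%C.
  - unfold kappa. simpl (0 =? 0)%nat. cbv iota. simpl (a ^ 0). simpl fact.
    replace (1 / INR 1) with 1 by (simpl; field). ring.
  - replace (Tay 1 a G) with (lincomb 1 (translate a G) (- (1)) G).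
    + rewrite Dpow_lincomb. unfold lincomb, translate. rewrite Dpow_shift. ring.
    + apply functional_extensionality; intros s'. apply functional_extensionality; intros d'.
      unfold lincomb, translate. simpl. replace (1 / 1) with 1 by field. ring.
Qed.

(** By the choice of [beta] only m = 1 survives in [step_expand] (hence 2 <= K), and it cancels
    [Dop G]. So the defect is -q times [E K], where D^k and a remainder of order K - k together give
    order [K]. *)
Lemma step_rho_order K : (2 <= K)%nat -> order_at_least (INR K) (rho K).
Proof.
  intros HK.
  replace (rho K) with (lincomb (- q) (E K) 0 (E K)).
  - apply order_lincomb; apply order_famsum; intros k Hk;
      (replace (INR K) with (INR (K - k) + INR k) by (rewrite <- plus_INR; f_equal; lia));
      apply order_Dpow; apply HG; lra.
  - apply functional_extensionality; intros s. apply functional_extensionality; intros d.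
    pose proof (step_expand K s d) as H.
    rewrite (csum_single _ K 1) in H; [|lia|].
    2:{ intros j _ Hj. rewrite Hbeta. destruct (Nat.eqb_spec j 1); [lia|ring]. }
    rewrite Hbeta in H. simpl in H.
    assert (H' : (P K s d - q * P K s (d + a)%R)%C = (- (1) * Dop G s d - q * E K s d)%C)
      by (rewrite <- H; ring).
    unfold rho, lincomb, translate.
    replace (1 * (1 * P K s d + - q * P K s (d + a)%R) + 1 * Dop G s d)%C
      with ((P K s d - q * P K s (d + a)%R) + Dop G s d)%C by ring.
    rewrite H'. ring.
Qed.

Lemma step_P_tame K : tame (P K).
Proof. apply tame_famsum. intros k _. now apply tame_Dpow. Qed.

Lemma step_rho_tame K : tame (rho K).
Proof.
  apply tame_lincomb; [apply tame_lincomb; [apply step_P_tame|]|now apply tame_Dop].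
  apply tame_translate; [lra|apply step_P_tame].
Qed.

Let approx (K : nat) : C -> R -> C :=
  fun s d => (P K s d - progression_sum q a (rho K) s d)%C.
(** Some truncation order that is large enough for [s]. It makes [F] total, and [step_approx_eq]
    later replaces it by one order common to a whole disc. *)
Let level (s : C) : nat := (Z.to_nat (up (Cmod s)) + 3)%nat.
Let F : C -> R -> C := fun s d => approx (level s) s d.

Lemma step_level s : Cmod s + 3 <= INR (level s).
Proof.
  unfold level. rewrite plus_INR. pose proof (archimed (Cmod s)) as [H _].
  pose proof (Cmod_ge_0 s).
  assert (Hz : (0 <= up (Cmod s))%Z) by (apply le_IZR; simpl; lra).
  rewrite INR_IZR_INZ, Z2Nat.id by exact Hz. simpl. lra.
Qed.

Lemma step_rho_cser K s d : Cmod s + 2 <= INR K -> 0 <= d ->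
  cser (fun n => q ^ n * rho K s (d + INR n * a)%R)%C (progression_sum q a (rho K) s d).
Proof.
  intros HK Hd. apply progression_sum_cser with (p := INR K); try assumption.
  apply step_rho_order. apply INR_le. simpl. pose proof (Cmod_ge_0 s). lra.
Qed.

(** The added term beta_K D^K G changes the defect by its own q-difference, whose sum along the
    progression telescopes back to that term. The two changes cancel. *)
Lemma step_approx_S K s d : Cmod s + 2 <= INR K -> 0 <= d -> approx (S K) s d = approx K s d.
Proof.
  intros HK Hd. unfold approx.
  assert (HK1 : Cmod s + 2 <= INR (S K)) by (rewrite S_INR; lra).
  pose proof (cser_minus _ _ _ _ (step_rho_cser (S K) s d HK1 Hd) (step_rho_cser K s d HK Hd)) as H.
  set (H1 := lincomb (beta K) (Dpow K G) 0 (Dpow K G)).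
  assert (Hord : order_at_least (INR K) H1).
  { pose proof (order_Dpow 0 K G (tame_order G HG)) as Ho. rewrite Rplus_0_l in Ho.
    now apply order_lincomb. }
  assert (Hpos : 0 < Re s + INR K).
  { pose proof (re_le_Cmod s) as Hre. apply Rabs_le_between in Hre. lra. }
  pose proof (telescoping (INR K) H1 a q s d Ha Hord Hpos Hq Hd) as Ht.
  assert (Heq : (progression_sum q a (rho (S K)) s d - progression_sum q a (rho K) s d)%C = H1 s d).
  { eapply cser_unique; [exact H|]. eapply cser_ext; [|exact Ht]. intros n. cbv beta.
    unfold H1, rho, P, translate. simpl famsum. unfold lincomb. ring. }
  replace (progression_sum q a (rho (S K)) s d) with
    (progression_sum q a (rho K) s d + H1 s d)%C by (rewrite <- Heq; ring).
  unfold P, H1. simpl famsum. unfold lincomb. ring.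
Qed.

Lemma step_approx_eq K s d : Cmod s + 2 <= INR K -> 0 <= d -> F s d = approx K s d.
Proof.
  intros HK Hd. pose proof (step_level s) as Hl.
  assert (Hmono : forall K0, Cmod s + 2 <= INR K0 -> forall i, approx (K0 + i) s d = approx K0 s d).
  { intros K0 HK0 i. induction i as [|i IH]; [now rewrite Nat.add_0_r|].
    rewrite Nat.add_succ_r, step_approx_S; [exact IH| |exact Hd].
    rewrite plus_INR. pose proof (pos_INR i). lra. }
  unfold F. destruct (Nat.le_ge_cases (level s) K) as [H|H].
  - replace K with (level s + (K - level s))%nat by lia. symmetry. apply Hmono. lra.
  - replace (level s) with (K + (level s - K))%nat by lia. now apply Hmono.
Qed.

(** Dropping the first term of the progression sum shows that its own q-difference is the defect
    [rho K], which is what [P K] misses. *)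
Lemma step_equation s d : 0 <= d -> (F s d - q * F s (d + a)%R)%C = (s * G (s + 1) d)%C.
Proof.
  intros Hd. set (K := level s). pose proof (step_level s) as Hl. fold K in Hl.
  rewrite !(step_approx_eq K) by lra. unfold approx.
  pose proof (step_rho_cser K s d ltac:(lra) Hd) as H1.
  pose proof (step_rho_cser K s (d + a) ltac:(lra) ltac:(lra)) as H2.
  apply cser_shift in H1. apply (cser_scal q) in H2.
  assert (Heq : (progression_sum q a (rho K) s d - rho K s d)%C
     = (q * progression_sum q a (rho K) s (d + a)%R)%C).
  { replace (rho K s d) with (q ^ 0 * rho K s (d + INR 0 * a)%R)%C
      by (simpl; rewrite Rmult_0_l, Rplus_0_r; ring).
    eapply cser_unique; [exact H1|]. eapply cser_ext; [|exact H2]. intros n.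
    rewrite Cpow_S. replace (d + a + INR n * a) with (d + INR (S n) * a) by (rewrite S_INR; ring).
    ring. }
  replace (P K s d - progression_sum q a (rho K) s d -
     q * (P K s (d + a)%R - progression_sum q a (rho K) s (d + a)%R))%C
    with (P K s d - q * P K s (d + a)%R - progression_sum q a (rho K) s d +
     q * progression_sum q a (rho K) s (d + a)%R)%C by ring.
  rewrite <- Heq. unfold rho at 3. unfold lincomb, translate, Dop. ring.
Qed.

(** One order [K] serves the whole disc. There the progression sum has a majorant of the form (1 + n
    a)^(-2), as [weierstrass] requires. *)
Lemma step_entire : entire_family F.
Proof.
  intros d Hd z R.
  destruct (INR_archimed 1 (Cmod z + Rabs R + 2) ltac:(lra)) as [K HK]. rewrite Rmult_1_r in HK.
  assert (Hz : forall w, Cmod w <= Rabs R -> Cmod (z + w) + 2 <= INR K).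
  { intros w Hw. pose proof (Cmod_triangle z w). lra. }
  destruct (step_P_tame K) as [HPe _]. destruct (HPe d Hd z R) as [cP HcP].
  destruct (step_rho_tame K) as [Hre _].
  assert (HKd : forall n, 0 <= d + INR n * a).
  { intros n. pose proof (Rmult_le_pos (INR n) a (pos_INR n) ltac:(lra)). lra. }
  assert (Hc : exists c : nat -> nat -> C, forall n,
     has_ps (c n) R (fun w => q ^ n * rho K (z + w) (d + INR n * a)%R)%C).
  { apply (choice (fun n c => has_ps c R (fun w => q ^ n * rho K (z + w) (d + INR n * a)%R)%C)).
    intros n. destruct (Hre _ (HKd n) z R) as [c Hc]. eexists. apply has_ps_scal, Hc. }
  destruct Hc as [c Hc].
  assert (HW : has_ps (fun k => CSum (fun n => c n k)) R
    (fun w => progression_sum q a (rho K) (z + w) d)).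
  { apply weierstrass with (1 := Hc).
    - intros r Hr.
      assert (HK2 : (2 <= K)%nat).
      { apply INR_le. simpl. pose proof (Cmod_ge_0 z). pose proof (Rabs_pos R). lra. }
      destruct (progression_bound (INR K) (rho K) a (Cmod z + Rabs R) Ha
        (step_rho_order K HK2) ltac:(lra)) as [A [HA HAb]].
      destruct (bounded_progression 2 a ltac:(lra) Ha) as [B [HB1 HB2]].
      set (X := Rpower (1 + d) (Cmod z + Rabs R)).
      assert (HX : 0 < X) by apply exp_pos.
      assert (HAX : 0 <= A * X) by (apply Rmult_le_pos; lra).
      exists (fun n => A * X * Rpower (1 + INR n * a) (- (2))), (A * X * B). split.
      + split; [intros n; now apply Rmult_le_pos|].
        intros n. rewrite rsum_scal. now apply Rmult_le_compat_l.
      + intros n w Hw. pose proof (Rle_abs R). pose proof (Cmod_triangle z w) as Ht.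
        eapply Rle_trans; [apply HAb; [exact Hq|lra|exact Hd]|].
        apply Rmult_le_compat_r; [left; apply exp_pos|]. apply Rmult_le_compat_l; [exact HA|].
        apply Rpower_le; [lra|].
        pose proof (re_le_Cmod (z + w)) as Hrr. apply Rabs_le_between in Hrr.
        apply le_INR in HK2. simpl in HK2. lra.
    - intros w Hw. apply step_rho_cser; [|exact Hd]. apply Hz. pose proof (Rle_abs R). lra. }
  eexists. eapply has_ps_ext; [|exact (has_ps_plus _ _ _ _ _ HcP (has_ps_scal (- (1)) _ _ _ HW))].
  intros w Hw. cbv beta. rewrite (step_approx_eq K); [unfold approx; ring| |exact Hd].
  apply Hz. pose proof (Rle_abs R). lra.
Qed.

(** Remainders may be taken term by term. The extra [J] in the condition on [K] is there because D^j
    evaluates at s + j. *)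
Lemma step_Tay_cser K J y s d : Cmod s + INR J + 2 <= INR K -> 0 <= d -> 0 <= y ->
  cser (fun n => q ^ n * Tay J y (rho K) s (d + INR n * a)%R)%C
    (Tay J y (progression_sum q a (rho K)) s d).
Proof.
  intros HK Hd Hy. induction J as [|J IH].
  - simpl in *. eapply cser_ext; [|apply (step_rho_cser K s (d + y)); lra].
    intros n. cbv beta. do 2 f_equal. ring.
  - rewrite S_INR in HK. simpl Tay.
    eapply cser_ext; [|apply cser_minus; [apply IH; lra|]].
    2:{ apply cser_scal. rewrite Dpow_Dcoef. apply cser_scal.
        apply (step_rho_cser K (s + INR J) d); [|exact Hd].
        pose proof (Cmod_triangle s (INR J)) as Ht.
        rewrite (Cmod_pos_real (INR J)) in Ht by apply pos_INR. lra. }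
    intros n. cbv beta. rewrite Dpow_Dcoef. ring.
Qed.

Lemma step_Tay_F K J y s d : Cmod s + INR J + 2 <= INR K -> 0 <= d -> 0 <= y ->
  Tay J y F s d = (Tay J y (P K) s d - Tay J y (progression_sum q a (rho K)) s d)%C.
Proof.
  intros HK Hd Hy.
  rewrite (Tay_ext J y F (lincomb 1 (P K) (- (1)) (progression_sum q a (rho K)))).
  - rewrite Tay_lincomb. unfold lincomb. ring.
  - intros j d' Hj Hd'. rewrite (step_approx_eq K).
    + unfold approx, lincomb. ring.
    + apply le_INR in Hj. pose proof (Cmod_triangle s (INR j)) as Ht.
      rewrite (Cmod_pos_real (INR j)) in Ht by apply pos_INR. lra.
    + exact Hd'.
  - exact Hd.
  - exact Hy.
Qed.

Lemma step_tame : tame F.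
Proof.
  split; [apply step_entire|]. intros J y Hy. split.
  - intros R.
    destruct (INR_archimed 1 (Rabs R + INR J + 2) ltac:(lra)) as [K HK]. rewrite Rmult_1_r in HK.
    assert (HK2 : (2 <= K)%nat).
    { apply INR_le. simpl. pose proof (pos_INR J). pose proof (Rabs_pos R). lra. }
    pose proof (le_INR _ _ HK2) as HK2'. simpl in HK2'.
    destruct (step_P_tame K) as [_ HP]. destruct (HP J y Hy) as [HPo _].
    destruct (HPo R) as [A1 [HA1 H1]].
    (* The remainders of the defect have order J + K; summation over the progression spends 2 of it,
       which leaves at least [J]. *)
    pose proof (order_Tay (INR K) (rho K) (step_rho_order K HK2) (step_rho_tame K) K J y Hy
      (Rle_refl _)) as Ho.
    pose proof (pos_INR J) as HJ. pose proof (Rle_abs R) as HRabs.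
    destruct (progression_bound _ _ a R Ha Ho ltac:(lra)) as [A2 [HA2 H2]].
    destruct (bounded_progression 2 a ltac:(lra) Ha) as [B [HB1 HB2]].
    assert (HB0 : 0 <= B) by apply (HB2 O).
    exists (A1 + A2 * B). split; [apply Rplus_le_le_0_compat; [exact HA1|now apply Rmult_le_pos]|].
    intros s d Hs Hd. rewrite (step_Tay_F K) by (lra || assumption).
    eapply Rle_trans; [apply Cmod_triangle|]. rewrite Cmod_opp, Rmult_plus_distr_r.
    apply Rplus_le_compat; [now apply H1|].
    apply Rle_trans with (A2 * Rpower (1 + d) (- Re s - (INR J + INR K - 2)) * B).
    + apply cser_le with (1 := step_Tay_cser K J y s d ltac:(lra) Hd Hy)
        (M := fun n => A2 * Rpower (1 + d) (- Re s - (INR J + INR K - 2)) *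
                       Rpower (1 + INR n * a) (- (2))).
      * intros n. now apply H2.
      * intros n. rewrite rsum_scal. apply Rmult_le_compat_l; [|apply HB2].
        apply Rmult_le_pos; [exact HA2|left; apply exp_pos].
    + rewrite Rmult_assoc, (Rmult_comm _ B), <- Rmult_assoc.
      apply Rmult_le_compat_l; [now apply Rmult_le_pos|]. apply Rpower_le; lra.
  - intros N d HN Hd.
    set (s := (- RtoC (INR N))%C).
    destruct (INR_archimed 1 (Cmod s + INR J + 2) ltac:(lra)) as [K HK]. rewrite Rmult_1_r in HK.
    rewrite (step_Tay_F K) by (lra || assumption).
    destruct (step_P_tame K) as [_ HP]. destruct (HP J y Hy) as [_ HPv].
    destruct (step_rho_tame K) as [_ Hr]. destruct (Hr J y Hy) as [_ Hrv].
    assert (Hz : Tay J y (progression_sum q a (rho K)) s d = RtoC 0).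
    { eapply cser_unique; [apply (step_Tay_cser K J y s d ltac:(lra) Hd Hy)|].
      eapply cser_ext; [|apply cser_zero]. intros n. cbv beta. unfold s. rewrite Hrv; [ring|exact HN|].
      pose proof (Rmult_le_pos (INR n) a (pos_INR n) ltac:(lra)). lra. }
    rewrite Hz. unfold s. rewrite HPv by assumption. ring.
Qed.

End Step.

Lemma tame_solution G q a : tame G -> Cmod q <= 1 -> 0 < a ->
  exists F, tame F /\ forall s d, 0 <= d -> (F s d - q * F s (d + a)%R)%C = (s * G (s + 1) d)%C.
Proof.
  intros HG Hq Ha. destruct (step_coefs q a Ha) as [beta Hbeta].
  eexists. split.
  - exact (step_tame G q a HG Hq Ha beta Hbeta).
  - exact (step_equation G q a HG Hq Ha beta Hbeta).
Qed.

(** * Multiple series *)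

Definition Rlsum (l : list R) : R := fold_right Rplus 0 l.

Lemma Csum_Cmod_le {T} (f : T -> C) l : Cmod (Csum (map f l)) <= Rlsum (map (fun n => Cmod (f n)) l).
Proof.
  induction l as [|n l IH]; simpl; [rewrite Cmod_0; lra|].
  eapply Rle_trans; [apply Cmod_triangle|]. unfold Csum, Rlsum in *. lra.
Qed.

Lemma Rlsum_le {T} (f g : T -> R) l : (forall n, In n l -> f n <= g n) ->
  Rlsum (map f l) <= Rlsum (map g l).
Proof.
  induction l as [|n l IH]; intros H; simpl; [lra|].
  assert (f n <= g n) by (apply H; now left).
  assert (Rlsum (map f l) <= Rlsum (map g l)) by (apply IH; intros; apply H; now right).
  unfold Rlsum in *. lra.
Qed.

Lemma Rlsum_scal {T} c (f : T -> R) l : Rlsum (map (fun n => c * f n) l) = c * Rlsum (map f l).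
Proof. induction l as [|n l IH]; simpl; [|unfold Rlsum in *; rewrite IH]; ring. Qed.

Lemma Csum_scal {T} c (f : T -> C) l : Csum (map (fun n => c * f n)%C l) = (c * Csum (map f l))%C.
Proof. induction l as [|n l IH]; simpl; [|unfold Csum in *; rewrite IH]; ring. Qed.

(** Fixing the first index reduces a sum over (r+1)-tuples to an iterated sum, which is how all
    inductions on [r] for multiple series proceed. *)
Definition slice (k : nat) (F : list (list nat)) : list (list nat) :=
  map (@tl nat) (filter (fun n => hd O n =? k)%nat F).

Lemma in_slice k r F n : multi_indices (S r) F -> In n (slice k F) <-> In (k :: n) F.
Proof.
  intros [_ HF]. unfold slice. rewrite in_map_iff. split.
  - intros [m [Hm Hin]]. apply filter_In in Hin. destruct Hin as [Hin Hk].
    specialize (HF _ Hin). destruct m as [|i m]; [discriminate|].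
    simpl in *. apply Nat.eqb_eq in Hk. now subst.
  - intros H. exists (k :: n). split; [reflexivity|]. apply filter_In. split; [exact H|].
    simpl. apply Nat.eqb_refl.
Qed.

Lemma multi_indices_tail r n F : multi_indices r (n :: F) -> multi_indices r F.
Proof.
  intros [H1 H2]. split; [now inversion H1|]. intros m Hm. apply H2. now right.
Qed.

Lemma multi_indices_slice k r F : multi_indices (S r) F -> multi_indices r (slice k F).
Proof.
  intros HF. split.
  - induction F as [|n F IH]; [constructor|].
    pose proof (multi_indices_tail _ _ _ HF) as HF'. specialize (IH HF').
    destruct HF as [HN HL]. inversion HN as [|? ? Hn HN']; subst.
    specialize (HL n (or_introl eq_refl)). destruct n as [|i n]; [discriminate|].
    unfold slice. simpl. destruct (Nat.eqb_spec i k) as [->|_]; [|exact IH].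
    simpl. constructor; [|exact IH]. intros Hin. apply Hn.
    now apply (in_slice k r F n HF').
  - intros n Hn. apply (in_slice k r F n HF) in Hn. apply HF in Hn. simpl in Hn. lia.
Qed.

Lemma heads_bounded (F : list (list nat)) : exists M, forall n, In n F -> (hd O n < M)%nat.
Proof.
  induction F as [|n F [M HM]]; [now exists O|].
  exists (S (hd O n) + M)%nat. intros m [<-|Hm]; [lia|]. specialize (HM m Hm). lia.
Qed.

Lemma Csum_slices r (f : list nat -> C) F M : multi_indices (S r) F ->
  (forall n, In n F -> (hd O n < M)%nat) ->
  Csum (map f F) = csum (fun k => Csum (map (fun n => f (k :: n)) (slice k F))) M.
Proof.
  intros HF HM. induction F as [|n F IH].
  - symmetry. now apply csum_zero.
  - pose proof (multi_indices_tail _ _ _ HF) as HF'.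
    destruct HF as [_ HL]. specialize (HL n (or_introl eq_refl)).
    destruct n as [|i n]; [discriminate|].
    pose proof (HM (i :: n) (or_introl eq_refl)) as Hi. simpl in Hi.
    rewrite (csum_ext _ (fun k => (if (i =? k)%nat then f (i :: n) else RtoC 0) +
      Csum (map (fun n => f (k :: n)) (slice k F)))%C).
    + rewrite csum_plus, <- IH; [|exact HF'|intros m Hm; apply HM; now right].
      rewrite (csum_single _ M i Hi).
      * now rewrite Nat.eqb_refl.
      * intros j _ Hj. destruct (Nat.eqb_spec i j); [now subst|reflexivity].
    + intros k _. unfold slice. simpl. destruct (Nat.eqb_spec i k) as [->|_]; simpl.
      * reflexivity.
      * ring.
Qed.

Lemma Rlsum_slices r (f : list nat -> R) F M : multi_indices (S r) F ->
  (forall n, In n F -> (hd O n < M)%nat) ->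
  Rlsum (map f F) = rsum (fun k => Rlsum (map (fun n => f (k :: n)) (slice k F))) M.
Proof.
  intros HF HM.
  assert (HR : forall {T} (g : T -> R) l, Csum (map (fun n => RtoC (g n)) l) = RtoC (Rlsum (map g l))).
  { intros T g l. induction l as [|t l IH]; [reflexivity|].
    simpl. rewrite RtoC_plus. unfold Csum, Rlsum in *. now rewrite IH. }
  assert (Hr : forall (g : nat -> R) n, csum (fun k => RtoC (g k)) n = RtoC (rsum g n)).
  { intros g n. induction n as [|n IH]; [reflexivity|]. simpl. now rewrite IH, RtoC_plus. }
  apply RtoC_inj. rewrite <- HR, (Csum_slices r _ F M HF HM), <- Hr.
  apply csum_ext. intros k _. apply HR.
Qed.

Lemma multi_sum_bound_cons r (f : list nat -> R) (B : nat -> R) Bt :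
  (forall k F, multi_indices r F -> Rlsum (map (fun n => f (k :: n)) F) <= B k) ->
  (forall n, rsum B n <= Bt) ->
  forall F, multi_indices (S r) F -> Rlsum (map f F) <= Bt.
Proof.
  intros HB HBt F HF. destruct (heads_bounded F) as [M HM].
  rewrite (Rlsum_slices r f F M HF HM). eapply Rle_trans; [|apply (HBt M)].
  apply rsum_le. intros k _. apply HB. now apply multi_indices_slice.
Qed.

(** A Fubini theorem. A finite set containing good sets for the first [N] slices has those slice
    sums close to s_k; the majorant [B] makes all other slices negligible, whatever the set. *)
Lemma is_multi_series_cons r f (s : nat -> C) S0 (B : nat -> R) Bt :
  bounded_by B Bt ->
  (forall k F, multi_indices r F -> Rlsum (map (fun n => Cmod (f (k :: n))) F) <= B k) ->
  (forall k, is_multi_series r (fun n => f (k :: n)) (s k)) ->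
  cser s S0 -> is_multi_series (S r) f S0.
Proof.
  intros HB Hf Hs HS eps He.
  destruct (bounded_by_tail B Bt HB (eps / 4)) as [N1 HN1]; [lra|].
  destruct (HS (eps / 4)) as [N2 HN2]; [lra|].
  set (N := (N1 + N2)%nat).
  assert (HNp : 0 < 4 * (INR N + 1)) by (pose proof (pos_INR N); lra).
  (* The [N] slice errors then add up to at most eps / 4. *)
  set (e := eps / (4 * (INR N + 1))).
  assert (He' : 0 < e) by now apply Rdiv_lt_0_compat.
  destruct (choice (fun k F0 => multi_indices r F0 /\ forall F, multi_indices r F -> incl F0 F ->
     Cmod (Csum (map (fun n => f (k :: n)) F) - s k) < e) (fun k => Hs k e He')) as [F0 HF0].
  set (U := nodup (list_eq_dec Nat.eq_dec) (flat_map (fun k => map (cons k) (F0 k)) (seq 0 N))).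
  exists U. split.
  { split; [apply NoDup_nodup|]. intros n Hn. apply nodup_In, in_flat_map in Hn.
    destruct Hn as [k [_ Hn]]. apply in_map_iff in Hn. destruct Hn as [m [<- Hm]].
    simpl. f_equal. now apply (HF0 k). }
  intros F HF Hincl. destruct (heads_bounded F) as [M0 HM0]. set (M := (N + M0)%nat).
  assert (HM : forall n, In n F -> (hd O n < M)%nat)
    by (intros n Hn; specialize (HM0 n Hn); unfold M; lia).
  rewrite (Csum_slices r f F M HF HM).
  set (T := fun k => Csum (map (fun n => f (k :: n)) (slice k F))).
  assert (HT : forall k, Cmod (T k) <= B k).
  { intros k. eapply Rle_trans; [apply Csum_Cmod_le|]. apply Hf. now apply multi_indices_slice. }
  assert (H1 : Cmod (csum T N - csum s N) <= eps / 4).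
  { replace (csum T N - csum s N)%C with (csum (fun k => T k + (- (1)) * s k)%C N)
      by (rewrite csum_plus, csum_scal; ring).
    apply Rle_trans with (rsum (fun _ => e) N).
    - apply csum_Cmod_le. intros k Hk. replace (T k + - (1) * s k)%C with (T k - s k)%C by ring.
      left. apply HF0; [now apply multi_indices_slice|].
      intros n Hn. apply (in_slice k r F n HF). apply Hincl, nodup_In, in_flat_map.
      exists k. split; [apply in_seq; lia|now apply in_map].
    - rewrite rsum_const. unfold e.
      replace (INR N * (eps / (4 * (INR N + 1)))) with (eps / 4 - eps / (4 * (INR N + 1)))
        by (field; lra).
      fold e. lra. }
  assert (H2 : Cmod (csum s N - S0) < eps / 4) by (apply HN2; unfold N; lia).
  assert (H3 : Cmod (csum T M - csum T N) <= eps / 4).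
  { eapply Rle_trans; [apply (csum_diff_le T B N M HT); unfold M; lia|].
    pose proof (HN1 M ltac:(unfold M, N; lia)).
    pose proof (rsum_mono B N1 N (proj1 HB) ltac:(unfold N; lia)). lra. }
  pose proof (Cmod_sub_triangle (csum T M) (csum T N) S0).
  pose proof (Cmod_sub_triangle (csum T N) (csum s N) S0). lra.
Qed.

Lemma is_multi_series_nil f : is_multi_series 0 f (f []).
Proof.
  intros eps He. exists [[]]. split.
  - split; [repeat constructor; easy|]. intros n [<-|[]]; reflexivity.
  - intros F [HN HL] Hi. assert (HF : F = [[]]).
    { assert (Hin : In [] F) by (apply Hi; now left).
      destruct F as [|n F]; [easy|].
      assert (n = []) by (apply length_zero_iff_nil, HL; now left). subst n.
      destruct F as [|m F]; [reflexivity|]. exfalso.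
      assert (m = []) by (apply length_zero_iff_nil, HL; right; now left). subst m.
      inversion HN as [|? ? Hn _]. apply Hn. now left. }
    rewrite HF. simpl. replace (f [] + 0 - f [])%C with (RtoC 0) by ring. now rewrite Cmod_0.
Qed.

Lemma is_multi_series_ext r f g S0 : (forall n, length n = r -> f n = g n) ->
  is_multi_series r f S0 -> is_multi_series r g S0.
Proof.
  intros H Hf eps He. destruct (Hf eps He) as [F0 [HF0 HF]]. exists F0. split; [exact HF0|].
  intros F HFm Hi. rewrite (map_ext_in g f); [now apply HF|].
  intros n Hn. symmetry. apply H. now apply HFm.
Qed.

Lemma is_multi_series_scal r c f S0 :
  is_multi_series r f S0 -> is_multi_series r (fun n => c * f n)%C (c * S0)%C.
Proof.
  intros Hf eps He. assert (Hc : 0 < Cmod c + 1) by (pose proof (Cmod_ge_0 c); lra).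
  destruct (Hf (eps / (Cmod c + 1))) as [F0 [HF0 HF]]; [now apply Rdiv_lt_0_compat|].
  exists F0. split; [exact HF0|]. intros F HFm Hi. specialize (HF F HFm Hi).
  rewrite Csum_scal. replace (c * Csum (map f F) - c * S0)%C with (c * (Csum (map f F) - S0))%C by ring.
  rewrite Cmod_mult. apply Rle_lt_trans with ((Cmod c) * (eps / (Cmod c + 1))).
  - apply Rmult_le_compat_l; [apply Cmod_ge_0|lra].
  - replace (Cmod c * (eps / (Cmod c + 1))) with (eps - eps / (Cmod c + 1)) by (field; lra).
    assert (0 < eps / (Cmod c + 1)) by now apply Rdiv_lt_0_compat. lra.
Qed.

Lemma is_multi_series_unique r f S1 S2 :
  is_multi_series r f S1 -> is_multi_series r f S2 -> S1 = S2.
Proof.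
  intros H1 H2. apply Ceq_minus, Cmod_le_eq. intros eps He.
  destruct (H1 (eps / 2)) as [F1 [[_ HL1] HF1]]; [lra|].
  destruct (H2 (eps / 2)) as [F2 [[_ HL2] HF2]]; [lra|].
  set (F := nodup (list_eq_dec Nat.eq_dec) (F1 ++ F2)).
  assert (HF : multi_indices r F).
  { split; [apply NoDup_nodup|]. intros n Hn. apply nodup_In, in_app_iff in Hn.
    destruct Hn; [now apply HL1|now apply HL2]. }
  specialize (HF1 F HF ltac:(intros n Hn; apply nodup_In, in_app_iff; now left)).
  specialize (HF2 F HF ltac:(intros n Hn; apply nodup_In, in_app_iff; now right)).
  pose proof (Cmod_sub_triangle S1 (Csum (map f F)) S2) as Ht.
  rewrite (Cmod_sub_sym S1 (Csum _)) in Ht. lra.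
Qed.

Lemma dot_nonneg n a : (forall b, In b a -> 0 < b) -> 0 <= dot n a.
Proof.
  revert a. induction n as [|k n IH]; intros [|b a] Ha; simpl; try lra.
  assert (0 < b) by (apply Ha; now left).
  assert (0 <= dot n a) by (apply IH; intros; apply Ha; now right).
  pose proof (Rmult_le_pos (INR k) b (pos_INR k) ltac:(lra)). lra.
Qed.

(** The exponent is shared out: [al] > 1 goes to the first index and p - al, still above the number
    of remaining indices, to the others. The excess of [p] over the length of [a] is halved for
    this. *)
Lemma multi_sum_power_bound a : (forall b, In b a -> 0 < b) ->
  forall p, INR (length a) < p -> exists B, forall F, multi_indices (length a) F ->
    Rlsum (map (fun n => Rpower (1 + dot n a) (- p)) F) <= B.
Proof.
  induction a as [|b a IH]; intros Ha p Hp.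
  - exists 1. intros F [HN HL]. destruct F as [|n F]; simpl; [lra|].
    destruct F as [|m F].
    + simpl. rewrite (proj1 (length_zero_iff_nil n)) by (apply HL; now left). simpl.
      unfold Rpower. rewrite !Rplus_0_r, ln_1, Rmult_0_r, exp_0. lra.
    + exfalso. assert (n = []) by (apply length_zero_iff_nil, HL; now left).
      assert (m = []) by (apply length_zero_iff_nil, HL; right; now left). subst.
      inversion HN as [|? ? Hn _]. apply Hn. now left.
  - simpl length in *. rewrite S_INR in Hp. set (r := length a) in *.
    assert (Hb : 0 < b) by (apply Ha; now left).
    assert (Ha' : forall c, In c a -> 0 < c) by (intros; apply Ha; now right).
    set (al := 1 + (p - INR r - 1) / 2).
    destruct (IH Ha' (p - al)) as [B HB]; [unfold al; lra|].
    destruct (bounded_progression al b) as [Bt [_ HBt]]; [unfold al; lra|exact Hb|].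
    assert (HB0 : 0 <= B).
    { specialize (HB []). apply HB. split; [constructor|easy]. }
    exists (B * Bt).
    apply multi_sum_bound_cons with (B := fun k => B * Rpower (1 + INR k * b) (- al)).
    + intros k F HF.
      apply Rle_trans with (Rlsum (map (fun n => Rpower (1 + INR k * b) (- al) *
         Rpower (1 + dot n a) (- (p - al))) F)).
      * apply Rlsum_le. intros n _. simpl dot.
        pose proof (dot_nonneg n a Ha').
        pose proof (Rmult_le_pos (INR k) b (pos_INR k) ltac:(lra)).
        pose proof (pos_INR r).
        replace (- p) with (- al + - (p - al)) by ring. rewrite Rpower_plus.
        apply Rmult_le_compat; try (left; apply exp_pos); apply Rpower_anti; unfold al; lra.
      * rewrite Rlsum_scal, Rmult_comm. apply Rmult_le_compat_r; [left; apply exp_pos|].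
        now apply HB.
    + intros n. rewrite rsum_scal. now apply Rmult_le_compat_l.
Qed.

(** * The family [G(s, d) = s (s + 1) ... (s + r - 1) l_r(s + r, x + d)] *)

Section Family.

Variables (logu x : C).
Hypotheses (Hu : 1 <= Cmod (Cexp logu)) (Hx : 0 < Re x).

Lemma Cmod_upow_le_1 b : 0 <= b -> Cmod (upow logu (- RtoC b)) <= 1.
Proof.
  intros Hb. unfold upow. rewrite Cmod_Cexp. rewrite Cmod_Cexp, <- exp_0 in Hu.
  assert (Hl : 0 <= Re logu).
  { apply Rnot_lt_le. intros H. apply exp_increasing in H. lra. }
  replace (Re (- RtoC b * logu)) with (- (b * Re logu)) by (unfold Re; simpl; ring).
  rewrite <- exp_0. pose proof (Rmult_le_pos b (Re logu) Hb Hl) as Hp.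
  destruct Hp as [Hp|Hp]; [left; apply exp_increasing; lra|rewrite <- Hp, Ropp_0; lra].
Qed.

(** A relation, because each step only provides the existence of a solution. Tameness at every level
    supplies the decay by which the difference equation determines the series. *)
Fixpoint l_family (a : list R) (G : C -> R -> C) : Prop :=
  match a with
  | [] => G = base_family x
  | b :: a => tame G /\ exists G', l_family a G' /\
      forall s d, 0 <= d -> (G s d - upow logu (- RtoC b) * G s (d + b)%R)%C = (s * G' (s + 1) d)%C
  end.

Lemma l_family_tame a G : l_family a G -> tame G.
Proof. destruct a as [|b a]; simpl; [intros ->; now apply tame_base|now intros []]. Qed.

Lemma l_family_exists a : (forall b, In b a -> 0 < b) -> exists G, l_family a G.
Proof.
  induction a as [|b a IH]; intros Ha; [now exists (base_family x)|].
  destruct IH as [G' HG']; [intros; apply Ha; now right|].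
  assert (Hb : 0 < b) by (apply Ha; now left).
  destruct (tame_solution G' (upow logu (- RtoC b)) b (l_family_tame a G' HG')
    (Cmod_upow_le_1 b ltac:(lra)) Hb) as [G [HG HE]].
  exists G. split; [exact HG|]. now exists G'.
Qed.

Fixpoint rising (r : nat) (s : C) : C :=
  match r with O => RtoC 1 | S r => (s * rising r (s + 1))%C end.

Definition multi_term (a : list R) (s : C) (d : R) (n : list nat) : C :=
  (upow logu (- RtoC (dot n a)) * base_family x s (d + dot n a))%C.

Lemma upow_plus v w : upow logu (v + w) = (upow logu v * upow logu w)%C.
Proof. unfold upow. rewrite <- Cexp_plus. f_equal. ring. Qed.

Lemma upow_INR k v : upow logu (INR k * v) = (upow logu v ^ k)%C.
Proof. unfold upow. rewrite <- Cexp_INR. f_equal. ring. Qed.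

Lemma multi_term_cons b a s d k n :
  multi_term (b :: a) s d (k :: n)
  = (upow logu (- RtoC b) ^ k * multi_term a s (d + INR k * b) n)%C.
Proof.
  unfold multi_term. simpl dot. rewrite <- upow_INR.
  replace (- RtoC (INR k * b + dot n a))%C with (INR k * - RtoC b + - RtoC (dot n a))%C
    by (rewrite RtoC_plus, RtoC_mult; ring).
  rewrite upow_plus. replace (d + INR k * b + dot n a) with (d + (INR k * b + dot n a)) by ring.
  ring.
Qed.

Lemma base_shift_bound a s : (forall b, In b a -> 0 < b) -> INR (length a) + 1 < Re s ->
  forall b, 0 < b -> exists (B : nat -> R) Bt, bounded_by B Bt /\
    forall d k F, 0 <= d -> multi_indices (length a) F ->
      Rlsum (map (fun n => Cmod (multi_term (b :: a) s d (k :: n))) F) <= B k.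
Proof.
  intros Ha Hs b Hb. destruct (tame_order _ (tame_base x Hx) (Cmod s)) as [A [HA H]].
  set (r := length a) in *. set (al := 1 + (Re s - INR r - 1) / 2).
  destruct (multi_sum_power_bound a Ha (Re s - al)) as [B HB]; [unfold al; fold r; lra|].
  assert (HB0 : 0 <= B) by (apply (HB []); split; [constructor|easy]).
  destruct (bounded_progression al b) as [Bt [HBt0 HBt]]; [unfold al; lra|exact Hb|].
  assert (HAB : 0 <= A * B) by now apply Rmult_le_pos.
  exists (fun k => A * B * Rpower (1 + INR k * b) (- al)), (A * B * Bt). split.
  { split; [intros k; now apply Rmult_le_pos|]. intros n. rewrite rsum_scal.
    now apply Rmult_le_compat_l. }
  intros d k F Hd HF.
  apply Rle_trans with (Rlsum (map (fun n => A * Rpower (1 + INR k * b) (- al) *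
     Rpower (1 + dot n a) (- (Re s - al))) F)).
  - apply Rlsum_le. intros n _. pose proof (dot_nonneg n a Ha) as Hn. unfold multi_term. simpl dot.
    pose proof (Rmult_le_pos (INR k) b (pos_INR k) ltac:(lra)) as Hk.
    rewrite Cmod_mult. pose proof (Cmod_upow_le_1 (INR k * b + dot n a) ltac:(lra)).
    specialize (H s (d + (INR k * b + dot n a)) (Rle_refl _) ltac:(lra)). rewrite Rminus_0_r in H.
    rewrite <- (Rmult_1_l (A * _ * _)). apply Rmult_le_compat; try apply Cmod_ge_0; [assumption|].
    eapply Rle_trans; [exact H|]. rewrite Rmult_assoc. apply Rmult_le_compat_l; [exact HA|].
    replace (- Re s) with (- al + - (Re s - al)) by ring. rewrite Rpower_plus.
    pose proof (pos_INR r).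
    apply Rmult_le_compat; try (left; apply exp_pos); apply Rpower_anti; unfold al; lra.
  - rewrite Rlsum_scal.
    replace (A * B * Rpower (1 + INR k * b) (- al)) with (A * Rpower (1 + INR k * b) (- al) * B) by ring.
    apply Rmult_le_compat_l; [|now apply HB]. apply Rmult_le_pos; [exact HA|left; apply exp_pos].
Qed.

(** [telescoping] writes G(s, d) as the sum over the first index of q^k s G'(s + 1, d + k b). The
    induction hypothesis at s + 1 expands each term, and the factors [s] accumulate to the rising
    factorial. *)
Lemma l_family_series a G : (forall b, In b a -> 0 < b) -> l_family a G ->
  forall s d, 0 < Re s -> 0 <= d ->
  is_multi_series (length a)
    (fun n => rising (length a) s * multi_term a (s + INR (length a)) d n)%C (G s d).
Proof.
  revert G. induction a as [|b a IH]; intros G Ha HG s d Hs Hd.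
  - simpl in HG. subst G. simpl.
    eapply is_multi_series_ext; [|apply (is_multi_series_nil (fun _ => base_family x s d))].
    intros n Hn. apply length_zero_iff_nil in Hn. subst n.
    unfold multi_term. simpl. rewrite Rplus_0_r. unfold upow.
    replace (- 0 * logu)%C with (RtoC 0) by ring. rewrite Cexp_0.
    replace (s + 0)%C with s by ring. ring.
  - destruct HG as [HGt [G' [HG' HE]]]. simpl length. set (r := length a) in *.
    assert (Hb : 0 < b) by (apply Ha; now left).
    assert (Ha' : forall c, In c a -> 0 < c) by (intros; apply Ha; now right).
    set (q := upow logu (- RtoC b)).
    assert (Hq : Cmod q <= 1) by (apply Cmod_upow_le_1; lra).
    assert (Hkb : forall k, 0 <= d + INR k * b).
    { intros k. pose proof (Rmult_le_pos (INR k) b (pos_INR k) ltac:(lra)). lra. }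
    assert (Hsr : Re (s + INR (S r))%C = Re s + INR (S r)) by reflexivity.
    destruct (base_shift_bound a (s + INR (S r))%C Ha' ltac:(rewrite Hsr, S_INR; fold r; lra) b Hb)
      as [B [Bt [[HB0 HBt] HB]]].
    set (ri := rising (S r) s).
    apply is_multi_series_cons with (s := fun k => (q ^ k * (s * G' (s + 1) (d + INR k * b)%R))%C)
      (B := fun k => Cmod ri * B k) (Bt := Cmod ri * Bt).
    + split; [intros k; apply Rmult_le_pos; [apply Cmod_ge_0|apply HB0]|].
      intros n. rewrite rsum_scal. apply Rmult_le_compat_l; [apply Cmod_ge_0|apply HBt].
    + intros k F HF.
      rewrite (map_ext _ (fun n => Cmod ri * Cmod (multi_term (b :: a) (s + INR (S r)) d (k :: n))))
        by (intros n; apply Cmod_mult).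
      rewrite Rlsum_scal. apply Rmult_le_compat_l; [apply Cmod_ge_0|]. now apply HB.
    + intros k.
      assert (Hs1 : 0 < Re (s + 1)%C) by (unfold Re in *; simpl; lra).
      pose proof (IH G' Ha' HG' (s + 1)%C (d + INR k * b) Hs1 (Hkb k)) as Hm.
      apply (is_multi_series_scal _ (q ^ k * s)%C) in Hm.
      replace (q ^ k * (s * G' (s + 1) (d + INR k * b)%R))%C
        with (q ^ k * s * G' (s + 1) (d + INR k * b)%R)%C by ring.
      eapply is_multi_series_ext; [|exact Hm]. intros n _. cbv beta.
      rewrite multi_term_cons. fold q r. unfold ri. simpl rising.
      rewrite S_INR, RtoC_plus. replace (s + 1 + INR r)%C with (s + (INR r + 1))%C by ring. ring.
    + eapply cser_ext; [|apply (telescoping 0 G b q s d Hb (tame_order G HGt) ltac:(lra) Hq Hd)].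
      intros k. cbv beta. unfold q. now rewrite HE.
Qed.

End Family.

(** * The domain of the continuation *)

(** The plane without the real segment [1, r], which contains every possible pole. Removing the
    whole segment rather than [r] points makes connectedness provable with straight lines. *)
Definition slit_free (r : nat) (s : C) : Prop := Im s <> 0 \/ INR r < Re s \/ Re s < 1.

Lemma Im_le_Cmod (z : C) : Rabs (Im z) <= Cmod z.
Proof. eapply Rle_trans; [apply Rmax_r|apply Rmax_Cmod]. Qed.

Lemma slit_free_open r : open (slit_free r).
Proof.
  apply open_C. intros z Hz.
  assert (HR : forall w, Rabs (Re w - Re z) <= Cmod (w - z)) by (intros w; apply (re_le_Cmod (w - z))).
  assert (HI : forall w, Rabs (Im w - Im z) <= Cmod (w - z)) by (intros w; apply (Im_le_Cmod (w - z))).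
  destruct Hz as [Hz|[Hz|Hz]].
  - exists (Rabs (Im z)). split; [now apply Rabs_pos_lt|]. intros w Hw. left. intros H0.
    specialize (HI w). rewrite H0 in HI. unfold Rminus in HI. rewrite Rplus_0_l, Rabs_Ropp in HI. lra.
  - exists (Re z - INR r). split; [lra|]. intros w Hw. right; left.
    specialize (HR w). apply Rabs_le_between in HR. lra.
  - exists (1 - Re z). split; [lra|]. intros w Hw. right; right.
    specialize (HR w). apply Rabs_le_between in HR. lra.
Qed.

(** A supremum argument: at the last parameter reached by [U], openness of [U] would carry it
    further unless it is 1, and openness of [V] would keep [U] away. *)
Lemma segment_connected (D U V : C -> Prop) (p q : C) :
  open U -> open V -> (forall z, D z -> U z \/ V z) ->
  (forall z, D z -> ~ (U z /\ V z)) ->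
  (forall t, 0 <= t <= 1 -> D (p + RtoC t * (q - p))%C) -> U p -> U q.
Proof.
  intros HU HV HUV Hdis Hseg Hp. set (g := fun t : R => (p + RtoC t * (q - p))%C).
  assert (Hg : forall O, open O -> forall t, O (g t) ->
    exists e, 0 < e /\ forall t', Rabs (t' - t) < e -> O (g t')).
  { intros O HO t Ht. destruct (proj1 (open_C O) HO _ Ht) as [eps [He H]].
    pose proof (Cmod_ge_0 (q - p)) as Hm.
    exists (eps / (Cmod (q - p) + 1)). split; [apply Rdiv_lt_0_compat; lra|].
    intros t' Ht'. apply H. unfold g.
    replace (p + t' * (q - p) - (p + t * (q - p)))%C with (RtoC (t' - t) * (q - p))%C
      by (rewrite RtoC_minus; ring).
    rewrite Cmod_mult, Cmod_R.
    apply Rmult_lt_compat_r with (r := Cmod (q - p) + 1) in Ht'; [|lra].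
    replace (eps / (Cmod (q - p) + 1) * (Cmod (q - p) + 1)) with eps in Ht' by (field; lra).
    pose proof (Rabs_pos (t' - t)). nra. }
  assert (H0 : g 0 = p) by (unfold g; ring). assert (H1 : g 1 = q) by (unfold g; ring).
  destruct (completeness (fun t => 0 <= t <= 1 /\ U (g t))) as [m [Hub Hlub]].
  { exists 1. intros t [Ht _]. lra. }
  { exists 0. split; [lra|]. now rewrite H0. }
  assert (Hm0 : 0 <= m) by (apply Hub; split; [lra|now rewrite H0]).
  assert (Hm1 : m <= 1) by (apply Hlub; intros t [Ht _]; lra).
  destruct (HUV (g m) (Hseg m ltac:(lra))) as [HmU|HmV].
  - destruct (Req_dec m 1) as [->|Hne]; [now rewrite <- H1|exfalso].
    destruct (Hg U HU m HmU) as [e [He H]].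
    set (t := m + Rmin (e / 2) (1 - m)).
    assert (Hr : 0 < Rmin (e / 2) (1 - m)) by (apply Rmin_pos; lra).
    pose proof (Rmin_l (e / 2) (1 - m)). pose proof (Rmin_r (e / 2) (1 - m)).
    assert (Htm : t <= m); [|unfold t in Htm; lra].
    apply Hub. split; [unfold t; lra|]. apply H. unfold t.
    replace (m + Rmin (e / 2) (1 - m) - m) with (Rmin (e / 2) (1 - m)) by ring.
    rewrite Rabs_pos_eq; lra.
  - exfalso. destruct (Hg V HV m HmV) as [e [He H]].
    assert (Hle : m <= m - e); [|lra].
    apply Hlub. intros t [Ht HtU]. apply Rnot_lt_le. intros Hlt.
    assert (Htm : t <= m) by (apply Hub; now split).
    apply (Hdis (g t)); [now apply Hseg|]. split; [exact HtU|].
    apply H. apply Rabs_def1; lra.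
Qed.

(** Every point is joined to r + 1: off the real axis by one segment, on the axis after a vertical
    move by [Ci]. *)
Lemma slit_free_connected r : connected (slit_free r).
Proof.
  intros U V HU HV HUV [z1 [Hz1 HU1]] [z2 [Hz2 HV2]]. apply NNPP. intros Hno.
  assert (Hdis : forall z, slit_free r z -> ~ (U z /\ V z)) by (intros z Hz H; apply Hno; now exists z).
  assert (Hseg : forall p q, (forall t, 0 <= t <= 1 -> slit_free r (p + RtoC t * (q - p))%C) ->
    (U p <-> U q)).
  { intros p q H. split; apply (segment_connected (slit_free r) U V); try assumption.
    intros t Ht. replace (q + t * (p - q))%C with (p + RtoC (1 - t) * (q - p))%C
      by (rewrite RtoC_minus; ring). apply H. lra. }
  assert (Hbase : forall z, slit_free r z -> (U z <-> U (RtoC (INR r + 1)))).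
  { assert (Hoff : forall z, Im z <> 0 -> (U z <-> U (RtoC (INR r + 1)))).
    { intros z Hz. apply Hseg. intros t Ht. destruct (Req_dec t 1) as [->|Hne].
      - right; left. replace (z + 1 * (RtoC (INR r + 1) - z))%C with (RtoC (INR r + 1)) by ring.
        simpl. lra.
      - left. replace (Im (z + t * (RtoC (INR r + 1) - z))%C) with ((1 - t) * Im z)
          by (unfold Im; simpl; ring).
        apply Rmult_integral_contrapositive. split; [lra|exact Hz]. }
    intros z Hz. destruct (Req_dec (Im z) 0) as [H0|H0]; [|now apply Hoff].
    rewrite <- (Hoff (z + Ci)%C) by (unfold Im in *; simpl; lra).
    apply Hseg. intros t Ht. destruct (Req_dec t 0) as [->|Hne].
    - replace (z + 0 * (z + Ci - z))%C with z by ring. exact Hz.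
    - left. unfold Im in *. simpl. lra. }
  apply (Hdis z2 Hz2). split; [|exact HV2].
  apply (Hbase z2 Hz2), (Hbase z1 Hz1), HU1.
Qed.

(** * The rising factorial *)

Lemma rising_zero r s : rising r s = RtoC 0 -> Im s = 0 /\ 1 - INR r <= Re s <= 0.
Proof.
  revert s. induction r as [|r IH]; intros s H.
  - simpl in H. exfalso. apply RtoC_inj in H. lra.
  - simpl rising in H. pose proof (pos_INR r) as Hr. rewrite S_INR.
    destruct (classic (s = RtoC 0)) as [->|Hs]; [simpl; lra|].
    destruct (classic (rising r (s + 1) = RtoC 0)) as [H1|H1].
    + apply IH in H1. unfold Re, Im in *. simpl in H1. lra.
    + exfalso. now apply (Cmult_neq_0 _ _ Hs H1).
Qed.

Lemma rising_S r s : rising (S r) s = (s * rising r (s + 1))%C.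
Proof. reflexivity. Qed.

Lemma rising_neg r n :
  (rising r (- RtoC (INR (n + r))) * INR (fact n))%C = ((- (1)) ^ r * INR (fact (n + r)))%C.
Proof.
  induction r as [|r IH]; [rewrite Nat.add_0_r; simpl; ring|].
  rewrite Nat.add_succ_r, rising_S.
  replace (- RtoC (INR (S (n + r))) + 1)%C with (- RtoC (INR (n + r)))%C
    by (rewrite S_INR, RtoC_plus; ring).
  rewrite <- Cmult_assoc, IH, fact_simpl, mult_INR, RtoC_mult, Cpow_S. ring.
Qed.

Lemma has_ps_rising r z R : exists c, has_ps c R (fun w => rising r (z + w)).
Proof.
  revert z. induction r as [|r IH]; intros z.
  - eexists. exact (has_ps_const (RtoC 1) R).
  - destruct (IH (z + 1)%C) as [c Hc]. destruct (has_ps_mult_lin z _ _ _ Hc) as [d Hd].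
    exists d. eapply has_ps_ext; [|exact Hd]. intros w _. cbv beta. simpl.
    do 2 f_equal. ring.
Qed.

Lemma analytic_at_rising_mult r a f z : analytic_at f z ->
  analytic_at (fun s => rising r (s + a) * f s)%C z.
Proof.
  intros [c [R [HR Hc]]]. destruct (has_ps_rising r (z + a)%C R) as [d Hd].
  exists (conv d c), R. split; [exact HR|].
  eapply has_ps_ext; [|exact (has_ps_mult _ _ _ _ _ Hd Hc)].
  intros w _. cbv beta. do 2 f_equal. ring.
Qed.

Lemma analytic_at_minus f g z : analytic_at f z -> analytic_at g z ->
  analytic_at (fun s => f s - g s)%C z.
Proof.
  intros [c [R [HR Hc]]] [d [R' [HR' Hd]]].
  exists (fun k => c k + (- (1)) * d k)%C, (Rmin R R'). split; [now apply Rmin_pos|].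
  eapply has_ps_ext; [|exact (has_ps_plus _ _ _ _ _ (has_ps_mono _ _ _ _ (Rmin_l _ _) Hc)
    (has_ps_scal (- (1)) _ _ _ (has_ps_mono _ _ _ _ (Rmin_r _ _) Hd)))].
  intros w _. cbv beta. ring.
Qed.

(** * The generating function *)

Section GeneratingFunction.

Variables (logu x : C).

Let q (b : R) : C := upow logu (- RtoC b).

Let kernel (b : R) (j : nat) : C :=
  ((if (j =? 0)%nat then 1 else 0) - q b * RtoC (b ^ j / INR (fact j)))%C.

(* Coefficients of [e^(xt) / prod_j (1 - q_j e^(a_j t))]. *)
Fixpoint gen_coef (a : list R) : nat -> C :=
  match a with
  | [] => fun n => (x ^ n / INR (fact n))%C
  | b :: a => conv_solve (kernel b) (gen_coef a)
  end.

Lemma INR_fact_C n : RtoC (INR (fact n)) <> RtoC 0.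
Proof. intros H. apply RtoC_inj in H. revert H. apply INR_fact_neq_0. Qed.

Lemma RtoC_pow_fact b n : RtoC (b ^ n / INR (fact n)) = (RtoC b ^ n / INR (fact n))%C.
Proof. rewrite RtoC_div by apply INR_fact_neq_0. now rewrite RtoC_pow. Qed.

Lemma kernel_has_ps b R : has_ps (kernel b) R (fun t => 1 - q b * Cexp (b * t))%C.
Proof.
  intros w Hw.
  pose proof (has_ps_plus _ _ _ _ _ (has_ps_const (RtoC 1) R)
    (has_ps_scal (- q b) _ _ _ (has_ps_Cexp (RtoC b) R)) w Hw) as H. cbv beta in H.
  replace (1 - q b * Cexp (b * w))%C with (1 + - q b * Cexp (b * w))%C by ring.
  eapply cser_ext; [|exact H]. intros k. cbv beta. f_equal. unfold kernel.
  rewrite RtoC_pow_fact. destruct k; simpl (_ =? _)%nat; cbv iota; ring.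
Qed.

Lemma kernel_0 b : kernel b 0 = (1 - q b)%C.
Proof. unfold kernel. simpl. replace (1 / 1) with 1 by field. ring. Qed.

Lemma gen_coef_has_ps a : (forall b, In b a -> q b <> RtoC 1) ->
  exists r, 0 < r /\
    has_ps (gen_coef a) r
      (fun t => Cprod (map (fun b => / (1 - q b * Cexp (b * t))) a) * Cexp (x * t))%C /\
    forall t b, Cmod t < r -> In b a -> (1 - q b * Cexp (b * t))%C <> RtoC 0.
Proof.
  induction a as [|b a IH]; intros Ha.
  - exists 1. split; [lra|]. split; [|easy].
    eapply has_ps_ext; [|apply has_ps_Cexp]. intros w _. simpl. ring.
  - destruct IH as [r [Hr [Hps Hne]]]; [intros; apply Ha; now right|].
    assert (Hk : kernel b 0 <> RtoC 0).
    { rewrite kernel_0. apply Cminus_eq_contra, not_eq_sym, Ha. now left. }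
    destruct (has_ps_div _ _ _ _ _ _ Hr (kernel_has_ps b r) Hps Hk (conv_solve_correct _ _ Hk))
      as [r' [[Hr0 Hr1] [Hps' Hne']]].
    exists r'. split; [exact Hr0|]. split.
    + eapply has_ps_ext; [|exact Hps']. intros w _. cbv beta. simpl. unfold Cdiv. ring.
    + intros t c Ht [->|Hc]; [now apply Hne'|]. apply Hne; [lra|exact Hc].
Qed.

Definition H_value (a : list R) (n : nat) : C :=
  (Cprod (map (fun b => 1 - q b) a) * (INR (fact n) * gen_coef a n))%C.

Lemma upow_opp (b : R) : (upow logu b * q b)%C = RtoC 1.
Proof.
  unfold q. rewrite <- upow_plus. replace (b + - RtoC b)%C with (RtoC 0) by ring.
  unfold upow. replace (0 * logu)%C with (RtoC 0) by ring. apply Cexp_0.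
Qed.

Lemma Cprod_zero {T} (f : T -> C) a b : In b a -> f b = RtoC 0 -> Cprod (map f a) = RtoC 0.
Proof.
  induction a as [|c a IH]; intros Hb Hf; [easy|].
  simpl. fold (Cprod (map f a)). destruct Hb as [->|Hb]; [rewrite Hf|rewrite (IH Hb Hf)]; ring.
Qed.

(** Numerator and denominator are divided by -u^b, which turns u^b into its inverse q_b. *)
Lemma H_genfun_factor (b : R) (t : C) : (1 - q b * Cexp (b * t))%C <> RtoC 0 ->
  ((1 - upow logu b) / (Cexp (b * t) - upow logu b))%C = ((1 - q b) * / (1 - q b * Cexp (b * t)))%C.
Proof.
  intros Hne. pose proof (upow_opp b) as Ho. set (v := upow logu b) in *.
  set (e := Cexp (b * t)) in *.
  assert (Hd : (e - v)%C <> RtoC 0).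
  { intros H0. apply Hne. replace (1 - q b * e)%C with (- q b * (e - v))%C.
    - rewrite H0. ring.
    - rewrite <- Ho. ring. }
  assert (H1 : (1 - v)%C = (- v * (1 - q b))%C) by (transitivity (v * q b - v)%C; [now rewrite Ho|ring]).
  assert (H2 : (e - v)%C = (- v * (1 - q b * e))%C).
  { transitivity (v * q b * e - v)%C; [rewrite Ho|]; ring. }
  assert (Hv : v <> RtoC 0).
  { intros H0. rewrite H0, Cmult_0_l in Ho. apply RtoC_inj in Ho. lra. }
  rewrite H1, H2. field. split; [exact Hne|]. intros H0. apply Hv.
  replace v with (- - v)%C by ring. rewrite H0. ring.
Qed.

Lemma is_H_degenerate a b : In b a -> q b = RtoC 1 -> is_H logu x a (fun _ => RtoC 0).
Proof.
  intros Hb Hq. exists 1. split; [lra|]. intros t _. apply cser_is_series.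
  unfold H_genfun. rewrite (Cprod_zero _ a b Hb).
  - rewrite Cmult_0_l. eapply cser_ext; [|apply cser_zero]. intros n. simpl. ring.
  - pose proof (upow_opp b) as Ho. rewrite Hq, Cmult_1_r in Ho. rewrite Ho.
    unfold Cdiv. ring.
Qed.

Lemma is_H_value a : (forall b, In b a -> q b <> RtoC 1) -> is_H logu x a (H_value a).
Proof.
  intros Ha. destruct (gen_coef_has_ps a Ha) as [r [Hr [Hps Hne]]].
  exists r. split; [exact Hr|]. intros t [_ Ht]. apply cser_is_series.
  assert (Hg : H_genfun logu x a t = (Cprod (map (fun b => 1 - q b) a) *
    (Cprod (map (fun b => / (1 - q b * Cexp (b * t))) a) * Cexp (x * t)))%C).
  { unfold H_genfun. rewrite Cmult_assoc. f_equal. clear Hps Ha.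
    induction a as [|b a IH]; [simpl; ring|].
    simpl. rewrite H_genfun_factor by (apply Hne; [exact Ht|now left]).
    unfold Cprod in *. rewrite IH; [ring|]. intros t' c Ht' Hc. apply Hne; [exact Ht'|now right]. }
  rewrite Hg. eapply cser_ext; [|apply cser_scal, Hps, Ht].
  intros n. cbv beta. unfold H_value. field. apply INR_fact_C.
Qed.

Lemma is_H_unique a H1 H2 : is_H logu x a H1 -> is_H logu x a H2 -> forall n, H1 n = H2 n.
Proof.
  intros [r1 [Hr1 Hs1]] [r2 [Hr2 Hs2]] n.
  assert (Hr : 0 < Rmin r1 r2) by now apply Rmin_pos.
  pose proof (Rmin_l r1 r2). pose proof (Rmin_r r1 r2).
  pose proof (has_ps_coef_unique (fun n => H1 n / INR (fact n))%C (fun n => H2 n / INR (fact n))%C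
    (Rmin r1 r2) (H_genfun logu x a) Hr) as Hu.
  assert (He : (H1 n / INR (fact n))%C = (H2 n / INR (fact n))%C).
  { apply Hu.
    - intros w Hw. eapply cser_ext; [|apply cser_is_series, (Hs1 w); lra].
      intros k. cbv beta. field. apply INR_fact_C.
    - intros w Hw. eapply cser_ext; [|apply cser_is_series, (Hs2 w); lra].
      intros k. cbv beta. field. apply INR_fact_C. }
  replace (H1 n) with (H1 n / INR (fact n) * INR (fact n))%C by (field; apply INR_fact_C).
  rewrite He. field. apply INR_fact_C.
Qed.

(** * Values at the nonpositive integers *)

Lemma Dcoef_neg M j : (j <= M)%nat ->
  (Dcoef j (- RtoC (INR M)) * INR (fact (M - j)))%C = RtoC (INR (fact M)).
Proof.
  revert M. induction j as [|j IH]; intros M Hj; [simpl; rewrite Nat.sub_0_r; ring|].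
  destruct M as [|M]; [lia|]. rewrite Nat.sub_succ.
  change (Dcoef (S j) (- RtoC (INR (S M)))) with
    (- - RtoC (INR (S M)) * Dcoef j (- RtoC (INR (S M)) + 1))%C.
  replace (- - RtoC (INR (S M)))%C with (RtoC (INR (S M))) by ring.
  replace (- RtoC (INR (S M)) + 1)%C with (- RtoC (INR M))%C by (rewrite S_INR, RtoC_plus; ring).
  rewrite <- Cmult_assoc, IH by lia. now rewrite fact_simpl, mult_INR, RtoC_mult.
Qed.

(** Division by M! gives exponential generating series, for which translation in [d] becomes
    multiplication by an exponential. *)
Definition scaled_value (G : C -> R -> C) (M : nat) : C :=
  (G (- RtoC (INR M)) 0 / INR (fact M))%C.

(** At s = -M the Taylor expansion of order M + 1 is exact, and its coefficients [Dcoef] i (-M) = M!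
    / (M - i)! turn it into a convolution. *)
Lemma scaled_value_conv G b M : tame G -> 0 <= b ->
  conv (kernel b) (scaled_value G) M =
  ((G (- RtoC (INR M)) 0 - q b * G (- RtoC (INR M)) (0 + b)%R) / INR (fact M))%C.
Proof.
  intros [_ HG] Hb. destruct (HG (S M) b Hb) as [_ Hv].
  rewrite (Tay_expand (S M) b G), Hv by (lia || lra). rewrite Cplus_0_r.
  unfold conv.
  rewrite (csum_ext _ (fun i => (if (i =? 0)%nat then scaled_value G M else RtoC 0) +
    (- q b / INR (fact M)) * (RtoC (b ^ i / INR (fact i)) * Dpow i G (- INR M) 0))%C).
  - rewrite csum_plus, csum_scal, (csum_single _ (S M) 0); [|lia|].
    + simpl (0 =? 0)%nat. cbv iota. unfold scaled_value. field. apply INR_fact_C.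
    + intros j _ Hj. destruct (Nat.eqb_spec j 0); [lia|reflexivity].
  - intros i Hi. rewrite Dpow_Dcoef. unfold kernel, scaled_value.
    replace (- INR M + INR i)%C with (- RtoC (INR (M - i)))%C
      by (rewrite minus_INR by lia; rewrite RtoC_minus; ring).
    pose proof (Dcoef_neg M i ltac:(lia)) as Hc.
    set (g := G (- RtoC (INR (M - i)))%C 0).
    assert (Hg : (g / INR (fact (M - i)))%C = (Dcoef i (- RtoC (INR M)) * g / INR (fact M))%C).
    { rewrite <- Hc. field. split; [apply INR_fact_C|].
      intros H0. rewrite H0, Cmult_0_l in Hc. now apply (INR_fact_C M). }
    destruct (Nat.eqb_spec i 0) as [->|_].
    + unfold g. rewrite Nat.sub_0_r. simpl Dcoef. field. apply INR_fact_C.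
    + rewrite Hg. field. apply INR_fact_C.
Qed.

(** Multiplication of the series of [h] by t^r. *)
Definition shift_coef (r : nat) (h : nat -> C) (M : nat) : C :=
  if (M <? r)%nat then RtoC 0 else h (M - r)%nat.

Lemma conv_shift_coef c h r M : conv c (shift_coef r h) M = shift_coef r (conv c h) M.
Proof.
  unfold shift_coef at 2. destruct (Nat.ltb_spec M r) as [H|H].
  - apply csum_zero. intros i Hi. unfold shift_coef.
    destruct (Nat.ltb_spec (M - i) r); [ring|lia].
  - unfold conv. replace (S M) with (S (M - r) + r)%nat by lia.
    rewrite csum_add, (csum_zero (fun k => c (S (M - r) + k)%nat * _)%C), Cplus_0_r.
    + apply csum_ext. intros i Hi. unfold shift_coef.
      destruct (Nat.ltb_spec (M - i) r); [lia|]. do 2 f_equal. lia.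
    + intros k Hk. unfold shift_coef.
      destruct (Nat.ltb_spec (M - (S (M - r) + k)) r); [ring|lia].
Qed.

(** The right-hand side s G'(s + 1) at s = -(M + 1), divided by (M + 1)!, is minus the [M]-th scaled
    value of [G']: a factor -t per step. Since q_b differs from 1, the kernel can be cancelled. *)
Lemma scaled_value_l_family a G : 0 < Re x -> (forall b, In b a -> 0 < b) ->
  (forall b, In b a -> q b <> RtoC 1) -> l_family logu x a G ->
  forall M, scaled_value G M =
    shift_coef (length a) (fun n => (- (1)) ^ length a * gen_coef a n)%C M.
Proof.
  intros Hx. revert G. induction a as [|b a IH]; intros G Ha Hq HG M.
  - simpl in HG. subst G. unfold scaled_value, shift_coef, base_family. simpl.
    rewrite Nat.sub_0_r.
    replace (- - INR M * Clog (x + 0))%C with (INR M * Clog x)%C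
      by (replace (x + 0)%C with x by ring; ring).
    rewrite Cexp_INR, Cexp_Clog by exact Hx. unfold Cdiv. ring.
  - assert (Hb : 0 < b) by (apply Ha; now left).
    pose proof (l_family_tame logu x Hx _ _ HG) as HGt.
    destruct HG as [_ [G' [HG' HE]]]. simpl length. set (r := length a) in *.
    assert (Hk : kernel b 0 <> RtoC 0).
    { rewrite kernel_0. apply Cminus_eq_contra, not_eq_sym, Hq. now left. }
    revert M. apply (conv_cancel (kernel b) _ _ Hk). intros M.
    rewrite scaled_value_conv by (assumption || lra). rewrite (HE _ 0) by lra.
    rewrite conv_shift_coef. unfold shift_coef at 1.
    destruct M as [|M].
    + destruct (Nat.ltb_spec 0 (S r)); [|lia]. simpl INR. unfold Cdiv. ring.
    + replace (- RtoC (INR (S M)) + 1)%C with (- RtoC (INR M))%C by (rewrite S_INR, RtoC_plus; ring).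
      replace (- RtoC (INR (S M)) * G' (- RtoC (INR M))%C 0 / INR (fact (S M)))%C
        with (- scaled_value G' M)%C.
      2:{ unfold scaled_value. rewrite fact_simpl, mult_INR, RtoC_mult. field.
          split; [apply INR_fact_C|]. intros H0. apply RtoC_inj in H0.
          revert H0. now apply not_0_INR. }
      rewrite (IH G') by (try assumption; intros; (apply Ha || apply Hq); now right).
      unfold shift_coef. change (S M <? S r)%nat with (M <? r)%nat.
      destruct (Nat.ltb_spec M r); [ring|]. rewrite Nat.sub_succ.
      unfold conv.
      rewrite (csum_ext _ (fun i => (- (1)) ^ S r * (kernel b i * gen_coef (b :: a) (M - r - i)%nat))%C)
        by (intros; ring).
      rewrite csum_scal. fold (conv (kernel b) (gen_coef (b :: a)) (M - r)).
      simpl gen_coef. rewrite conv_solve_correct by exact Hk. rewrite Cpow_S. ring.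
Qed.

End GeneratingFunction.

(** * Analytic continuation *)

Lemma l_term_multi_term logu x s a n : l_term logu s x a n = multi_term logu x a s 0 n.
Proof.
  unfold l_term, multi_term, Cpower, base_family. rewrite Rplus_0_l.
  replace (- s * Clog (x + RtoC (dot n a)))%C with (- (s * Clog (x + RtoC (dot n a))))%C by ring.
  now rewrite Cexp_opp.
Qed.

Lemma l_term_series logu x a G s : 1 <= Cmod (Cexp logu) -> 0 < Re x ->
  (forall b, In b a -> 0 < b) -> l_family logu x a G -> INR (length a) < Re s ->
  is_multi_series (length a) (fun n => rising (length a) (s - INR (length a)) * l_term logu s x a n)%C
    (G (s - INR (length a))%C 0).
Proof.
  intros Hu Hx Ha HG Hs.
  assert (Hs' : 0 < Re (s - INR (length a))%C) by (unfold Re in *; simpl; lra).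
  pose proof (l_family_series logu x Hu Hx a G Ha HG _ 0 Hs' (Rle_refl _)) as H.
  eapply is_multi_series_ext; [|exact H]. intros n _. cbv beta.
  rewrite l_term_multi_term. do 2 f_equal. ring.
Qed.

Lemma l_family_analytic logu x a G c z : 0 < Re x -> l_family logu x a G ->
  analytic_at (fun s => G (s + c)%C 0) z.
Proof.
  intros Hx HG. destruct (l_family_tame logu x Hx a G HG) as [He _].
  apply entire_analytic, (entire_shift (fun s => G s 0)), He, Rle_refl.
Qed.

Lemma continuation_exists logu x a : 1 <= Cmod (Cexp logu) -> 0 < Re x ->
  (forall b, In b a -> 0 < b) -> (1 <= length a)%nat ->
  exists l, is_l_continuation logu x (length a) a (slit_free (length a)) l.
Proof.
  intros Hu Hx Ha Hr. set (r := length a) in *.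
  destruct (l_family_exists logu x Hu Hx a Ha) as [G HG].
  assert (Hne : forall s, slit_free r s -> rising r (s - INR r) <> RtoC 0).
  { intros s Hs H0. apply rising_zero in H0. unfold Re, Im in *. simpl in H0.
    destruct H0 as [H0 H1]. apply le_INR in Hr. simpl in Hr.
    unfold slit_free, Re, Im in Hs. lra. }
  exists (fun s => G (s - INR r)%C 0 / rising r (s - INR r))%C.
  split; [apply slit_free_open|]. split; [apply slit_free_connected|].
  split; [intros s Hs; right; now left|]. split.
  - apply analytic_on_iff. intros z Hz.
    destruct (l_family_analytic logu x a G (- INR r)%C z Hx HG) as [e [R [HR He]]].
    destruct (has_ps_rising r (z - INR r)%C R) as [c Hc].
    assert (Hc0 : c O <> RtoC 0).
    { rewrite <- (has_ps_at_0 _ _ _ HR Hc). replace (z - INR r + 0)%C with (z - INR r)%C by ring.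
      now apply Hne. }
    destruct (has_ps_div _ _ _ _ _ _ HR Hc He Hc0 (conv_solve_correct c e Hc0))
      as [r' [[Hr' _] [Hps _]]].
    eexists. exists r'. split; [exact Hr'|].
    eapply has_ps_ext; [|exact Hps]. intros w _. cbv beta.
    replace (z - INR r + w)%C with (z + w - INR r)%C by ring. reflexivity.
  - intros s Hs. pose proof (l_term_series logu x a G s Hu Hx Ha HG Hs) as H. fold r in H.
    assert (Hn : rising r (s - INR r) <> RtoC 0) by (apply Hne; right; now left).
    apply (is_multi_series_scal _ (/ rising r (s - INR r))%C) in H.
    replace (G (s - INR r)%C 0 / rising r (s - INR r))%C
      with (/ rising r (s - INR r) * G (s - INR r)%C 0)%C by (unfold Cdiv; ring).
    eapply is_multi_series_ext; [|exact H]. intros n _. cbv beta. field. exact Hn.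
Qed.

(** Stated as a product, not a quotient, so that the identity theorem applies on any [D], even one
    meeting the zeros of the rising factor. The comparison starts on the unit disc about r + 1,
    inside the half-plane of convergence. *)
Lemma continuation_unique logu x a G D l : 1 <= Cmod (Cexp logu) -> 0 < Re x ->
  (forall b, In b a -> 0 < b) -> l_family logu x a G ->
  is_l_continuation logu x (length a) a D l ->
  forall s, D s -> (rising (length a) (s - INR (length a)) * l s)%C = G (s - INR (length a))%C 0.
Proof.
  intros Hu Hx Ha HG [_ [HD [HDr [Hl Hs]]]] s HsD. set (r := length a) in *.
  apply (proj2 (Ceq_minus _ _)).
  apply (identity_theorem D (fun s => rising r (s - INR r) * l s - G (s - INR r)%C 0)%C
    (RtoC (INR r + 1)) 1); try assumption; try lra.
  - intros z Hz. apply analytic_at_minus.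
    + apply (analytic_at_rising_mult r (- INR r)%C). now apply (proj1 (analytic_on_iff D l) Hl).
    + now apply (l_family_analytic logu x a G (- INR r)%C).
  - apply HDr. simpl. lra.
  - intros w Hw. apply (proj1 (Ceq_minus _ _)).
    assert (Hwr : INR r < Re w).
    { pose proof (re_le_Cmod (w - RtoC (INR r + 1))) as H. apply Rabs_le_between in H.
      unfold Re in *. simpl in H. lra. }
    eapply is_multi_series_unique.
    + apply is_multi_series_scal, Hs, Hwr.
    + now apply l_term_series.
Qed.

(** The two existence clauses keep the last one from being vacuous. The last one covers every
    continuation on every domain and any sequence with the generating function. *)
Theorem theorem2p3 (r : nat) (a : list R) (x u logu : C)
    (hr : (1 <= r)%nat)
    (ha : length a = r)
    (ha_pos : forall b, In b a -> 0 < b)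
    (hx : 0 < Re x)
    (hu : 1 <= Cmod u)
    (hlogu : Cexp logu = u) :
  (exists (D : C -> Prop) (l : C -> C),
      is_l_continuation logu x r a D l /\ forall n : nat, D (- RtoC (INR n))%C) /\
  (exists H : nat -> C, is_H logu x a H) /\
  (forall (D : C -> Prop) (l : C -> C) (H : nat -> C),
      is_l_continuation logu x r a D l -> is_H logu x a H ->
      forall n : nat, D (- RtoC (INR n))%C ->
        (Cprod (map (fun b : R => 1 - upow logu (- RtoC b)) a) * l (- RtoC (INR n)))%C
        = H n).
Proof.
  subst r u. split; [|split].
  - destruct (continuation_exists logu x a hu hx ha_pos hr) as [l Hl].
    exists (slit_free (length a)), l. split; [exact Hl|].
    intros n. right; right. unfold Re. simpl. pose proof (pos_INR n). lra.
  - destruct (classic (exists b, In b a /\ upow logu (- RtoC b) = RtoC 1)) as [[b [Hb Hq]]|Hq].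
    + eexists. exact (is_H_degenerate logu x a b Hb Hq).
    + exists (H_value logu x a). apply is_H_value. intros b Hb H1. apply Hq. now exists b.
  - intros D l H Hl HH n Hn.
    destruct (classic (exists b, In b a /\ upow logu (- RtoC b) = RtoC 1)) as [[b [Hb Hq]]|Hq].
    + rewrite (is_H_unique logu x a H _ HH (is_H_degenerate logu x a b Hb Hq)).
      rewrite (Cprod_zero _ a b Hb); [ring|]. rewrite Hq. ring.
    + assert (Hq' : forall b, In b a -> upow logu (- RtoC b) <> RtoC 1)
        by (intros b Hb H1; apply Hq; now exists b).
      rewrite (is_H_unique logu x a H _ HH (is_H_value logu x a Hq')).
      unfold H_value. f_equal.
      destruct (l_family_exists logu x hu hx a ha_pos) as [G HG].
      pose proof (continuation_unique logu x a G D l hu hx ha_pos HG Hl _ Hn) as HlG.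
      (* The value of l at -n is read off from [G] at -(n + r), because of the shift by [r] in the
         normalisation. *)
      pose proof (scaled_value_l_family logu x a G hx ha_pos Hq' HG (n + length a)) as Hsv.
      unfold scaled_value, shift_coef in Hsv.
      destruct (Nat.ltb_spec (n + length a) (length a)) as [Hlt|_]; [lia|].
      rewrite Nat.add_sub in Hsv. set (k := length a) in *.
      replace (- RtoC (INR n) - INR k)%C with (- RtoC (INR (n + k)))%C in HlG
        by (rewrite plus_INR, RtoC_plus; ring).
      pose proof (rising_neg k n) as Hr. pose proof (INR_fact_C n) as Hfn.
      pose proof (INR_fact_C (n + k)) as Hfk.
      set (ri := rising k (- RtoC (INR (n + k)))) in *.
      assert (Hm1 : ((- (1)) ^ k)%C <> RtoC 0).
      { apply Cpow_nz. intros H0. assert (H1 : RtoC 1 = RtoC 0) by (replace (RtoC 1) with (- - (1))%C by ring; rewrite H0; ring).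
        apply RtoC_inj in H1. lra. }
      assert (Hri : ri <> RtoC 0).
      { intros H0. rewrite H0, Cmult_0_l in Hr. symmetry in Hr. revert Hr. now apply Cmult_neq_0. }
      replace (l (- RtoC (INR n))%C) with (/ ri * (ri * l (- RtoC (INR n))))%C by (field; exact Hri).
      rewrite HlG.
      replace (G (- RtoC (INR (n + k)))%C 0)
        with (G (- RtoC (INR (n + k)))%C 0 / INR (fact (n + k)) * INR (fact (n + k)))%C
        by (field; exact Hfk).
      rewrite Hsv.
      (* By [rising_neg] the sign and (n + k)! cancel against the rising factor and leave n!, as in
         [H_value]. *)
      replace (/ ri * ((- (1)) ^ k * gen_coef logu x a n * INR (fact (n + k))))%C
        with (/ ri * ((- (1)) ^ k * INR (fact (n + k))) * gen_coef logu x a n)%C by ring.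
      rewrite <- Hr. field. exact Hri.
Qed.
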